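(* Let $P$ be a maximal lattice polygon with $g$ interior lattice points and expected gonality $d>1$. Then \[ \dim(\mathbb{M}_P) \leq g + \frac{2g}{d-1} + 2d - 3. \]
   Context: A lattice polygon is the convex hull of a nonempty finite subset of $\mathbb{Z}^2$; its interior polygon $P^{(1)}$ is the convex hull of its interior lattice points. $P$ is maximal if it is not properly contained in another lattice polygon with the same interior polygon. Lattice width $\mathrm{lw}$: least $s$ such that some map $x\mapsto Ax+b$ ($A\in\mathrm{GL}_2(\mathbb{Z})$, $b\in\mathbb{Z}^2$) sends the polygon into $\mathbb{R}\times[0,s]$; segments/points have lattice width $0$, the empty set $-1$. Expected gonality: $\mathrm{egon}(P)=\mathrm{lw}(P^{(1)})+2$, except $\mathrm{egon}(P)=3$ if $P$ is equivalent to $\mathrm{conv}\{(-2,-2),(2,0),(0,2)\}$. A smooth tropical plane curve with Newton polygon $P$ is given by a min-plus tropical polynomial with finite coefficients at all lattice points of $P$ whose induced regular subdivision of $P$ is a unimodular triangulation; its skeleton is the metric graph obtained by deleting infinite rays, retracting leaves, and smoothing 2-valent vertices. $\mathbb{M}_P$ is the set of metric graphs arising as skeletons of such curves; it is a finite union over regular unimodular triangulations $\Delta$ of $P$ of polyhedral cones $\mathbb{M}_\Delta$ in the moduli space of metric graphs, and $\dim\mathbb{M}_P$ is the maximum dimension of these cones. *)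

(* Defs.v *)
From HB Require Import structures.
From mathcomp Require Import all_boot all_order all_algebra finmap.
From mathcomp Require Import all_classical all_reals all_analysis.

Set Implicit Arguments.
Unset Strict Implicit.
Unset Printing Implicit Defensive.

Import Order.TTheory GRing.Theory Num.Theory.
Import numFieldNormedType.Exports.

Local Open Scope fset_scope.
Local Open Scope classical_set_scope.
Local Open Scope ring_scope.

Notation lpoint := 'cV[int]_2.
Notation plane R := 'cV[R]_2.

Definition pt2 (x y : int) : lpoint := \col_(i < 2) (if i == 0 then x else y).

Section Polygons.
Variable R : realType.

Definition emb (z : lpoint) : plane R := map_mx intr z.

Definition conv_hull (S : set (plane R)) : set (plane R) :=
  smallest (fun C : set (plane R) => convex_set C) S.

Definition lattice_polygon (P : set (plane R)) : Prop :=
  exists2 A : {fset lpoint}, A != fset0 & P = conv_hull (emb @` [set` A]).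

Definition lattice_points (P : set (plane R)) : {fset lpoint} :=
  fset_set [set z : lpoint | P (emb z)].

Definition interior_points (P : set (plane R)) : {fset lpoint} :=
  fset_set [set z : lpoint | interior P (emb z)].

Definition interior_polygon (P : set (plane R)) : set (plane R) :=
  conv_hull (emb @` [set` interior_points P]).

Definition maximal_polygon (P : set (plane R)) : Prop :=
  lattice_polygon P /\
  forall Q, lattice_polygon Q -> P `<=` Q ->
    interior_polygon Q = interior_polygon P -> Q = P.

Definition unimodular_map (A : 'M[int]_2) (b : lpoint) (x : plane R) : plane R :=
  map_mx intr A *m x + emb b.

Definition equivalent_polygons (P Q : set (plane R)) : Prop :=
  exists (A : 'M[int]_2) (b : lpoint),
    A \in unitmx /\ Q = unimodular_map A b @` P.

Definition fits_in_strip (P : set (plane R)) (s : nat) : Prop :=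
  exists (A : 'M[int]_2) (b : lpoint), A \in unitmx /\
    forall x, P x -> 0 <= unimodular_map A b x 1 0 <= s%:R.

Definition lattice_width (P : set (plane R)) : int :=
  if `[< P = set0 >] then -1
  else Posz (xget 0%N [set s | fits_in_strip P s /\
                       forall t, fits_in_strip P t -> (s <= t)%N]).

Definition exceptional_triangle : set (plane R) :=
  conv_hull (emb @` [set` [fset pt2 (-2) (-2); pt2 2 0; pt2 0 2]]).

Definition egon (P : set (plane R)) : int :=
  if `[< equivalent_polygons P exceptional_triangle >] then 3
  else lattice_width (interior_polygon P) + 2.

End Polygons.

Section Subdivisions.
Variable R : realType.

(* Value at w of the tropical monomial with exponent a of the min-plus
   polynomial with coefficients h. *)
Definition trop_monomial (h : lpoint -> R) (w : plane R) (a : lpoint) : R :=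
  h a + \sum_(i < 2) (a i 0)%:~R * w i 0.

(* The exponents of A at which the tropical polynomial attains its minimum
   at w: the vertex set of the cell dual to the face of the curve through w. *)
Definition dual_cell (A : {fset lpoint}) (h : lpoint -> R) (w : plane R) :
    {fset lpoint} :=
  [fset a in A | all (fun b => trop_monomial h w a <= trop_monomial h w b) A].

Definition orientation (a b c : lpoint) : int :=
  \det (row_mx (b - a) (c - a) : 'M[int]_2).

Definition two_dimensional (T : {fset lpoint}) : Prop :=
  exists a b c, [/\ a \in T, b \in T, c \in T & orientation a b c != 0].

Definition unimodular_triangle (T : {fset lpoint}) : Prop :=
  exists a b c, T = [fset a; b; c] /\ `|orientation a b c| = 1.

(* A subdivision is given by the vertex sets of its two-dimensional cells. *)
Definition induces (A : {fset lpoint}) (h : lpoint -> R)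
    (D : {fset {fset lpoint}}) : Prop :=
  forall T, T \in D <-> (two_dimensional T /\ exists w, dual_cell A h w = T).

Definition regular_unimodular (A : {fset lpoint}) (D : {fset {fset lpoint}}) :
    Prop :=
  (forall T, T \in D -> unimodular_triangle T) /\ exists h, induces A h D.

End Subdivisions.

(* Finite simple graphs, given by their set of edges (two-element sets). *)
Section Graphs.
Variable V : finType.
Implicit Types E : {set {set V}}.

Definition degree E (v : V) : nat := #|[set e in E | v \in e]|.

Definition remove_leaves E : {set {set V}} :=
  [set e in E | [forall v in e, degree E v != 1%N]].

(* #|E| rounds suffice, since a round that removes no edge is stable. *)
Definition retract_leaves E : {set {set V}} := iter #|E| remove_leaves E.

Definition joined_at_2valent E : rel {set V} :=
  fun e f => [&& e \in E, f \in E &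
    [exists v, [&& v \in e, v \in f & degree E v == 2%N]]].

(* Each edge of the graph obtained by smoothing the 2-valent vertices is the
   set of the edges of E that it is made of. *)
Definition smooth_edges E : {set {set {set V}}} :=
  equivalence_partition (connect (joined_at_2valent E)) E.

End Graphs.

Section Moduli.
Variable R : realType.

(* The bounded edges of a smooth tropical curve dual to D: the vertices of the
   curve are the triangles in D. *)
Definition bounded_edges (D : {fset {fset lpoint}}) : {set {set D}} :=
  [set e : {set D} | [exists S : D, exists T : D,
    (e == [set S; T]%SET) && (#|` (val S `&` val T)%fset| == 2%N)]]%SET.

Definition skeleton_edges (D : {fset {fset lpoint}}) : {set {set {set D}}} :=
  smooth_edges (retract_leaves (bounded_edges D)).

Definition lattice_length (v : plane R) : R :=
  xget 0 [set l | 0 <= l /\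
    exists u : lpoint, coprimez (u 0 0) (u 1 0) /\ v = l *: emb R u].

Definition curve_vertex (A : {fset lpoint}) (h : lpoint -> R)
    (T : {fset lpoint}) : plane R :=
  xget 0 [set w | dual_cell A h w = T].

Definition edge_length (A : {fset lpoint}) (h : lpoint -> R)
    (D : {fset {fset lpoint}}) (e : {set D}) : R :=
  xget 0 [set l | exists S T : D, e = [set S; T]%SET /\
    l = lattice_length (curve_vertex A h (val S) - curve_vertex A h (val T))].

Definition skeleton_lengths (A : {fset lpoint}) (D : {fset {fset lpoint}})
    (h : lpoint -> R) : 'rV[R]_#|skeleton_edges D| :=
  \row_(i < #|skeleton_edges D|)
    \sum_(e in (enum_val i : {set {set D}})) edge_length A h e.

(* Metric graphs of the combinatorial type of the skeleton are recorded by
   their edge lengths; the moduli space glues the quotients of these orthants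
   by the finite automorphism groups of the graphs, which does not affect
   dimensions. *)
Definition moduli_cone (A : {fset lpoint}) (D : {fset {fset lpoint}}) :
    set 'rV[R]_#|skeleton_edges D| :=
  [set skeleton_lengths A D h | h in [set h | induces A h D]].

(* Dimension of the linear span. *)
Definition cone_dim (n : nat) (C : set 'rV[R]_n) : nat :=
  \max_(k < n.+1 | `[< exists X : k.-tuple 'rV[R]_n,
                        free X /\ forall x, x \in X -> C x >]) k.

Definition dim_moduli (P : set (plane R)) : nat :=
  let A := lattice_points P in
  \max_(D <- fpowerset (fpowerset A) | `[< regular_unimodular R A D >])
    cone_dim (@moduli_cone A D).

End Moduli.

(* Main.v *)
(** The length of a bounded edge dual to a segment ab, with adjacent unimodular
    triangles abc and abz, is h c + h z - al * h a - be * h b, where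
    c + z = al * a + be * b. So the skeleton lengths are linear in h, affine
    functions lie in the kernel, and the dimension of a moduli cone is at most
    #|A| - 3 - #|K| for any set K of lattice points whose indicator functions
    lie in the kernel (null points) and whose complement is not collinear.

    Null points come from the edges of P. Choose lattice coordinates in which
    P has a horizontal bottom edge with L + 1 lattice points, and let the next
    row contain m interior lattice points. Each unit segment of the bottom edge
    is the base of a triangle whose apex lies in that row, and the apexes are
    ordered from left to right. A bottom point between two equal apexes is null:
    it occurs in three consecutive edges of one skeleton edge with coefficients
    1, -2, 1. A corner whose apex is on the boundary is null as well, since its
    triangle is retracted. This gives at least L - m null points.

    Let d = s + 2 with s the width of the interior polygon. If P has width d in
    a direction where its interior polygon occupies the rows 1, ..., d - 1, then
    counting rows and applying the previous bound to the bottom and top rows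
    reduces the theorem to an estimate of the interior points from below by
    interpolation between the rows 1 and d - 1. Otherwise, choosing among the
    directions of minimal interior width one in which P is narrowest forces P to
    be the (s + 3)-fold unimodular triangle, where two sides give three null
    points. The exceptional triangle has only ten lattice points. *)

Require Import Defs.
From mathcomp Require Import all_boot all_order all_algebra finmap.
From mathcomp Require Import all_classical all_reals all_analysis.
From mathcomp Require Import zify ring lra.

Set Implicit Arguments.
Unset Strict Implicit.
Unset Printing Implicit Defensive.

Import Order.TTheory GRing.Theory Num.Theory.
Import numFieldNormedType.Exports.

Local Open Scope fset_scope.
Local Open Scope classical_set_scope.
Local Open Scope ring_scope.

(** * Lattice triangles *)

(** Number the rows of P by 0, ..., s + 2 and let row i have c_i lattice points, m_i of them
    interior. The null points are counted so that at most m_1 + 1 points of row 0 survive, and at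
    most m_(s+1) + 1 of row s + 2. The other rows have at most two boundary points each, so for s >
    0 the dimension is at most g + (c_1 + c_(s+1)) + 2 (s - 1) - 1. Interpolation gives (s + 1) (c_1
    + c_(s+1)) <= 2 g + 4 (s + 1); as s + 1 = d - 1, this is the origin of 2 g / (d - 1). The
    obstacle is a direction in which P reaches k >= 2 rows below its interior strip. Row -1 then has
    no interior lattice point, although the segment from an interior lattice point of row 0 to a
    point of row -k crosses it inside P. Hence P meets row -1 within one unit segment. Seen from the
    deep point, this window confines the rest of P to a cone whose two sides give two more
    directions of interior width at most s; minimality of the width of P in these directions
    determines the corners. *)

Definition px (T : Type) (a : 'cV[T]_2) : T := a ord0 ord0.
Definition py (T : Type) (a : 'cV[T]_2) : T := a (lift ord0 ord0) ord0.

Lemma cV2_eq (T : Type) (a b : 'cV[T]_2) : px a = px b -> py a = py b -> a = b.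
Proof.
move=> hx hy; apply/matrixP => i j; rewrite (ord1 j).
by case: (unliftP ord0 i) => [k|] ->; rewrite ?(ord1 k).
Qed.

Lemma pxE (T : Type) (a : 'cV[T]_2) : a 0 0 = px a. Proof. by []. Qed.

Lemma pyE (T : Type) (a : 'cV[T]_2) : a 1 0 = py a.
Proof. by rewrite /py; congr (a _ _); apply/val_inj. Qed.

Lemma det_mx2 (R : comPzRingType) (M : 'M[R]_2) :
  \det M = M ord0 ord0 * M (lift ord0 ord0) (lift ord0 ord0)
           - M (lift ord0 ord0) ord0 * M ord0 (lift ord0 ord0).
Proof.
have R' n i0 (N : 'M[R]_(2, n)) i j : row' i0 N i j = N (lift i0 i) j by rewrite mxE.
have C' n j0 (N : 'M[R]_(n, 2)) i j : col' j0 N i j = N i (lift j0 j) by rewrite mxE.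
rewrite (expand_det_row _ ord0) !big_ord_recl big_ord0 addr0.
rewrite /cofactor !det_mx11 !R' !C' /=.
have -> : lift ord0 ord0 = lift ord0 0 :> 'I_2 by [].
have -> : lift (lift ord0 0) 0 = ord0 :> 'I_2 by apply/val_inj.
by rewrite expr0 mul1r expr1; ring.
Qed.

Lemma det_row_mx2 (R : comPzRingType) (u v : 'cV[R]_2) :
  \det (row_mx u v : 'M[R]_2) = px u * py v - py u * px v.
Proof.
have E0 i : (row_mx u v : 'M[R]_2) i ord0 = u i ord0.
  by rewrite -(row_mxEl u v); congr (row_mx _ _ _ _); apply/val_inj.
have E1 i : (row_mx u v : 'M[R]_2) i (lift ord0 ord0) = v i ord0.
  by rewrite -(row_mxEr u v); congr (row_mx _ _ _ _); apply/val_inj.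
by rewrite det_mx2 !E0 !E1.
Qed.

Lemma orientationE (a b c : lpoint) : orientation a b c =
  (px b - px a) * (py c - py a) - (py b - py a) * (px c - px a).
Proof. by rewrite /orientation det_row_mx2 /px /py !mxE. Qed.

Lemma trop_monomialE (R : realType) (h : lpoint -> R) w a :
  trop_monomial h w a = h a + ((px a)%:~R * px w + (py a)%:~R * py w).
Proof. by rewrite /trop_monomial !big_ord_recl big_ord0 addr0. Qed.

Lemma dual_cellP (R : realType) (A : {fset lpoint}) (h : lpoint -> R) w a :
  reflect (a \in A /\ forall b, b \in A ->
             trop_monomial h w a <= trop_monomial h w b)
          (a \in dual_cell A h w).
Proof.
apply: (iffP idP); rewrite /dual_cell !inE /=.
  by case/andP => aA /allP.
by case=> aA ha; apply/andP; split=> //; apply/allP.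
Qed.

Lemma orientation_rot (a b c : lpoint) : orientation a b c = orientation b c a.
Proof. by rewrite !orientationE; ring. Qed.

Lemma orientation_swap (a b c : lpoint) : orientation a b c = - orientation b a c.
Proof. by rewrite !orientationE; ring. Qed.

Lemma fset3_rot (K : choiceType) (a b c : K) :
  [fset a; b; c]%fset = [fset b; c; a]%fset.
Proof. by apply/fsetP => x; rewrite !inE -orbA orbC. Qed.

Lemma fset3_swap (K : choiceType) (a b c : K) :
  [fset a; b; c]%fset = [fset b; a; c]%fset.
Proof. by rewrite [[fset a; b]%fset]fsetUC. Qed.

Lemma unimodular_neq (a b c : lpoint) : `|orientation a b c| = 1 ->
  [/\ a != b, a != c & b != c].
Proof.
rewrite orientationE => h.
by split; apply/eqP => E; move: h; rewrite E; lia.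
Qed.

Lemma card_unimodular (a b c : lpoint) : `|orientation a b c| = 1 ->
  #|` [fset a; b; c]%fset| = 3%N.
Proof.
move/unimodular_neq => [ab ac bc]; rewrite cardfsU cardfs2 cardfs1 ab.
have -> : ([fset a; b] `&` [fset c])%fset = fset0.
  apply/fsetP => x; rewrite !inE; apply/negP => /andP[/orP[]/eqP-> /eqP E];
  by rewrite E eqxx in ac bc.
by rewrite cardfs0.
Qed.

Lemma unimodular_apex (T : {fset lpoint}) a b :
  unimodular_triangle T -> a \in T -> b \in T -> a != b ->
  exists2 c, T = [fset a; b; c]%fset & `|orientation a b c| = 1.
Proof.
move=> [u [v [w [-> o1]]]]; rewrite !inE -!orbA.
have o2 : `|orientation v w u| = 1 by rewrite -orientation_rot.
have o3 : `|orientation w u v| = 1 by rewrite -orientation_rot.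
have o1' : `|orientation v u w| = 1 by rewrite orientation_swap normrN.
have o2' : `|orientation w v u| = 1 by rewrite orientation_swap normrN.
have o3' : `|orientation u w v| = 1 by rewrite orientation_swap normrN.
move=> /or3P[]/eqP-> /or3P[]/eqP->; rewrite ?eqxx // => _.
- by exists w.
- by exists v => //; rewrite fset3_swap fset3_rot.
- by exists w => //; rewrite fset3_swap.
- by exists u => //; rewrite fset3_rot.
- by exists v => //; rewrite -fset3_rot.
- by exists u => //; rewrite fset3_rot fset3_swap.
Qed.

(** * Cells of a regular subdivision as faces of a lower hull *)

Section Regular.
Variables (R : realType) (A : {fset lpoint}) (h : lpoint -> R).
Variable D : {fset {fset lpoint}}.
Hypothesis indD : induces A h D.
Hypothesis uniD : forall T, T \in D -> unimodular_triangle T.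

Lemma cell_weight T : T \in D -> exists w : plane R, dual_cell A h w = T.
Proof. by case/indD. Qed.

Lemma cell_sub T a : T \in D -> a \in T -> a \in A.
Proof. by case/cell_weight=> w <- /dual_cellP[]. Qed.

(* A common value of a convex combination over S and one over T forces the
   supports to be shared, since both cells are faces of the lower hull of h. *)
Lemma cell_compat S T x y a b c (n al be ga : int) :
  S \in D -> T \in D -> x \in S -> y \in S -> a \in T -> b \in T -> c \in T ->
  0 <= n -> 0 <= al -> 0 <= be -> 0 <= ga -> 1 + n = al + be + ga ->
  px x + n * px y = al * px a + be * px b + ga * px c ->
  py x + n * py y = al * py a + be * py b + ga * py c ->
  x \in T.
Proof.
move=> SD TD xS yS aT bT cT n0 al0 be0 ga0 wt hx hy.
have [wS eS] := cell_weight SD; have [wT eT] := cell_weight TD.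
have [aA [bA cA]] : a \in A /\ b \in A /\ c \in A by rewrite !(cell_sub TD).
have [xA yA] : x \in A /\ y \in A by rewrite !(cell_sub SD).
move: xS yS aT bT cT; rewrite -{1 2}eS -eT.
move=> /dual_cellP[_ xm] /dual_cellP[_ ym] /dual_cellP[_ am] /dual_cellP[_ bm] /dual_cellP[_ cm].
apply/dual_cellP; split=> // z zA.
apply: le_trans (am _ zA).
have := xm _ yA; have := ym _ xA; have := xm _ aA; have := xm _ bA; have := xm _ cA.
have := am _ yA; have := am _ bA; have := am _ cA; have := bm _ aA; have := cm _ aA.
have := bm _ yA; have := cm _ yA.
rewrite !trop_monomialE.
move: n0 al0 be0 ga0; rewrite -!(ler0z R).
move: wt hx hy => /(congr1 (fun i : int => i%:~R : R)) wt
  /(congr1 (fun i : int => i%:~R : R)) hx /(congr1 (fun i : int => i%:~R : R)) hy.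
move: wt hx hy; rewrite !rmorphD !rmorphM /= .
set N := n%:~R; set a1 := al%:~R; set b1 := be%:~R; set c1 := ga%:~R.
move: (px wS) (py wS) (px wT) (py wT) => u v p q.
set X := (px x)%:~R; set Y := (px y)%:~R; set Ax := (px a)%:~R; set Bx := (px b)%:~R; set Cx := (px c)%:~R.
set X' := (py x)%:~R; set Y' := (py y)%:~R; set Ay := (py a)%:~R; set By := (py b)%:~R; set Cy := (py c)%:~R.
move=> wt hx hy N0 a10 b10 c10 H1 H2 H3 H4 H5 H6 H7 H8 H9 H10 H11 H12.
set mxT := h x + (X * p + X' * q).
set maT := h a + (Ax * p + Ay * q).
have EA : maT = h b + (Bx * p + By * q) by apply/le_anti/andP; split.
have EB : maT = h c + (Cx * p + Cy * q) by apply/le_anti/andP; split.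
set mxS := h x + (X * u + X' * v).
have EX : mxS = h y + (Y * u + Y' * v) by apply/le_anti/andP; split.
(* At [wS] the vertices of [T] are at or above the minimum, which bounds h x + n h y by the weighted
   sum of [h] over [T]. At [wT] the point [y] is at or above the minimum, which then leaves no room
   for [x] to exceed it. *)
have K1 : 0 <= a1 * (h a + (Ax * u + Ay * v) - mxS) by apply: mulr_ge0 => //; rewrite subr_ge0.
have K2 : 0 <= b1 * (h b + (Bx * u + By * v) - mxS) by apply: mulr_ge0 => //; rewrite subr_ge0.
have K3 : 0 <= c1 * (h c + (Cx * u + Cy * v) - mxS) by apply: mulr_ge0 => //; rewrite subr_ge0.
have K4 : 0 <= N * (h y + (Y * p + Y' * q) - maT) by apply: mulr_ge0 => //; rewrite subr_ge0.
have E1 : mxS + N * mxS = h x + N * h y + ((X + N * Y) * u + (X' + N * Y') * v).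
  by rewrite {2}EX /mxS; ring.
have E2 : a1 * (h a + (Ax * u + Ay * v)) + b1 * (h b + (Bx * u + By * v))
   + c1 * (h c + (Cx * u + Cy * v)) = a1 * h a + b1 * h b + c1 * h c + ((X + N * Y) * u + (X' + N * Y') * v).
  by rewrite hx hy; ring.
have E3 : a1 * maT + b1 * maT + c1 * maT =
   a1 * h a + b1 * h b + c1 * h c + ((X + N * Y) * p + (X' + N * Y') * q).
  by rewrite {2}EA {2}EB hx hy /maT; ring.
have E4 : (1 + N) * maT = a1 * maT + b1 * maT + c1 * maT by rewrite wt; ring.
have E5 : (1 + N) * mxS = a1 * mxS + b1 * mxS + c1 * mxS by rewrite wt; ring.
have E6 : mxT + N * (h y + (Y * p + Y' * q)) = h x + N * h y + ((X + N * Y) * p + (X' + N * Y') * q).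
  by rewrite /mxT; ring.
move: K1 K2 K3 K4; rewrite !mulrBr.
move: E1 E2 E3 E4 E5 E6; rewrite !mulrDl !mul1r.
by lra.
Qed.

End Regular.

Lemma norm1_sqr (u : int) : `|u| = 1 -> u * u = 1.
Proof. lia. Qed.

(* The lattice parallelogram relation c + z = al * a + be * b between the
   apexes of two unimodular triangles lying on both sides of ab. *)
Definition edge_flip (S T : {fset lpoint}) a b c z (al be : int) : Prop :=
  [/\ S = [fset a; b; c]%fset, T = [fset a; b; z]%fset, c != z,
      `|orientation a b c| = 1 & `|orientation a b z| = 1] /\
  [/\ al + be = 2, px c + px z = al * px a + be * px b
    & py c + py z = al * py a + be * py b].

Lemma edge_flip_sym S T a b c z al be :
  edge_flip S T a b c z al be -> edge_flip T S a b z c al be.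
Proof.
move=> [[-> -> ? ? ?] [? hx hy]]; split; split=> //; first by rewrite eq_sym.
  by rewrite addrC.
by rewrite addrC.
Qed.

(** * Adjacent unimodular triangles and the length of the dual edge *)

Section RegularLength.
Variables (R : realType) (A : {fset lpoint}) (h : lpoint -> R).
Variable D : {fset {fset lpoint}}.
Hypothesis indD : induces A h D.
Hypothesis uniD : forall T, T \in D -> unimodular_triangle T.

(** Equal signed areas give z = c + k (b - a). For k >= 0 the relation z + k a = c + k b makes the
    segments za and cb meet, for k < 0 the segments zb and ca do; by [cell_compat], z is then a
    vertex of S. *)
Lemma same_side_eq S T a b c z : S \in D -> T \in D ->
  S = [fset a; b; c]%fset -> T = [fset a; b; z]%fset ->
  orientation a b c = orientation a b z -> `|orientation a b c| = 1 -> c = z.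
Proof.
move=> SD TD eS eT o12 o1.
have zS : z \in S.
  (* Multiplying by the orientation divides by it, since it is 1 or -1. *)
  set k := orientation a b c * ((px z - px a) * (py c - py a) - (py z - py a) * (px c - px a)).
  have [kx ky] : px z = px c + k * (px b - px a) /\ py z = py c + k * (py b - py a).
    have o11 : orientation a b c * orientation a b c = 1 by apply: norm1_sqr.
    rewrite /k; move: o12 o11; rewrite !orientationE.
    move: (px a) (py a) (px b) (py b) (px c) (py c) (px z) (py z) => ax ay bx by' cx cy zx zy.
    set o := (bx - ax) * (cy - ay) - (by' - ay) * (cx - ax) => o12 o11.
    have ids : o * (zx - ax) = ((zx - ax) * (cy - ay) - (zy - ay) * (cx - ax)) * (bx - ax) + o * (cx - ax).
      by rewrite {2}o12 /o; ring.
    have idt : o * (zy - ay) = ((zx - ax) * (cy - ay) - (zy - ay) * (cx - ax)) * (by' - ay) + o * (cy - ay).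
      by rewrite {2}o12 /o; ring.
    split.
      suff : zx - ax = cx - ax + o * ((zx - ax) * (cy - ay) - (zy - ay) * (cx - ax)) * (bx - ax) by move=> E; lia.
      by rewrite -[LHS]mul1r -o11 -mulrA ids mulrDr !mulrA o11 mul1r addrC.
    suff : zy - ay = cy - ay + o * ((zx - ax) * (cy - ay) - (zy - ay) * (cx - ax)) * (by' - ay) by move=> E; lia.
    by rewrite -[LHS]mul1r -o11 -mulrA idt mulrDr !mulrA o11 mul1r addrC.
  have [k0|k0] := lerP 0 k.
    apply: (@cell_compat _ _ _ _ indD T S z a c b b k 1 k 0) => //;
      rewrite ?eS ?eT ?inE ?eqxx ?orbT //; try lia; rewrite ?kx ?ky; ring.
  apply: (@cell_compat _ _ _ _ indD T S z b c a a (- k) 1 (- k) 0) => //;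
    rewrite ?eS ?eT ?inE ?eqxx ?orbT //; try lia; rewrite ?kx ?ky; ring.
have := unimodular_neq o1; have : `|orientation a b z| = 1 by rewrite -o12.
move=> /unimodular_neq [_ az bz] [_ ac bc].
move: zS; rewrite eS !inE ![z == _]eq_sym (negPf az) (negPf bz) /=.
by move/eqP.
Qed.

(** The orientations of abc and abz are opposite by [same_side_eq], so c + z - 2 a is an integer
    multiple k (b - a), which gives the weights 2 - k and k. *)
Lemma edge_flip_exists S T : S \in D -> T \in D ->
  #|` (S `&` T)%fset| = 2%N ->
  exists a b c z al be, edge_flip S T a b c z al be.
Proof.
move=> SD TD card2.
have [a aST] : exists a, a \in (S `&` T)%fset.
  by apply/fset0Pn; rewrite -cardfs_gt0 card2.
have [b bST] : exists b, b \in ((S `&` T) `\ a)%fset.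
  by apply/fset0Pn; rewrite -cardfs_gt0; move: card2; rewrite (cardfsD1 a) aST; lia.
move: aST bST; rewrite !inE => /andP[aS aT] /andP[ba /andP[bS bT]].
have ab : a != b by rewrite eq_sym.
have [c eS oc] := unimodular_apex (uniD SD) aS bS ab.
have [z eT oz] := unimodular_apex (uniD TD) aT bT ab.
have cz : c != z.
  apply/eqP => E; move: card2; rewrite eT -E -eS fsetIid eS card_unimodular //.
have oo : orientation a b z = - orientation a b c.
  have no : orientation a b c <> orientation a b z.
    by move=> E; move: cz; rewrite (same_side_eq SD TD eS eT E oc) eqxx.
  move: no oc oz; move: (orientation a b c) (orientation a b z) => u v; clear; lia.
exists a, b, c, z.
set k := orientation a b c * ((px z - px a) * (py c - py a) - (py z - py a) * (px c - px a)).
have [kx ky] : px z - px a = k * (px b - px a) - (px c - px a) /\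
               py z - py a = k * (py b - py a) - (py c - py a).
  have o11 : orientation a b c * orientation a b c = 1 by apply: norm1_sqr.
  rewrite /k; move: oo o11; rewrite !orientationE.
  move: (px a) (py a) (px b) (py b) (px c) (py c) (px z) (py z) => ax ay bx by' cx cy zx zy.
  set o := (bx - ax) * (cy - ay) - (by' - ay) * (cx - ax) => o12 o11.
  have eo : o = - ((bx - ax) * (zy - ay) - (by' - ay) * (zx - ax)) by rewrite o12 opprK.
  have ids : o * (zx - ax) = ((zx - ax) * (cy - ay) - (zy - ay) * (cx - ax)) * (bx - ax) - o * (cx - ax).
    by rewrite {2}eo /o; ring.
  have idt : o * (zy - ay) = ((zx - ax) * (cy - ay) - (zy - ay) * (cx - ax)) * (by' - ay) - o * (cy - ay).
    by rewrite {2}eo /o; ring.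
  split.
    by rewrite -[LHS]mul1r -o11 -mulrA ids mulrBr !mulrA o11 mul1r.
  by rewrite -[LHS]mul1r -o11 -mulrA idt mulrBr !mulrA o11 mul1r.
exists (2 - k), k; split; split=> //; first lia.
  have -> : px z = px a + k * (px b - px a) - (px c - px a) by rewrite -addrA -kx; ring.
  by ring.
have -> : py z = py a + k * (py b - py a) - (py c - py a) by rewrite -addrA -ky; ring.
by ring.
Qed.

(** [lattice_length] is a choice, so uniqueness has to be shown. Bezout combinations for two
    primitive directions of the same vector make each length an integer multiple of the other, with
    positive factors unless the length is 0. *)
Lemma lattice_length_scale (u : lpoint) (l : R) :
  coprimez (px u) (py u) -> 0 <= l -> lattice_length (l *: emb R u) = l.
Proof.
move=> cop l0; apply: xget_unique; first by split=> //; exists u; rewrite pxE pyE.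
move=> l' [l'0 [u' [cop' E]]]; move: cop'; rewrite pxE pyE => cop'.
have Ex : l * (px u)%:~R = l' * (px u')%:~R by move/(congr1 (@px R)): E; rewrite /px !mxE.
have Ey : l * (py u)%:~R = l' * (py u')%:~R by move/(congr1 (@py R)): E; rewrite /py !mxE.
have [[p q] /= B] := coprimezP _ _ cop.
have [[p' q'] /= B'] := coprimezP _ _ cop'.
have B1 : p%:~R * (px u)%:~R + q%:~R * (py u)%:~R = 1 :> R by rewrite -!rmorphM -rmorphD /= B.
have B1' : p'%:~R * (px u')%:~R + q'%:~R * (py u')%:~R = 1 :> R by rewrite -!rmorphM -rmorphD /= B'.
have K : l = l' * (p * px u' + q * py u')%:~R.
  rewrite rmorphD !rmorphM /=.
  transitivity (p%:~R * (l * (px u)%:~R) + q%:~R * (l * (py u)%:~R)).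
    by rewrite -[LHS]mulr1 -[X in _ * X = _]B1; ring.
  by rewrite Ex Ey; ring.
have K' : l' = l * (p' * px u + q' * py u)%:~R.
  rewrite rmorphD !rmorphM /=.
  transitivity (p'%:~R * (l' * (px u')%:~R) + q'%:~R * (l' * (py u')%:~R)).
    by rewrite -[LHS]mulr1 -[X in _ * X = _]B1'; ring.
  by rewrite -Ex -Ey; ring.
move: K K'; set m := (X in l' * X%:~R); set m' := (X in l * X%:~R); move: m m' => m m' K K'.
have [l00|lN0] := eqVneq l 0; first by rewrite K' l00 mul0r.
have lp : 0 < l by rewrite lt_neqAle eq_sym lN0.
have l'p : 0 < l'.
  by rewrite lt_neqAle l'0 andbT eq_sym; apply/eqP => E0; move: lN0; rewrite K E0 mul0r eqxx.
have m0 : 0 < m by rewrite -(ltr0z R) -(pmulr_rgt0 _ l'p) -K.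
have m'0 : 0 < m' by rewrite -(ltr0z R) -(pmulr_rgt0 _ lp) -K'.
have mm : m * m' = 1.
  apply/eqP; rewrite -(eqr_int R) rmorphM /=; apply/eqP.
  by apply: (mulfI lN0); rewrite mulr1 [m%:~R * _]mulrC mulrA -K' -K.
have m1 : m = 1 by nia.
by rewrite K m1 mulr1.
Qed.

Lemma curve_vertexP T : T \in D -> dual_cell A h (curve_vertex A h T) = T.
Proof.
move=> TD; have [w ew] := cell_weight indD TD.
exact: (@xgetPex _ 0 [set w | dual_cell A h w = T] (ex_intro _ w ew)).
Qed.

Lemma dual_cell_eq w a b : a \in dual_cell A h w -> b \in dual_cell A h w ->
  trop_monomial h w a = trop_monomial h w b.
Proof.
move=> /dual_cellP[aA am] /dual_cellP[bA bm].
by apply/le_anti; rewrite am // bm.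
Qed.

Lemma edge_flip_length S T a b c z al be : S \in D -> T \in D ->
  edge_flip S T a b c z al be ->
  lattice_length (curve_vertex A h S - curve_vertex A h T) =
  h c + h z - al%:~R * h a - be%:~R * h b.
Proof.
move=> SD TD [[eS eT cz oc oz] [ab2 hx hy]].
set wS := curve_vertex A h S; set wT := curve_vertex A h T.
have dS : dual_cell A h wS = S := curve_vertexP SD.
have dT : dual_cell A h wT = T := curve_vertexP TD.
have iS x : x \in [:: a; b; c] -> x \in dual_cell A h wS by rewrite dS eS !inE orbA.
have iT x : x \in [:: a; b; z] -> x \in dual_cell A h wT by rewrite dT eT !inE orbA.
have m1 : trop_monomial h wS a = trop_monomial h wS b by apply: dual_cell_eq; apply: iS; rewrite !inE eqxx ?orbT.
have m2 : trop_monomial h wS a = trop_monomial h wS c by apply: dual_cell_eq; apply: iS; rewrite !inE eqxx ?orbT.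
have m3 : trop_monomial h wT a = trop_monomial h wT b by apply: dual_cell_eq; apply: iT; rewrite !inE eqxx ?orbT.
have m4 : trop_monomial h wT a = trop_monomial h wT z by apply: dual_cell_eq; apply: iT; rewrite !inE eqxx ?orbT.
have m5 : trop_monomial h wS a <= trop_monomial h wS z.
  have /dual_cellP[_] : a \in dual_cell A h wS by apply: iS; rewrite !inE eqxx.
  by apply; apply: (cell_sub indD TD); rewrite eT !inE eqxx orbT.
(* A quarter turn of b - a, signed so that its product with z - a is the squared orientation, that
   is 1. This makes it primitive, and pairing [wS - wT] with z - a reads off the length. *)
pose u : lpoint := \col_i (if i == 0 then - (orientation a b z) * (py b - py a) else orientation a b z * (px b - px a)).
have ux : px u = - (orientation a b z) * (py b - py a) by rewrite /px mxE.
have uy : py u = orientation a b z * (px b - px a) by rewrite /py mxE.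
have o11 : orientation a b z * orientation a b z = 1 by apply: norm1_sqr.
set lam : R := (RHS).
have lamE : trop_monomial h wS z - trop_monomial h wS a = lam.
  have -> : trop_monomial h wS z - trop_monomial h wS a =
     trop_monomial h wS z + trop_monomial h wS c - al%:~R * trop_monomial h wS a - be%:~R * trop_monomial h wS b.
    have -> : al%:~R = 2 - be%:~R :> R by rewrite -(addrK be al) ab2 rmorphB.
    by rewrite -m1 -m2; ring.
  rewrite !trop_monomialE /lam.
  move: hx hy => /(congr1 (fun i : int => i%:~R : R)) + /(congr1 (fun i : int => i%:~R : R)).
  rewrite !rmorphD !rmorphM /= => hx hy.
  have hx' : (px c)%:~R = al%:~R * (px a)%:~R + be%:~R * (px b)%:~R - (px z)%:~R :> R by rewrite -hx; ring.
  have hy' : (py c)%:~R = al%:~R * (py a)%:~R + be%:~R * (py b)%:~R - (py z)%:~R :> R by rewrite -hy; ring.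
  by rewrite hx' hy'; ring.
have -> : wS - wT = lam *: emb R u.
  have o11R : (orientation a b z)%:~R * (orientation a b z)%:~R = 1 :> R by rewrite -rmorphM /= o11.
  have EX : px (lam *: emb R u) = lam * (px u)%:~R by rewrite /px !mxE.
  have EY : py (lam *: emb R u) = lam * (py u)%:~R by rewrite /py !mxE.
  have FX : px (wS - wT) = px wS - px wT by rewrite /px !mxE.
  have FY : py (wS - wT) = py wS - py wT by rewrite /py !mxE.
  move: lamE m1 m3 m4; rewrite !trop_monomialE => lamE m1 m3 m4.
  have G1 : ((px b)%:~R - (px a)%:~R) * (px wS - px wT) + ((py b)%:~R - (py a)%:~R) * (py wS - py wT) = 0 by rewrite !mulrBl !mulrBr; lra.
  have G2 : ((px z)%:~R - (px a)%:~R) * (px wS - px wT) + ((py z)%:~R - (py a)%:~R) * (py wS - py wT) = lam by rewrite !mulrBl !mulrBr; lra.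
  have oE : (orientation a b z)%:~R = ((px b)%:~R - (px a)%:~R) * ((py z)%:~R - (py a)%:~R) - ((py b)%:~R - (py a)%:~R) * ((px z)%:~R - (px a)%:~R) :> R.
    by rewrite orientationE rmorphB !rmorphM /= !rmorphB.
  apply: cV2_eq; rewrite ?EX ?EY ?FX ?FY ?ux ?uy ?rmorphM ?rmorphN ?rmorphB /=.
    rewrite -[LHS]mul1r -{1}o11R -G2 {2}oE.
    transitivity ((orientation a b z)%:~R * ((((px b)%:~R - (px a)%:~R) * (px wS - px wT)) * ((py z)%:~R - (py a)%:~R) - ((py b)%:~R - (py a)%:~R) * ((px z)%:~R - (px a)%:~R) * (px wS - px wT))); first by ring.
    have -> : ((px b)%:~R - (px a)%:~R) * (px wS - px wT) = - (((py b)%:~R - (py a)%:~R) * (py wS - py wT)) by apply/eqP; rewrite -addr_eq0 G1.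
    by ring.
  rewrite -[LHS]mul1r -{1}o11R -G2 {2}oE.
  transitivity ((orientation a b z)%:~R * (((px b)%:~R - (px a)%:~R) * ((py z)%:~R - (py a)%:~R) * (py wS - py wT) - (((py b)%:~R - (py a)%:~R) * (py wS - py wT)) * ((px z)%:~R - (px a)%:~R))); first by ring.
  have -> : ((py b)%:~R - (py a)%:~R) * (py wS - py wT) = - (((px b)%:~R - (px a)%:~R) * (px wS - px wT)) by apply/eqP; rewrite -addr_eq0 addrC G1.
  by ring.
apply: lattice_length_scale; last by rewrite -lamE subr_ge0.
apply/coprimezP; exists (px z - px a, py z - py a) => /=.
rewrite ux uy -o11 [X in _ = _ * X]orientationE; ring.
Qed.

End RegularLength.

(** * Edge lengths as linear functions *)

Definition flip_coef (a b c z : lpoint) (al be : int) (x : lpoint) : int :=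
  (x == c)%:Z + (x == z)%:Z - al * (x == a)%:Z - be * (x == b)%:Z.

(* The coefficients of the values of h in the length of the edge e. *)
Definition edge_coef (D : {fset {fset lpoint}}) (e : {set D}) : lpoint -> int :=
  xget (fun=> 0) [set f | exists S T : D, e = [set S; T]%SET /\
    exists a b c z al be, edge_flip (val S) (val T) a b c z al be /\
      f = flip_coef a b c z al be].

Lemma sum_flip_coef (R : realType) (A : {fset lpoint}) (f : lpoint -> R)
    a b c z al be :
  a \in A -> b \in A -> c \in A -> z \in A ->
  \sum_(x <- A) (flip_coef a b c z al be x)%:~R * f x =
  f c + f z - al%:~R * f a - be%:~R * f b.
Proof.
move=> aA bA cA zA.
have K y : y \in A -> \sum_(x <- A) ((x == y)%:Z%:~R : R) * f x = f y.
  move=> yA; rewrite (bigD1_seq y) ?fset_uniq //= eqxx mul1r big1 ?addr0 //.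
  by move=> x /negPf ->; rewrite mul0r.
rewrite -(K c) // -(K z) // -(K a) // -(K b) // !mulr_sumr -big_split -!sumrB /=.
apply: eq_bigr => x _.
by rewrite /flip_coef !rmorphB rmorphD !rmorphM /=; ring.
Qed.

Lemma set2_eq (V : finType) (S T S' T' : V) : [set S; T]%SET = [set S'; T']%SET ->
  (S = S' /\ T = T') \/ (S = T' /\ T = S').
Proof.
move=> E.
have : S \in [set S'; T']%SET by rewrite -E !inE eqxx.
have : T \in [set S'; T']%SET by rewrite -E !inE eqxx orbT.
have : S' \in [set S; T]%SET by rewrite E !inE eqxx.
have : T' \in [set S; T]%SET by rewrite E !inE eqxx orbT.
rewrite !inE.
by move=> /orP[]/eqP-> /orP[]/eqP-> /orP[]/eqP ? /orP[]/eqP ?; subst; auto.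
Qed.

Lemma bounded_edgesP (D : {fset {fset lpoint}}) (e : {set D}) :
  reflect (exists S T : D, e = [set S; T]%SET /\ #|` (val S `&` val T)%fset| = 2%N)
          (e \in bounded_edges D).
Proof.
rewrite inE; apply: (iffP existsP).
  by move=> [S /existsP[T /andP[/eqP-> /eqP c2]]]; exists S, T.
by move=> [S [T [-> c2]]]; exists S; apply/existsP; exists T; rewrite eqxx c2 eqxx.
Qed.

Section EdgeCoef.
Variables (R : realType) (A : {fset lpoint}) (h : lpoint -> R).
Variable D : {fset {fset lpoint}}.
Hypothesis indD : induces A h D.
Hypothesis uniD : forall T, T \in D -> unimodular_triangle T.

Lemma edge_coefP e : e \in bounded_edges D -> exists S T : D, e = [set S; T]%SET /\
    exists a b c z al be, edge_flip (val S) (val T) a b c z al be /\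
      edge_coef e = flip_coef a b c z al be.
Proof.
move=> /bounded_edgesP[S [T [eE c2]]].
apply: (@xgetPex _ (fun=> 0) [set f | exists S T : D, e = [set S; T]%SET /\
    exists a b c z al be, edge_flip (val S) (val T) a b c z al be /\
      f = flip_coef a b c z al be]).
have [a [b [c [z [al [be F]]]]]] := edge_flip_exists indD uniD (valP S) (valP T) c2.
by exists (flip_coef a b c z al be), S, T; split=> //; exists a, b, c, z, al, be.
Qed.

Lemma edge_coef_sub (S T : D) a b c z al be :
  edge_flip (val S) (val T) a b c z al be ->
  [/\ a \in A, b \in A, c \in A & z \in A].
Proof.
move=> [[eS eT _ _ _] _].
by split; [apply: (cell_sub indD (valP S))|apply: (cell_sub indD (valP S))
  |apply: (cell_sub indD (valP S))|apply: (cell_sub indD (valP T))];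
  rewrite ?eS ?eT !inE eqxx ?orbT.
Qed.

(** Both sides rest on a choice of ordered triangles and of a flip; the length formula is symmetric,
    so all choices agree. *)
Lemma edge_length_coef e : e \in bounded_edges D ->
  edge_length A h e = \sum_(x <- A) (edge_coef e x)%:~R * h x.
Proof.
move=> /edge_coefP[S [T [eE [a [b [c [z [al [be [F ->]]]]]]]]]].
have [aA bA cA zA] := edge_coef_sub F.
rewrite sum_flip_coef //.
have lST := edge_flip_length indD (valP S) (valP T) F.
have lTS := edge_flip_length indD (valP T) (valP S) (edge_flip_sym F).
apply: xget_unique; first by exists S, T.
move=> l [S' [T' [eE' ->]]].
move: eE'; rewrite eE => /set2_eq[[<- <-]|[<- <-]] //.
by rewrite lTS; ring.
Qed.

Lemma edge_coef_affine e (r p q : R) : e \in bounded_edges D ->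
  \sum_(x <- A) (edge_coef e x)%:~R * (r + p * (px x)%:~R + q * (py x)%:~R) = 0.
Proof.
move=> /edge_coefP[S [T [eE [a [b [c [z [al [be [F ->]]]]]]]]]].
have [aA bA cA zA] := edge_coef_sub F.
rewrite sum_flip_coef //; case: F => _ [ab2 hx hy].
have al2 : al%:~R = 2 - be%:~R :> R by rewrite -(addrK be al) ab2 rmorphB.
move: hx hy => /(congr1 (fun i : int => i%:~R : R)) + /(congr1 (fun i : int => i%:~R : R)).
rewrite !rmorphD !rmorphM /= => hx hy.
have hx' : (px c)%:~R = al%:~R * (px a)%:~R + be%:~R * (px b)%:~R - (px z)%:~R :> R by rewrite -hx; ring.
have hy' : (py c)%:~R = al%:~R * (py a)%:~R + be%:~R * (py b)%:~R - (py z)%:~R :> R by rewrite -hy; ring.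
by rewrite hx' hy' al2; ring.
Qed.

End EdgeCoef.

(** * Retraction of leaves and smoothing *)

Section Leaves.
Variable V : finType.
Implicit Types E : {set {set V}}.

Lemma remove_leaves_sub E : remove_leaves E \subset E.
Proof. by apply/fintype.subsetP => e; rewrite inE => /andP[]. Qed.

Lemma retract_leaves_sub E : retract_leaves E \subset E.
Proof.
rewrite /retract_leaves; elim: #|E| => [|n IH] //=.
exact: fintype.subset_trans (remove_leaves_sub _) IH.
Qed.

Lemma retract_leaves_stable E : remove_leaves (retract_leaves E) = retract_leaves E.
Proof.
(* After n rounds either n edges are gone or the graph is stable. For n = #|E| the first case leaves
   the empty graph, which is stable too. *)
have K n : (n + #|iter n (@remove_leaves V) E| <= #|E|)%N \/
    remove_leaves (iter n (@remove_leaves V) E) = iter n (@remove_leaves V) E.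
  elim: n => [|n [IH|IH]]; [by left| |by right; rewrite /= IH].
  have [E1|N1] := eqVneq (remove_leaves (iter n (@remove_leaves V) E)) (iter n (@remove_leaves V) E).
    by right; rewrite /= E1.
  left; have := remove_leaves_sub (iter n (@remove_leaves V) E).
  rewrite subEproper (negPf N1) /= => /proper_card lt1.
  by apply: leq_trans IH; rewrite addSn -addnS leq_add2l.
have [H|//] := K #|E|; rewrite /retract_leaves.
have H0 : #|iter #|E| (@remove_leaves V) E| = 0%N.
  by apply/eqP; rewrite -leqn0 -(leq_add2l #|E|) addn0.
by move/eqP: H0; rewrite cards_eq0 => /eqP ->; apply/setP => e; rewrite !inE.
Qed.

Lemma retract_leaves_degree E e v : e \in retract_leaves E -> v \in e ->
  degree (retract_leaves E) v != 1%N.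
Proof.
rewrite -{1}retract_leaves_stable inE => /andP[_ /forallP/(_ v)/implyP]; exact.
Qed.

Lemma joined_sym E : symmetric (joined_at_2valent E).
Proof.
move=> e f; rewrite /joined_at_2valent andbCA; do 2 congr andb.
by apply: eq_existsb => v; rewrite andbCA.
Qed.

Lemma smooth_edges_sub E X : X \in smooth_edges E -> X \subset E.
Proof.
by move=> /imsetP[x xE ->]; apply/fintype.subsetP => e; rewrite inE => /andP[].
Qed.

Lemma smooth_edges_joined E X e f : X \in smooth_edges E ->
  joined_at_2valent E e f -> (e \in X) = (f \in X).
Proof.
move=> /imsetP[x xE ->] J; have /and3P[eE fE _] := J.
rewrite !inE eE fE /=; apply/idP/idP => H; apply: connect_trans H (connect1 _) => //.
by rewrite joined_sym.
Qed.

End Leaves.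

(** * Null points *)

Lemma unit_int_eq (u v w : int) : `|u| = 1 -> `|v| = 1 -> `|w| = 1 ->
  v <> u -> w <> u -> v = w.
Proof. lia. Qed.

Lemma flip_coef_apexl (a b c z w : lpoint) al be :
  (w == a) = false -> (w == b) = false -> (w == z) = false -> w == c ->
  flip_coef a b c z al be w = 1.
Proof. by rewrite /flip_coef => -> -> -> ->; rewrite !mulr0 addr0 !subr0. Qed.

Lemma flip_coef_apexr (a b c z w : lpoint) al be :
  (w == a) = false -> (w == b) = false -> (w == c) = false -> w == z ->
  flip_coef a b c z al be w = 1.
Proof. by rewrite /flip_coef => -> -> -> ->; rewrite !mulr0 add0r !subr0. Qed.

(** Subtracting c + z = 2 w from the flip relation leaves be (p - w) = 0: when w is the midpoint of
    the two apexes, it carries the whole weight. *)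
Lemma flip_collinear (al be : int) (w p c z : lpoint) : p != w -> al + be = 2 ->
  px c + px z = 2 * px w -> py c + py z = 2 * py w ->
  px c + px z = al * px w + be * px p -> py c + py z = al * py w + be * py p ->
  be = 0.
Proof.
move=> pw ab2 -> -> hx hy; apply/eqP/negPn/negP => be0.
have alE : al = 2 - be by rewrite -ab2 addrK.
have kx : be * (px w - px p) = 0.
  by move: hx; rewrite alE => /eqP; rewrite -subr_eq0 => /eqP <-; ring.
have ky : be * (py w - py p) = 0.
  by move: hy; rewrite alE => /eqP; rewrite -subr_eq0 => /eqP <-; ring.
move: kx ky => /eqP + /eqP; rewrite !mulf_eq0 (negPf be0) !subr_eq0 /=.
by move=> /eqP u1 /eqP u2; move: pw; rewrite (cV2_eq u1 u2) eqxx.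
Qed.

(* No skeleton length depends on the value of h at w. *)
Definition null_point (D : {fset {fset lpoint}}) (w : lpoint) : Prop :=
  forall X, X \in skeleton_edges D -> \sum_(e in X) edge_coef e w = 0.

Section NullPoints.
Variables (R : realType) (A : {fset lpoint}) (h : lpoint -> R).
Variable D : {fset {fset lpoint}}.
Hypothesis indD : induces A h D.
Hypothesis uniD : forall T, T \in D -> unimodular_triangle T.

Local Notation BE := (bounded_edges D).
Local Notation RE := (retract_leaves (bounded_edges D)).

Lemma skeleton_edge_bounded X e : X \in skeleton_edges D -> e \in X -> e \in BE.
Proof.
move=> /smooth_edges_sub/fintype.subsetP XE /XE.
exact: (fintype.subsetP (retract_leaves_sub _)).
Qed.

Lemma edge_coef_mem (e : {set D}) w : e \in BE -> edge_coef e w != 0 ->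
  exists2 S : D, S \in e & w \in val S.
Proof.
move=> /(edge_coefP indD uniD)[S [T [-> [a [b [c [z [al [be [F ->]]]]]]]]]].
have [[eS eT _ _ _] _] := F.
rewrite /flip_coef => nz.
have [wS|/negPf wS] := boolP (w \in val S); first by exists S; rewrite ?inE ?eqxx.
have [wT|/negPf wT] := boolP (w \in val T); first by exists T; rewrite ?inE ?eqxx ?orbT.
move: wS wT nz; rewrite eS eT !inE => /negbT; rewrite !negb_or => /andP[/andP[/negPf -> /negPf ->] /negPf ->] /negbT.
by rewrite !negb_or => /andP[_ /negPf ->]; rewrite /= !mulr0.
Qed.

(** A retained edge with a nonzero coefficient at w has an endpoint triangle containing w. That
    triangle would have degree one in the retracted graph, against stability. *)
Lemma ear_null w : (forall S : D, w \in val S -> (degree BE S <= 1)%N) ->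
  null_point D w.
Proof.
move=> ear X XE; apply: big1 => e eX; apply/eqP/negPn/negP => nz.
have eRE := fintype.subsetP (smooth_edges_sub XE) _ eX.
have eBE := skeleton_edge_bounded XE eX.
have [S Se wS] := edge_coef_mem eBE nz.
have := retract_leaves_degree eRE Se; have := ear _ wS.
have d0 : (0 < degree RE S)%N.
  by rewrite card_gt0; apply/set0Pn; exists e; rewrite inE eRE.
have : (degree RE S <= degree BE S)%N.
  apply/subset_leq_card/fintype.subsetP => f; rewrite inE => /andP[fE sf].
  by rewrite inE sf andbT; exact: (fintype.subsetP (retract_leaves_sub _) f).
move=> le1 le2 ne1; move: ne1; rewrite eqn_leq d0 andbT => /negP; apply.
exact: leq_trans le1 le2.
Qed.

(** The triangles on ab other than S all lie on the side opposite to S, where [same_side_eq] leaves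
    only one. *)
Lemma neighbor_unique (S T T' : {fset lpoint}) a b : S \in D -> T \in D -> T' \in D ->
  T != S -> T' != S -> a != b -> a \in S -> b \in S -> a \in T -> b \in T ->
  a \in T' -> b \in T' -> T = T'.
Proof.
move=> SD TD T'D TS T'S ab aS bS aT bT aT' bT'.
have [c eS oc] := unimodular_apex (uniD SD) aS bS ab.
have [z eT oz] := unimodular_apex (uniD TD) aT bT ab.
have [y eT' oy] := unimodular_apex (uniD T'D) aT' bT' ab.
have oo : orientation a b z <> orientation a b c.
  by move=> E; move: TS; rewrite eT eS (same_side_eq indD TD SD eT eS E oz) eqxx.
have oo' : orientation a b y <> orientation a b c.
  by move=> E; move: T'S; rewrite eT' eS (same_side_eq indD T'D SD eT' eS E oy) eqxx.
have E : orientation a b z = orientation a b y.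
  exact: unit_int_eq oc oz oy oo oo'.
by rewrite eT eT' (same_side_eq indD TD T'D eT eT' E oz).
Qed.

Lemma bounded_edge_other (e : {set D}) (t : D) : e \in BE -> t \in e ->
  exists T : D, [/\ e = [set t; T]%SET, T != t & #|` (val t `&` val T)%fset| = 2%N].
Proof.
move=> /bounded_edgesP[S [T [-> c2]]].
have ST : S != T.
  apply/eqP => E; move: c2; rewrite E fsetIid.
  by have [a [b [c [-> o]]]] := uniD (valP T); rewrite card_unimodular.
rewrite !inE => /orP[]/eqP->; first by exists T; rewrite eq_sym.
by exists S; split=> //; [rewrite finset.setUC|rewrite fsetIC].
Qed.

Section Side.
Variables (w u p : lpoint) (t t' : D).
Hypotheses (et : val t = [fset u; w; p]%fset) (ot : `|orientation u w p| = 1).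
Hypothesis star : forall S : D, w \in val S -> S = t \/ S = t'.

Lemma side_edgeP e : e \in BE -> t \in e -> e != [set t; t']%SET ->
  exists T : D, [/\ e = [set t; T]%SET, T != t, u \in val T, p \in val T & w \notin val T].
Proof.
move=> eE te ne.
have [T [eT Tt c2]] := bounded_edge_other eE te.
have wT : w \notin val T.
  apply/negP => /star[E|E]; first by rewrite E eqxx in Tt.
  by move: ne; rewrite eT E eqxx.
exists T; split=> //.
  apply/negPn/negP => uT.
  have : (#|` (val t `&` val T)| <= #|` [fset p]|)%N%fset.
    apply: fsubset_leq_card; apply/fsubsetP => x; rewrite et !inE.
    by move=> /andP[/orP[/orP[]|]/eqP-> // ]; rewrite ?(negPf uT) ?(negPf wT).
  by rewrite c2 cardfs1.
apply/negPn/negP => pT.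
have : (#|` (val t `&` val T)| <= #|` [fset u]|)%N%fset.
  apply: fsubset_leq_card; apply/fsubsetP => x; rewrite et !inE.
  by move=> /andP[/orP[/orP[]|]/eqP-> // ]; rewrite ?(negPf pT) ?(negPf wT).
by rewrite c2 cardfs1.
Qed.

Lemma side_edge_unique e e' : e \in BE -> t \in e -> e != [set t; t']%SET ->
  e' \in BE -> t \in e' -> e' != [set t; t']%SET -> e = e'.
Proof.
move=> eE te ne e'E te' ne'.
have [T [-> Tt uT pT _]] := side_edgeP eE te ne.
have [T' [-> Tt' uT' pT' _]] := side_edgeP e'E te' ne'.
congr [set t; _]%SET; apply/val_inj.
have [_ up _] := unimodular_neq ot.
have ut : u \in val t by rewrite et !inE eqxx.
have pt : p \in val t by rewrite et !inE eqxx orbT.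
have vT : val T != val t by rewrite (inj_eq val_inj).
have vT' : val T' != val t by rewrite (inj_eq val_inj).
exact: (neighbor_unique (valP t) (valP T) (valP T') vT vT' up ut pt uT pT uT' pT').
Qed.

Lemma side_edge_coef e : e \in BE -> t \in e -> e != [set t; t']%SET ->
  edge_coef e w = 1.
Proof.
move=> eE te ne.
have [T [eT Tt uT pT wT]] := side_edgeP eE te ne.
have wt : w \in val t by rewrite et !inE eqxx orbT.
have [S1 [T1 [e1 [a [b [c [z [al [be [F ->]]]]]]]]]] := edge_coefP indD uniD eE.
have [[eS1 eT1 cz oc oz] _] := F.
move: e1; rewrite eT => /set2_eq[[E1 E2]|[E1 E2]]; subst S1 T1.
  move: wT wt; rewrite eT1 eS1 !inE !negb_or => /andP[/andP[/negPf wa /negPf wb] /negPf wz].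
  by rewrite wa wb /= => wc; apply: flip_coef_apexl.
move: wT wt; rewrite eT1 eS1 !inE !negb_or => /andP[/andP[/negPf wa /negPf wb] /negPf wz].
by rewrite wa wb /= => wc; apply: flip_coef_apexr.
Qed.

End Side.

(** [edge_coef] rests on an unknown flip, so its shared edge and apexes are first identified with wp
    and the outer points; [flip_collinear] then gives w the weight 2. *)
Lemma mid_edge_coef (wm w wp p : lpoint) (t1 t2 : D) :
  val t1 = [fset wm; w; p]%fset -> val t2 = [fset wp; w; p]%fset ->
  `|orientation wm w p| = 1 -> `|orientation wp w p| = 1 ->
  px wm + px wp = 2 * px w -> py wm + py wp = 2 * py w ->
  wm != wp -> [set t1; t2]%SET \in BE -> edge_coef [set t1; t2]%SET w = - 2.
Proof.
move=> e1 e2 o1 o2 hx hy wmp eE.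
have [mw mp wp'] := unimodular_neq o1; have [pw pp _] := unimodular_neq o2.
have [S1 [T1 [eST [a [b [c [z [al [be [F ->]]]]]]]]]] := edge_coefP indD uniD eE.
wlog [E1 E2] : S1 T1 a b c z al be eST F / S1 = t1 /\ T1 = t2.
  move=> W; case: (set2_eq eST) => [[E1 E2]|[E1 E2]]; subst S1 T1; first exact: W F _.
  have := W t1 t2 a b z c al be erefl (edge_flip_sym F) (conj erefl erefl).
  by rewrite /flip_coef [(w == z)%:Z + _]addrC.
subst S1 T1; case: F => [[f1 f2 cz oc oz] [ab2 fx fy]].
have [ab ac bc] := unimodular_neq oc; have [_ az bz] := unimodular_neq oz.
have memE x : (x \in val t1) && (x \in val t2) = (x == a) || (x == b).
  rewrite f1 f2 !inE.
  have [//|xa] := eqVneq x a; have [//|xb] := eqVneq x b => /=.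
  by apply/negP => /andP[/eqP-> /eqP E]; rewrite E eqxx in cz.
have wab : (w == a) || (w == b) by rewrite -memE e1 e2 !inE eqxx !orbT.
have pab : (p == a) || (p == b) by rewrite -memE e1 e2 !inE eqxx !orbT.
have cE : c = wm.
  have : c \in val t1 by rewrite f1 !inE eqxx orbT.
  rewrite e1 !inE => /orP[/orP[]|]/eqP // E; subst c.
    by move: wab; rewrite ![w == _]eq_sym (negPf ac) (negPf bc).
  by move: pab; rewrite ![p == _]eq_sym (negPf ac) (negPf bc).
have zE : z = wp.
  have : z \in val t2 by rewrite f2 !inE eqxx orbT.
  rewrite e2 !inE => /orP[/orP[]|]/eqP // E; subst z.
    by move: wab; rewrite ![w == _]eq_sym (negPf az) (negPf bz).
  by move: pab; rewrite ![p == _]eq_sym (negPf az) (negPf bz).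
subst c z; rewrite /flip_coef ![w == wm]eq_sym ![w == wp]eq_sym (negPf mw) (negPf pw).
have [wa|wa] := eqVneq w a.
  subst a; rewrite eq_sym (negPf wp') /= in pab; move/eqP: pab => pb; subst b.
  have be0 : be = 0 by apply: flip_collinear hx hy fx fy; rewrite // eq_sym.
  have al2 : al = 2 by rewrite -ab2 be0 addr0.
  by rewrite (negPf wp') be0 al2.
rewrite (negPf wa) /= in wab; move/eqP: wab => wb; subst b.
rewrite [p == w]eq_sym (negPf wp') orbF in pab; move/eqP: pab => pa; subst a.
rewrite addrC in fx; rewrite addrC in fy; rewrite [px wm + _]addrC in hx; rewrite [py wm + _]addrC in hy.
rewrite [al * _ + _]addrC in fx; rewrite [al * _ + _]addrC in fy; rewrite addrC in ab2.
have al0 : al = 0 by apply: flip_collinear hx hy fx fy; rewrite // eq_sym.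
have be2 : be = 2 by rewrite -ab2 al0 addr0.
by rewrite al0 be2 eqxx mul0r.
Qed.

Lemma mid_null (wm w wp p : lpoint) (t1 t2 : D) :
  val t1 = [fset wm; w; p]%fset -> val t2 = [fset wp; w; p]%fset ->
  `|orientation wm w p| = 1 -> `|orientation wp w p| = 1 ->
  px wm + px wp = 2 * px w -> py wm + py wp = 2 * py w -> wm != wp ->
  (forall S : D, w \in val S -> S = t1 \/ S = t2) -> null_point D w.
Proof.
move=> e1 e2 o1 o2 hx hy wmp star X XE.
have star' (S : D) : w \in val S -> S = t2 \/ S = t1 by move/star; tauto.
have w1 : w \in val t1 by rewrite e1 !inE eqxx orbT.
have w2 : w \in val t2 by rewrite e2 !inE eqxx orbT.
have C12 : [set t2; t1]%SET = [set t1; t2]%SET by rewrite finset.setUC.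
have [e0 e0E] : exists e0 : {set D}, e0 = [set t1; t2]%SET by exists [set t1; t2]%SET.
have reB : forall e : {set D}, e \in RE -> e \in BE := fintype.subsetP (retract_leaves_sub _).
have XR := fintype.subsetP (smooth_edges_sub XE).
have deg2 (t t' : D) (e : {set D}) : t \in e -> e \in RE -> (forall f : {set D}, f \in BE -> t \in f -> f != e0 -> f = e) ->
    t \in e0 -> e0 \in RE -> e != e0 -> degree RE t = 2%N.
  move=> te eR uq t0 e0R ne; rewrite /degree.
  rewrite (_ : [set f in RE | t \in f] = [set e; e0])%SET; first by rewrite cards2 ne.
  apply/setP => f; rewrite !inE; apply/andP/orP.
    case=> fR tf; have [->|nf] := eqVneq f e0; first by right.
    by left; rewrite (uq f) // reB.
  by case=> /eqP ->.
have find (t : D) : t \in e0 -> e0 \in RE -> exists e : {set D}, [/\ e \in RE, t \in e & e != e0].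
  move=> t0 e0R; have := retract_leaves_degree e0R t0.
  have -> : degree RE t = (#|[set f in RE | t \in f] :\ e0|).+1%SET.
    by rewrite /degree (cardsD1 e0) !inE e0R t0.
  rewrite eqSS cards_eq0 => /set0Pn[e]; rewrite !inE => /and3P[ne eR te].
  by exists e.
have t10 : t1 \in e0 by rewrite e0E !inE eqxx.
have t20 : t2 \in e0 by rewrite e0E !inE eqxx orbT.
have uq1 (e f : {set D}) : e \in BE -> t1 \in e -> e != e0 -> f \in BE -> t1 \in f -> f != e0 -> f = e.
  by rewrite e0E => *; apply: (@side_edge_unique w wm p t1 t2 e1 o1 star).
have uq2 (e f : {set D}) : e \in BE -> t2 \in e -> e != e0 -> f \in BE -> t2 \in f -> f != e0 -> f = e.
  by rewrite e0E => *; apply: (@side_edge_unique w wp p t2 t1 e2 o2 star'); rewrite ?C12.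
(* If the edge between the two triangles survives, each of them keeps exactly one more edge. Both
   then have degree 2, so [f1], [e0], [f2] lie together in one skeleton edge or none of them lies in
   X. *)
have [e0R|e0R] := boolP (e0 \in RE).
  have [f1 [f1R tf1 n1]] := find _ t10 e0R.
  have [f2 [f2R tf2 n2]] := find _ t20 e0R.
  have n1' : f1 != [set t1; t2]%SET by rewrite -e0E.
  have n2' : f2 != [set t2; t1]%SET by rewrite C12 -e0E.
  have d1 : degree RE t1 = 2%N.
    by apply: (deg2 t1 t2 f1) => // f fB tf nf; apply: uq1 => //; apply: reB.
  have d2 : degree RE t2 = 2%N.
    by apply: (deg2 t2 t1 f2) => // f fB tf nf; apply: uq2 => //; apply: reB.
  have j1 : joined_at_2valent RE e0 f1.
    by rewrite /joined_at_2valent e0R f1R; apply/existsP; exists t1; rewrite t10 tf1 d1.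
  have j2 : joined_at_2valent RE e0 f2.
    by rewrite /joined_at_2valent e0R f2R; apply/existsP; exists t2; rewrite t20 tf2 d2.
  (* A common edge [f1 = f2] would be counted once only, and the coefficients would not cancel. *)
  have n12 : f1 != f2.
    apply/eqP => E; have [T [eT Tt uT pT wT]] := side_edgeP e1 star (reB _ f1R) tf1 n1'.
    move: tf2; rewrite -E eT !inE => /orP[]/eqP E2; last by move: wT; rewrite -E2 w2.
    have wm1 : wm \in val t2 by rewrite E2 e1 !inE eqxx.
    move: wm1; rewrite e2 !inE (negPf wmp).
    by have [mw mp _] := unimodular_neq o1; rewrite (negPf mw) (negPf mp).
  have zero (f : {set D}) : f \in X -> f != e0 -> f != f1 -> f != f2 -> edge_coef f w = 0.
    move=> fX nf0 nf1 nf2; apply/eqP/negPn/negP => /edge_coef_mem[]; first exact: reB (XR _ fX).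
    move=> S Sf /star[] E; subst S.
      by move: nf1; rewrite (uq1 f1 f) ?eqxx // ?reB // XR.
    by move: nf2; rewrite (uq2 f2 f) ?eqxx // ?reB // XR.
  have [X0|X0] := boolP (e0 \in X); last first.
    apply: big1 => f fX.
    have nf0 : f != e0 by apply/eqP => E; rewrite -E fX in X0.
    apply: zero => //; apply/eqP => E; move: X0.
      by rewrite (smooth_edges_joined XE j1) -E fX.
    by rewrite (smooth_edges_joined XE j2) -E fX.
  have X1 : f1 \in X by rewrite -(smooth_edges_joined XE j1).
  have X2 : f2 \in X by rewrite -(smooth_edges_joined XE j2).
  rewrite (bigD1 e0) //= (bigD1 f1) /=; last by rewrite X1.
  rewrite (bigD1 f2) /=; last by rewrite X2 n2 eq_sym n12.
  rewrite big1 ?addr0; last by move=> f /andP[/andP[/andP[fX nf0] nf1] nf2]; apply: zero.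
  rewrite {1}e0E (mid_edge_coef e1 e2) -?e0E // ?reB //.
  rewrite (side_edge_coef e1 star (reB _ f1R) tf1 n1').
  by rewrite (side_edge_coef e2 star' (reB _ f2R) tf2 n2').
(* If the middle edge is retracted, an edge left at [t1] or [t2] would be the only one there, that
   is a leaf, against stability. *)
apply: big1 => f fX; apply/eqP/negPn/negP => /edge_coef_mem[]; first exact: reB (XR _ fX).
have fR := XR _ fX.
have nf0 : f != e0 by apply/eqP => E; rewrite -E fR in e0R.
have deg1 (t : D) : t \in f -> (forall g : {set D}, g \in RE -> t \in g -> g = f) -> degree RE t = 1%N.
  move=> tf uq; rewrite /degree (_ : [set g in RE | t \in g] = [set f])%SET ?cards1 //.
  apply/setP => g; rewrite !inE; apply/andP/eqP; first by case=> *; apply: uq.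
  by move=> ->.
have ng0 (g : {set D}) : g \in RE -> g != e0 by move=> gR; apply/eqP => E; rewrite -E gR in e0R.
move=> S Sf /star[] E; subst S; have := retract_leaves_degree fR Sf; rewrite deg1 //.
  by move=> g gR tg; apply: uq1 => //; rewrite ?reB ?ng0.
by move=> g gR tg; apply: uq2 => //; rewrite ?reB ?ng0.
Qed.

End NullPoints.

(** * Dimension of the moduli cone *)

Section Rank.
Variables (R : realType) (A : {fset lpoint}) (D : {fset {fset lpoint}}).
Hypothesis uniD : forall T, T \in D -> unimodular_triangle T.

Definition skeleton_coef (x : lpoint) : 'rV[R]_#|skeleton_edges D| :=
  \row_i \sum_(e in (enum_val i : {set {set D}})) (edge_coef e x)%:~R.

Lemma skeleton_lengthsE (h : lpoint -> R) : induces A h D ->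
  skeleton_lengths A D h = \sum_(x <- A) h x *: skeleton_coef x.
Proof.
move=> indD; apply/rowP => i; rewrite mxE summxE.
under [RHS]eq_bigr do rewrite !mxE mulr_sumr.
rewrite exchange_big /=; apply: eq_bigr => e eX.
rewrite (edge_length_coef indD uniD) ?(skeleton_edge_bounded (enum_valP i)) //.
by apply: eq_bigr => x _; rewrite mulrC.
Qed.

Lemma skeleton_coef_affine (h : lpoint -> R) r p q : induces A h D ->
  \sum_(x <- A) (r + p * (px x)%:~R + q * (py x)%:~R) *: skeleton_coef x = 0.
Proof.
move=> indD; apply/rowP => i; rewrite mxE summxE.
under [LHS]eq_bigr do rewrite !mxE mulr_sumr.
rewrite exchange_big /=; apply: big1 => e eX.
rewrite -[RHS](edge_coef_affine indD uniD r p q (skeleton_edge_bounded (enum_valP i) eX)).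
by apply: eq_bigr => x _; rewrite mulrC.
Qed.

Lemma skeleton_coef_null x : null_point D x -> skeleton_coef x = 0.
Proof.
move=> nx; apply/rowP => i; rewrite !mxE -rmorph_sum /=.
by rewrite (nx _ (enum_valP i)).
Qed.

Lemma affine_interpolation (h : lpoint -> R) (b1 b2 b3 : lpoint) :
  orientation b1 b2 b3 != 0 -> exists r p q : R,
  forall x, x \in [:: b1; b2; b3] -> h x = r + p * (px x)%:~R + q * (py x)%:~R.
Proof.
rewrite orientationE -(intr_eq0 R) rmorphB !rmorphM !rmorphB /=.
set x1 := (px b1)%:~R; set y1 := (py b1)%:~R; set x2 := (px b2)%:~R.
set y2 := (py b2)%:~R; set x3 := (px b3)%:~R; set y3 := (py b3)%:~R.
set o := _ - _ => o0.
(* Cramer's rule, with the orientation as determinant. *)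
pose p := ((h b2 - h b1) * (y3 - y1) - (h b3 - h b1) * (y2 - y1)) / o.
pose q := ((x2 - x1) * (h b3 - h b1) - (x3 - x1) * (h b2 - h b1)) / o.
have po := divfK o0 _ : p * o = (h b2 - h b1) * (y3 - y1) - (h b3 - h b1) * (y2 - y1).
have qo := divfK o0 _ : q * o = (x2 - x1) * (h b3 - h b1) - (x3 - x1) * (h b2 - h b1).
exists (h b1 - p * x1 - q * y1), p, q => x; rewrite !inE => /or3P[]/eqP->.
- by rewrite -/x1 -/y1; ring.
- rewrite -/x2 -/y2; apply: (mulIf o0).
  transitivity (h b1 * o + (p * o) * (x2 - x1) + (q * o) * (y2 - y1)); last by ring.
  by rewrite po qo /o; ring.
- rewrite -/x3 -/y3; apply: (mulIf o0).
  transitivity (h b1 * o + (p * o) * (x3 - x1) + (q * o) * (y3 - y1)); last by ring.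
  by rewrite po qo /o; ring.
Qed.

(** The members of a free tuple may come from different [h], so a subspace independent of [h] is
    needed. Subtracting the affine function that agrees with [h] at b1, b2, b3 keeps the lengths and
    kills these three terms, and the terms of K vanish as well; the coefficient vectors of the other
    points span. *)
Lemma cone_dim_le (K : {fset lpoint}) (b1 b2 b3 : lpoint) :
  (K `<=` A)%fset -> (forall x, x \in K -> null_point D x) ->
  b1 \in (A `\` K)%fset -> b2 \in (A `\` K)%fset -> b3 \in (A `\` K)%fset ->
  orientation b1 b2 b3 != 0 ->
  (cone_dim (@moduli_cone R A D) + #|` K| + 3 <= #|` A|)%N.
Proof.
move=> KA nullK bA1 bA2 bA3 o0.
pose B := ((A `\` K) `\` [fset b1; b2; b3])%fset.
have cB : (#|` B| + 3 + #|` K| = #|` A|)%N.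
  have c3 : #|` [fset b1; b2; b3]%fset| = 3%N.
    have n12 : b1 != b2 by apply: contraNneq o0 => ->; rewrite orientationE; apply/eqP; ring.
    have n13 : b1 != b3 by apply: contraNneq o0 => ->; rewrite orientationE; apply/eqP; ring.
    have n23 : b2 != b3 by apply: contraNneq o0 => ->; rewrite orientationE; apply/eqP; ring.
    rewrite cardfsU cardfs2 cardfs1 n12.
    have -> : ([fset b1; b2] `&` [fset b3])%fset = fset0.
      apply/fsetP => x; rewrite !inE; apply/negP => /andP[/orP[]/eqP-> /eqP E];
      by rewrite E eqxx in n13 n23.
    by rewrite cardfs0.
  have sub : ([fset b1; b2; b3] `<=` A `\` K)%fset.
    by apply/fsubsetP => x; rewrite !in_fsetE => /orP[/orP[]|]/eqP ->; move: bA1 bA2 bA3; rewrite !inE.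
  have := cardfsDS sub; have := cardfsDS KA; rewrite -/B c3.
  have := fsubset_leq_card sub; have := fsubset_leq_card KA; rewrite c3.
  by move: #|` B| #|` A| #|` K| #|` (A `\` K)%fset| => u v w z; lia.
suff : (cone_dim (@moduli_cone R A D) <= #|` B|)%N by move: cB; lia.
apply/bigmax_leqP => k /asboolP[X [freeX XC]].
have XB x : x \in X -> x \in <<[seq skeleton_coef y | y <- B]>>%VS.
  move=> /XC[h indD <-].
  have [r [p [q haff]]] := affine_interpolation h o0.
  have -> : skeleton_lengths A D h = \sum_(y <- A)
      (h y *: skeleton_coef y - (r + p * (px y)%:~R + q * (py y)%:~R) *: skeleton_coef y).
    by rewrite sumrB (skeleton_coef_affine r p q indD) subr0 skeleton_lengthsE.
  rewrite big_seq; apply: memv_suml => y yA; rewrite -scalerBl.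
  have [yB|yB] := boolP (y \in B).
    by apply: memvZ; apply: memv_span; apply: map_f.
  have [yK|yK] := boolP (y \in K).
    by rewrite skeleton_coef_null ?scaler0 ?mem0v //; apply: nullK.
  rewrite -haff ?subrr ?scale0r ?mem0v //.
  by move: yB; rewrite !inE yA yK /= andbT negbK orbA.
have : (\dim <<X>> <= \dim <<[seq skeleton_coef y | y <- B]>>)%N.
  by apply: dimvS; apply/span_subvP.
have -> : \dim <<X>>%VS = k by move/eqP: freeX; rewrite size_tuple.
move/leq_trans; apply; apply: leq_trans (dim_span _) _.
by rewrite size_map.
Qed.

Lemma cone_dim_card :
  (cone_dim (@moduli_cone R A D) <= #|` A|)%N.
Proof.
apply/bigmax_leqP => k /asboolP[X [freeX XC]].
have XB x : x \in X -> x \in <<[seq skeleton_coef y | y <- A]>>%VS.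
  move=> /XC[h indD <-]; rewrite skeleton_lengthsE // big_seq.
  by apply: memv_suml => y yA; apply: memvZ; apply: memv_span; apply: map_f.
have : (\dim <<X>> <= \dim <<[seq skeleton_coef y | y <- A]>>)%N.
  by apply: dimvS; apply/span_subvP.
have -> : \dim <<X>>%VS = k by move/eqP: freeX; rewrite size_tuple.
move/leq_trans; apply; apply: leq_trans (dim_span _) _.
by rewrite size_map.
Qed.

End Rank.

(** * Lattice frames *)

(** An origin with a basis of the lattice. Squaring the determinant admits both signs and makes
    [fdet] its own inverse in the coordinates [fX] and [fY]. *)
Record frame := Frame {
  fo : lpoint; fe1 : lpoint; fe2 : lpoint;
  fdetP : (px fe1 * py fe2 - py fe1 * px fe2) *
          (px fe1 * py fe2 - py fe1 * px fe2) = 1 }.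

Definition fdet f := px (fe1 f) * py (fe2 f) - py (fe1 f) * px (fe2 f).
Definition fpt f (x y : int) : lpoint := fo f + x *: fe1 f + y *: fe2 f.
Definition fX f (z : lpoint) : int :=
  fdet f * ((px z - px (fo f)) * py (fe2 f) - (py z - py (fo f)) * px (fe2 f)).
Definition fY f (z : lpoint) : int :=
  fdet f * (px (fe1 f) * (py z - py (fo f)) - py (fe1 f) * (px z - px (fo f))).

Section FrameTheory.
Variable f : frame.

Lemma fdet2 : fdet f * fdet f = 1. Proof. exact: fdetP. Qed.

Lemma px_fpt x y : px (fpt f x y) = px (fo f) + x * px (fe1 f) + y * px (fe2 f).
Proof. by rewrite /px /fpt !mxE. Qed.

Lemma py_fpt x y : py (fpt f x y) = py (fo f) + x * py (fe1 f) + y * py (fe2 f).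
Proof. by rewrite /py /fpt !mxE. Qed.

Lemma fX_fpt x y : fX f (fpt f x y) = x.
Proof.
rewrite /fX px_fpt py_fpt -[RHS]mulr1 -[in RHS]fdet2 /fdet.
by move: (px _) (py _) (px _) (py _) (px _) (py _) => *; ring.
Qed.

Lemma fY_fpt x y : fY f (fpt f x y) = y.
Proof.
rewrite /fY px_fpt py_fpt -[RHS]mulr1 -[in RHS]fdet2 /fdet.
by move: (px _) (py _) (px _) (py _) (px _) (py _) => *; ring.
Qed.

Lemma px_frame z : px z = px (fo f) + fX f z * px (fe1 f) + fY f z * px (fe2 f).
Proof.
transitivity (px (fo f) + fdet f * fdet f * (px z - px (fo f))).
  by rewrite fdet2; ring.
by rewrite /fX /fY {2}/fdet; ring.
Qed.

Lemma py_frame z : py z = py (fo f) + fX f z * py (fe1 f) + fY f z * py (fe2 f).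
Proof.
transitivity (py (fo f) + fdet f * fdet f * (py z - py (fo f))).
  by rewrite fdet2; ring.
by rewrite /fX /fY {2}/fdet; ring.
Qed.

Lemma fptK z : fpt f (fX f z) (fY f z) = z.
Proof. by apply: cV2_eq; rewrite ?px_fpt ?py_fpt -?px_frame -?py_frame. Qed.

Lemma frame_eq z z' : fX f z = fX f z' -> fY f z = fY f z' -> z = z'.
Proof. by move=> hx hy; rewrite -(fptK z) hx hy fptK. Qed.

Lemma orientation_frame a b c : orientation a b c =
  fdet f * ((fX f b - fX f a) * (fY f c - fY f a) -
            (fY f b - fY f a) * (fX f c - fX f a)).
Proof.
rewrite orientationE (px_frame a) (px_frame b) (px_frame c).
by rewrite (py_frame a) (py_frame b) (py_frame c) /fdet; ring.
Qed.

Lemma norm_fdet : `|fdet f| = 1.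
Proof. by have := fdet2; move: (fdet f) => e; nia. Qed.

Lemma norm_orientation_frame a b c : `|orientation a b c| =
  `|(fX f b - fX f a) * (fY f c - fY f a) -
            (fY f b - fY f a) * (fX f c - fX f a)|.
Proof. by rewrite orientation_frame normrM norm_fdet mul1r. Qed.

Lemma frame_combination x y a b c (n al be ga : int) : 1 + n = al + be + ga ->
  fX f x + n * fX f y = al * fX f a + be * fX f b + ga * fX f c ->
  fY f x + n * fY f y = al * fY f a + be * fY f b + ga * fY f c ->
  px x + n * px y = al * px a + be * px b + ga * px c /\
  py x + n * py y = al * py a + be * py b + ga * py c.
Proof.
move=> wt hx hy.
rewrite (px_frame x) (px_frame y) (px_frame a) (px_frame b) (px_frame c).
rewrite (py_frame x) (py_frame y) (py_frame a) (py_frame b) (py_frame c).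
split.
  transitivity ((1 + n) * px (fo f) + (fX f x + n * fX f y) * px (fe1 f) +
    (fY f x + n * fY f y) * px (fe2 f)); first by ring.
  by rewrite wt hx hy; ring.
transitivity ((1 + n) * py (fo f) + (fX f x + n * fX f y) * py (fe1 f) +
  (fY f x + n * fY f y) * py (fe2 f)); first by ring.
by rewrite wt hx hy; ring.
Qed.

(** Solving for a weight that pairs to s with [fe1] and to t with [fe2] allows cells to be
    constructed from slopes along the frame axes; C comes from the origin and does not affect
    minimality. *)
Lemma frame_covector (R : realType) (s t : R) : exists (w : plane R) (C : R),
  forall h a, trop_monomial h w a = h a + C + (fX f a)%:~R * s + (fY f a)%:~R * t.
Proof.
have d2 : (fdet f)%:~R * (fdet f)%:~R = 1 :> R by rewrite -rmorphM fdet2.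
pose w : plane R := \col_i (if i == 0
  then (fdet f)%:~R * (s * (py (fe2 f))%:~R - t * (py (fe1 f))%:~R)
  else (fdet f)%:~R * (t * (px (fe1 f))%:~R - s * (px (fe2 f))%:~R)).
have wx : px w = (fdet f)%:~R * (s * (py (fe2 f))%:~R - t * (py (fe1 f))%:~R).
  by rewrite /px mxE.
have wy : py w = (fdet f)%:~R * (t * (px (fe1 f))%:~R - s * (px (fe2 f))%:~R).
  by rewrite /py mxE.
exists w, ((px (fo f))%:~R * px w + (py (fo f))%:~R * py w) => h a.
rewrite trop_monomialE; move: (px_frame a) (py_frame a).
move: (fX f a) (fY f a) => xa ya -> ->; rewrite !rmorphD !rmorphM /=.
have dE : (fdet f)%:~R = (px (fe1 f))%:~R * (py (fe2 f))%:~R - (py (fe1 f))%:~R * (px (fe2 f))%:~R :> R.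
  by rewrite /fdet rmorphB !rmorphM.
have E1 : (px (fe1 f))%:~R * px w + (py (fe1 f))%:~R * py w = s.
  transitivity ((fdet f)%:~R * ((px (fe1 f))%:~R * (py (fe2 f))%:~R -
      (py (fe1 f))%:~R * (px (fe2 f))%:~R) * s); first by rewrite wx wy; ring.
  by rewrite -dE d2 mul1r.
have E2 : (px (fe2 f))%:~R * px w + (py (fe2 f))%:~R * py w = t.
  transitivity ((fdet f)%:~R * ((px (fe1 f))%:~R * (py (fe2 f))%:~R -
      (py (fe1 f))%:~R * (px (fe2 f))%:~R) * t); first by rewrite wx wy; ring.
  by rewrite -dE d2 mul1r.
transitivity (h a + ((px (fo f))%:~R * px w + (py (fo f))%:~R * py w)
  + xa%:~R * ((px (fe1 f))%:~R * px w + (py (fe1 f))%:~R * py w)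
  + ya%:~R * ((px (fe2 f))%:~R * px w + (py (fe2 f))%:~R * py w)); first by ring.
by rewrite E1 E2.
Qed.

Lemma frame_coords : exists a b c a' b' c' : int,
  (a * b' - a' * b) * (a * b' - a' * b) = 1 /\
  forall z, fX f z = a * px z + b * py z + c /\ fY f z = a' * px z + b' * py z + c'.
Proof.
exists (fdet f * py (fe2 f)), (- (fdet f * px (fe2 f))),
  (fdet f * (py (fo f) * px (fe2 f) - px (fo f) * py (fe2 f))),
  (- (fdet f * py (fe1 f))), (fdet f * px (fe1 f)),
  (fdet f * (py (fe1 f) * px (fo f) - px (fe1 f) * py (fo f))).
split; last by move=> z; rewrite /fX /fY; split; ring.
set d := _ - _.
have -> : d = fdet f * fdet f * (px (fe1 f) * py (fe2 f) - py (fe1 f) * px (fe2 f)).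
  by rewrite /d; ring.
by rewrite fdet2 mul1r -/(fdet f) fdet2.
Qed.

End FrameTheory.

Global Opaque fX fY.

(** * Triangles over the unit segments of a bottom row *)

Lemma seq_argmin (T : eqType) (R : realDomainType) (F : T -> R) (s : seq T) x :
  x \in s -> exists2 y, y \in s & forall z, z \in s -> F y <= F z.
Proof.
elim: s x => [//|a s IH] x _.
case: s IH => [|b s] IH.
  by exists a; rewrite ?inE ?eqxx // => z; rewrite inE => /eqP->.
have [|y ys ym] := IH b; first by rewrite inE eqxx.
have [ay|ya] := lerP (F a) (F y).
  exists a; first by rewrite inE eqxx.
  move=> z; rewrite inE => /orP[/eqP-> //|/ym]; exact: le_trans.
exists y; first by rewrite inE ys orbT.
by move=> z; rewrite inE => /orP[/eqP->|/ym //]; exact: ltW.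
Qed.

(* Minimising, over the pairs of points of the bottom row on both sides of
   x + 1/2, the height of their chord there yields an edge of the lower hull of
   the bottom row; tilting it up until it hits a higher point yields a cell. *)
Section Apex.
Variables (R : realType) (A : {fset lpoint}) (h : lpoint -> R).
Variable D : {fset {fset lpoint}}.
Hypothesis indD : induces A h D.
Hypothesis uniD : forall T, T \in D -> unimodular_triangle T.
Variable f : frame.
Local Notation X := (fX f).
Local Notation Y := (fY f).
Hypothesis Ypos : forall a, a \in A -> 0 <= Y a.

Lemma bottom_chord x : fpt f x 0 \in A -> fpt f (x + 1) 0 \in A ->
  exists a b, [/\ a \in A, b \in A, Y a = 0 & Y b = 0] /\
   [/\ X a <= x, x + 1 <= X b & exists s mu : R,
      [/\ h a + (X a)%:~R * s = mu, h b + (X b)%:~R * s = mu &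
       forall c, c \in A -> Y c = 0 -> mu <= h c + (X c)%:~R * s]].
Proof.
move=> xA x1A.
(* Twice the height of the chord at x + 1/2. At a half-integer both weights are strictly positive,
   so minimality yields an inequality at either end. *)
pose F (ab : lpoint * lpoint) : R := (h ab.1 * ((X ab.2)%:~R *+ 2 - x%:~R *+ 2 - 1)
   + h ab.2 * (x%:~R *+ 2 + 1 - (X ab.1)%:~R *+ 2)) / ((X ab.2)%:~R - (X ab.1)%:~R).
pose L := [seq a <- A | (Y a == 0) && (X a <= x)].
pose U := [seq a <- A | (Y a == 0) && (x + 1 <= X a)].
have inL a : a \in L -> [/\ a \in A, Y a = 0 & X a <= x].
  by rewrite mem_filter => /andP[/andP[/eqP-> ->] ->].
have inU a : a \in U -> [/\ a \in A, Y a = 0 & x + 1 <= X a].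
  by rewrite mem_filter => /andP[/andP[/eqP-> ->] ->].
have [|[a b] /allpairsP[[a' b'] /= [aL bU [ea eb]]] abm] :=
  @seq_argmin _ _ F [seq (a, b) | a <- L, b <- U] (fpt f x 0, fpt f (x + 1) 0).
  apply/allpairsP; exists (fpt f x 0, fpt f (x + 1) 0); split=> //=;
  by rewrite mem_filter fY_fpt fX_fpt eqxx /= ?lexx ?xA ?x1A.
subst a' b'; have [aA a0 ax] := inL _ aL; have [bA b0 bx] := inU _ bU.
exists a, b; split=> //; split=> //.
have gap c d : X c <= x -> x + 1 <= X d ->
  [/\ 0 < (X d)%:~R - (X c)%:~R :> R, 0 < (X d)%:~R *+ 2 - x%:~R *+ 2 - 1 :> R
    & 0 < x%:~R *+ 2 + 1 - (X c)%:~R *+ 2 :> R].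
  rewrite -(ler_int R (X c)) -(ler_int R (x + 1)) rmorphD /=.
  by move: ((X c)%:~R : R) ((X d)%:~R : R) (x%:~R : R) => u v w; split; lra.
pose s : R := (h a - h b) / ((X b)%:~R - (X a)%:~R).
have [ab0 ab1 ab2] := gap _ _ ax bx.
have sE : s * ((X b)%:~R - (X a)%:~R) = h a - h b by rewrite /s divfK // gt_eqF.
pose mu := h a + (X a)%:~R * s.
have muE : h b + (X b)%:~R * s = mu by rewrite /mu; move: sE; rewrite mulrBr [s * _]mulrC [s * (X a)%:~R]mulrC; lra.
exists s, mu; split=> // c cA c0.
(* F is a weighted mean of h, and h = mu - s X + (excess over the chord). *)
have FE p q : X p <= x -> x + 1 <= X q ->
   F (p, q) * ((X q)%:~R - (X p)%:~R) =
   ((h p + (X p)%:~R * s - mu) * ((X q)%:~R *+ 2 - x%:~R *+ 2 - 1)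
   + (h q + (X q)%:~R * s - mu) * (x%:~R *+ 2 + 1 - (X p)%:~R *+ 2))
   + (mu *+ 2 - s * (x%:~R *+ 2 + 1)) * ((X q)%:~R - (X p)%:~R).
  move=> px_ qx; have [g0 _ _] := gap _ _ px_ qx.
  by rewrite /F divfK ?gt_eqF //=; ring.
have Fab : F (a, b) = mu *+ 2 - s * (x%:~R *+ 2 + 1).
  apply: (@mulIf _ ((X b)%:~R - (X a)%:~R)); first by rewrite gt_eqF.
  by rewrite FE // muE /mu; ring.
have [cx|cx] := lerP (X c) x.
  have [g0 g1 g2] := gap _ _ cx bx.
  have cL : c \in L by rewrite mem_filter c0 eqxx cx cA.
  have : F (a, b) <= F (c, b) by apply: abm; apply/allpairsP; exists (c, b).
  rewrite -(ler_pM2r g0) FE // Fab muE subrr mul0r addr0 lerDr pmulr_lge0 //.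
  by rewrite subr_ge0.
have cx' : x + 1 <= X c by rewrite lezD1.
have [g0 g1 g2] := gap _ _ ax cx'.
have cU : c \in U by rewrite mem_filter c0 eqxx cx' cA.
have : F (a, b) <= F (a, c) by apply: abm; apply/allpairsP; exists (a, c).
rewrite -(ler_pM2r g0) FE // Fab /mu subrr mul0r add0r lerDr pmulr_lge0 //.
by rewrite subr_ge0.
Qed.

Lemma bottom_apex x : (exists2 a, a \in A & 0 < Y a) ->
  fpt f x 0 \in A -> fpt f (x + 1) 0 \in A ->
  exists p, [fset fpt f x 0; fpt f (x + 1) 0; fpt f p 1]%fset \in D.
Proof.
move=> [u uA u0] xA x1A.
have [a [b [[aA bA a0 b0] [ax bx [s [mu [ea eb mum]]]]]]] := bottom_chord xA x1A.
pose U := [seq a <- A | 0 < Y a].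
have [|c + cm] := @seq_argmin _ R (fun c => (h c + (X c)%:~R * s - mu) / (Y c)%:~R) U u.
  by rewrite mem_filter u0.
rewrite mem_filter => /andP[c0 cA].
have c0R : 0 < (Y c)%:~R :> R by rewrite ltr0z.
(* The least slope for which mu <= h z + X z s + Y z t holds at all points above the bottom row; it
   is attained at c. *)
pose t := - ((h c + (X c)%:~R * s - mu) / (Y c)%:~R).
have tE : h c + (X c)%:~R * s + (Y c)%:~R * t = mu.
  by rewrite /t mulrN [(Y c)%:~R * _]mulrC divfK ?gt_eqF //; ring.
have [w [C wE]] := frame_covector f s t.
have low z : z \in A -> mu <= h z + (X z)%:~R * s + (Y z)%:~R * t.
  move=> zA; have := Ypos zA; rewrite le_eqVlt => /orP[/eqP z0|z0].
    by rewrite -z0 mul0r addr0; apply: mum.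
  have z0R : 0 < (Y z)%:~R :> R by rewrite ltr0z.
  have : - t <= (h z + (X z)%:~R * s - mu) / (Y z)%:~R.
    by rewrite /t opprK; apply: cm; rewrite mem_filter z0.
  by rewrite ler_pdivlMr // mulNr mulrC; lra.
have cell z : z \in A -> h z + (X z)%:~R * s + (Y z)%:~R * t = mu ->
    z \in dual_cell A h w.
  move=> zA ez; apply/dual_cellP; split=> // y yA; rewrite !wE.
  by have := low y yA; lra.
have aT : a \in dual_cell A h w by apply: cell; rewrite // a0 mul0r addr0.
have bT : b \in dual_cell A h w by apply: cell; rewrite // b0 mul0r addr0.
have cT : c \in dual_cell A h w by apply: cell.
have TD : dual_cell A h w \in D.
  apply/indD; split; last by exists w.
  exists a, b, c; split=> //; rewrite -normr_eq0 (norm_orientation_frame f) normr_eq0 a0 b0 subrr.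
  rewrite mul0r !subr0 mulf_neq0 ?gt_eqF // subr_gt0.
  by apply: le_lt_trans ax _; rewrite -lezD1.
have ab : a != b by apply/eqP => E; move: ax bx; rewrite E; clear; lia.
have [q eT oq] := unimodular_apex (uniD TD) aT bT ab.
have cq : c = q.
  by move: cT; rewrite eT !inE => /orP[/orP[]|]/eqP // E; move: c0; rewrite E ?a0 ?b0 ltxx.
rewrite -cq in eT oq.
move: oq; rewrite (norm_orientation_frame f) a0 b0 subrr mul0r !subr0 => oq.
(* Unimodularity says that the product of X b - X a and Y c is 1: the chord is the given unit
   segment and the apex lies in row 1. *)
have [ab1 c1] : X b - X a = 1 /\ Y c = 1.
  by move: c0 ax bx oq; move: (Y c) (X a) (X b) => yc xa xb; clear; nia.
exists (X c).
have -> : fpt f x 0 = a by rewrite -(fptK f a) a0; congr fpt; move: ax bx ab1; clear; lia.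
have -> : fpt f (x + 1) 0 = b by rewrite -(fptK f b) b0; congr fpt; move: ax bx ab1; clear; lia.
by rewrite -{1}c1 fptK -eT.
Qed.

End Apex.

(** * Null points on a bottom row *)

Section BottomRow.
Variables (R : realType) (A : {fset lpoint}) (h : lpoint -> R).
Variable D : {fset {fset lpoint}}.
Hypothesis indD : induces A h D.
Hypothesis uniD : forall T, T \in D -> unimodular_triangle T.
Variable f : frame.
Local Notation X := (fX f).
Local Notation Y := (fY f).
Hypothesis Ypos : forall a, a \in A -> 0 <= Y a.

Lemma row_triangle_norm x p (sg : int) : sg * sg = 1 ->
  `|orientation (fpt f (x + sg) 0) (fpt f x 0) (fpt f p 1)| = 1.
Proof.
move=> sg1; rewrite (norm_orientation_frame f) !fX_fpt !fY_fpt.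
move: sg1; clear; nia.
Qed.

(** The sign condition on k places a in the cone at w = (x, 0) spanned by the two sides of T, since
    a - w = k (sg, 0) + Y a (p - x, 1). A cell through w and a then overlaps T, and [cell_compat]
    applies. *)
Lemma cone_cell x p (sg : int) S T a : sg * sg = 1 -> S \in D -> T \in D ->
  T = [fset fpt f (x + sg) 0; fpt f x 0; fpt f p 1]%fset ->
  fpt f x 0 \in S -> a \in S -> 0 <= sg * (X a - x - Y a * (p - x)) -> a \in T.
Proof.
move=> sg1 SD TD eT wS aS; set k := sg * _ => k0.
have ya := Ypos (cell_sub indD SD aS).
have wt : 1 + (k + Y a) = k + Y a + 1 by ring.
have ex : X a + (k + Y a) * X (fpt f x 0) =
   k * X (fpt f (x + sg) 0) + Y a * X (fpt f p 1) + 1 * X (fpt f x 0).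
  rewrite !fX_fpt.
  transitivity (k * x + x + sg * sg * (X a - x - Y a * (p - x)) + Y a * p); last by rewrite /k; ring.
  by rewrite sg1; ring.
have ey : Y a + (k + Y a) * Y (fpt f x 0) =
   k * Y (fpt f (x + sg) 0) + Y a * Y (fpt f p 1) + 1 * Y (fpt f x 0).
  by rewrite !fY_fpt; ring.
have [hx hy] := frame_combination wt ex ey.
apply: (cell_compat indD SD TD aS wS _ _ _ _ k0 ya ler01 wt hx hy).
- by rewrite eT !inE eqxx.
- by rewrite eT !inE eqxx orbT.
- by rewrite eT !inE eqxx !orbT.
- exact: addr_ge0.
Qed.

Lemma unimodular_sub_eq S T : S \in D -> T \in D ->
  (forall a, a \in S -> a \in T) -> S = T.
Proof.
move=> SD TD sub.
have [a [b [c [eS oS]]]] := uniD SD; have [a' [b' [c' [eT oT]]]] := uniD TD.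
apply/eqP; rewrite eqEfcard; apply/andP; split; first by apply/fsubsetP.
by rewrite eS eT !card_unimodular.
Qed.

(** All lattice points lie in the cone of the triangle at its corner, so it is the only triangle
    there, and its dual vertex has at most the edge across the opposite side. *)
Lemma ear_row x p (sg : int) : sg * sg = 1 ->
  [fset fpt f (x + sg) 0; fpt f x 0; fpt f p 1]%fset \in D ->
  (forall a, a \in A -> 0 <= sg * (X a - x - Y a * (p - x))) ->
  null_point D (fpt f x 0).
Proof.
move=> sg1 TD side; pose t : D := [` TD]%fset.
have star (S : D) : fpt f x 0 \in val S -> S = t \/ S = t.
  move=> wS; left; apply/val_inj => /=; apply: (unimodular_sub_eq (valP S) TD) => a aS.
  apply: (cone_cell sg1 (valP S) TD erefl wS aS); apply: side.
  exact: (cell_sub indD (valP S) aS).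
have ot := row_triangle_norm x p sg1.
have et : val t = [fset fpt f (x + sg) 0; fpt f x 0; fpt f p 1]%fset by [].
have nt (g : {set D}) : g \in bounded_edges D -> t \in g -> g != [set t; t]%SET.
  move=> gE tg; have [T [-> Tt _]] := bounded_edge_other uniD gE tg.
  by apply/eqP => /set2_eq[[_ E]|[_ E]]; rewrite E eqxx in Tt.
have deg : (degree (bounded_edges D) t <= 1)%N.
  rewrite /degree; apply/card_le1_eqP => e e'.
  rewrite inE => /andP[eE te]; rewrite inE => /andP[e'E te'].
  by rewrite (side_edge_unique indD uniD et ot star eE te (nt _ eE te) e'E te' (nt _ e'E te')).
by apply: (ear_null indD uniD) => S /star[]->.
Qed.

(** The cones of the two triangles at w cover the upper half-plane, so a cell at w has its vertices
    among the four known points. Three of these are collinear, which leaves the two triangles. *)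
Lemma mid_row x p :
  [fset fpt f (x - 1) 0; fpt f x 0; fpt f p 1]%fset \in D ->
  [fset fpt f (x + 1) 0; fpt f x 0; fpt f p 1]%fset \in D ->
  null_point D (fpt f x 0).
Proof.
move=> TD1 TD2; pose t1 : D := [` TD1]%fset; pose t2 : D := [` TD2]%fset.
have m11 : (-1) * (-1) = 1 :> int by [].
have o1 := row_triangle_norm x p m11.
have o2 := row_triangle_norm x p (mulr1 1).
have [m1 _ m3] := unimodular_neq o1; have [n1 _ n3] := unimodular_neq o2.
have mn : fpt f (x - 1) 0 != fpt f (x + 1) 0.
  by apply/eqP => /(congr1 X); rewrite !fX_fpt; clear; lia.
have Ex z : px (fpt f (z - 1) 0) + px (fpt f (z + 1) 0) = 2 * px (fpt f z 0).
  by rewrite !px_fpt; ring.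
have Ey z : py (fpt f (z - 1) 0) + py (fpt f (z + 1) 0) = 2 * py (fpt f z 0).
  by rewrite !py_fpt; ring.
apply: (@mid_null _ _ _ _ indD uniD (fpt f (x - 1) 0) _ (fpt f (x + 1) 0) (fpt f p 1) t1 t2) => // S wS.
have SD := valP S.
have mem a : a \in val S -> a \in [:: fpt f (x - 1) 0; fpt f (x + 1) 0; fpt f x 0; fpt f p 1].
  move=> aS; have [k0|k0] := lerP 0 (X a - x - Y a * (p - x)).
    have := @cone_cell x p 1 _ _ a (mulr1 1) SD TD2 erefl wS aS; rewrite mul1r => /(_ k0).
    by rewrite !inE => /orP[/orP[]|] ->; rewrite ?orbT.
  have := @cone_cell x p (-1) _ _ a m11 SD TD1 erefl wS aS; rewrite mulN1r oppr_ge0 => /(_ (ltW k0)).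
  by rewrite !inE => /orP[/orP[]|] ->; rewrite ?orbT.
have [mS|mS] := boolP (fpt f (x - 1) 0 \in val S).
  left; apply/val_inj => /=.
  have [c eS oc] := unimodular_apex (uniD SD) mS wS m1.
  have [_ nc1 nc2] := unimodular_neq oc.
  have : c \in val S by rewrite eS !inE eqxx orbT.
  move=> /mem; rewrite !inE ![c == fpt f (x - 1) 0]eq_sym ![c == fpt f x 0]eq_sym (negPf nc1) (negPf nc2) /=.
  case/orP => /eqP E; last by rewrite eS E.
  move: oc; rewrite E (norm_orientation_frame f) !fX_fpt !fY_fpt.
  by rewrite subrr !mulr0 mul0r subrr normr0.
have [nS|nS] := boolP (fpt f (x + 1) 0 \in val S).
  right; apply/val_inj => /=.
  have [c eS oc] := unimodular_apex (uniD SD) nS wS n1.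
  have [_ nc1 nc2] := unimodular_neq oc.
  have cS : c \in val S by rewrite eS !inE eqxx orbT.
  have := mem _ cS; rewrite !inE ![c == fpt f (x + 1) 0]eq_sym ![c == fpt f x 0]eq_sym (negPf nc1) (negPf nc2) /=.
  case/orP => /eqP E; last by rewrite eS E.
  by rewrite E (negPf mS) in cS.
have [a [b [c [eS oS]]]] := uniD SD.
have : (#|` val S| <= #|` [fset fpt f x 0; fpt f p 1]|)%N%fset.
  apply: fsubset_leq_card; apply/fsubsetP => y yS; have := mem _ yS.
  rewrite !inE => /or4P[]/eqP E; rewrite ?E ?eqxx ?orbT //.
    by rewrite E (negPf mS) in yS.
  by rewrite E (negPf nS) in yS.
by rewrite {1}eS card_unimodular // cardfs2; case: (_ != _).
Qed.

End BottomRow.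

Lemma PoszS n : n.+1%:Z = n%:Z + 1.
Proof. by rewrite -addn1 PoszD. Qed.

(** Each step that is not a repetition raises the value by at least one. *)
Lemma count_repeats (p : nat -> int) n :
  (forall i, (i < n)%N -> p i <= p i.+1) ->
  n%:Z <= (count (fun i => p i == p i.+1) (iota 0 n))%:Z + (p n - p 0%N).
Proof.
elim: n => [|n IH] mono; first by rewrite subrr.
have {IH} := IH (fun i hi => mono i (ltn_trans hi (ltnSn n))).
rewrite -addn1 iotaD count_cat /= add0n addn0 addn1.
have := mono n (ltnSn n); case: eqP => [->|]; move: (p n) (p n.+1) (p 0%N) => u v w; clear; lia.
Qed.

Section BottomRowCount.
Variables (R : realType) (A : {fset lpoint}) (h : lpoint -> R).
Variable D : {fset {fset lpoint}}.
Hypothesis indD : induces A h D.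
Hypothesis uniD : forall T, T \in D -> unimodular_triangle T.
Variable f : frame.
Local Notation X := (fX f).
Local Notation Y := (fY f).
Hypothesis Ypos : forall a, a \in A -> 0 <= Y a.

(* The apexes p i over the unit segments of the bottom row are nondecreasing.
   A bottom point between equal apexes is a null point, and so is a corner whose
   apex lies on the boundary; the interior points of row 1 are at [al, be]. *)
Lemma bottom_row_null (x0 al be : int) (L : nat) :
  (exists2 a, a \in A & 0 < Y a) ->
  (forall i, (i <= L)%N -> fpt f (x0 + i%:Z) 0 \in A) ->
  (forall a, a \in A -> Y a = 1 -> al - 1 <= X a <= be + 1) ->
  (fpt f (al - 1) 1 \in A ->
     forall a, a \in A -> Y a * (al - 1 - x0) <= X a - x0) ->
  (fpt f (be + 1) 1 \in A ->
     forall a, a \in A -> X a - (x0 + L%:Z) <= Y a * (be + 1 - (x0 + L%:Z))) ->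
  al <= be + 1 ->
  exists K : {fset lpoint}, [/\ (K `<=` A)%fset,
    forall w, w \in K -> null_point D w /\ Y w = 0 &
    L%:Z <= #|` K|%:Z + (be - al + 1)].
Proof.
move=> up row0 row1 leftb rightb albe.
case: L row0 rightb => [|n] row0 rightb.
  exists fset0; split; rewrite ?fsub0set //.
  by rewrite cardfs0 add0r addrAC subr_ge0.
pose w i := fpt f (x0 + i%:Z) 0.
have wS i : w i.+1 = fpt f (x0 + i%:Z + 1) 0 by rewrite /w PoszS addrA.
have apexP i : exists p, (i <= n)%N -> [fset w i; w i.+1; fpt f p 1]%fset \in D.
  have [le_i|lt_i] := leqP i n; last by exists 0.
  have h1 : fpt f (x0 + i%:Z) 0 \in A by apply: row0; apply: leqW.
  have h2 : fpt f (x0 + i%:Z + 1) 0 \in A by rewrite -wS; apply: row0.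
  have [p pD] := bottom_apex indD uniD Ypos up h1 h2.
  by exists p => _; rewrite wS.
have [p pD] := choice apexP.
have pA i : (i <= n)%N -> fpt f (p i) 1 \in A.
  by move=> /pD TD; apply: (cell_sub indD TD); rewrite !inE eqxx orbT.
have pmono i : (i < n)%N -> p i <= p i.+1.
  move=> lt_i; rewrite leNgt; apply/negP => gt.
  have TD1 := pD i (ltnW lt_i); have TD2 := pD i.+1 lt_i.
  set T1 := [fset w i; w i.+1; fpt f (p i) 1]%fset in TD1.
  set T2 := [fset w i.+1; w i.+2; fpt f (p i.+1) 1]%fset in TD2.
  (* With the apexes in the wrong order, p_(i+1) + k w_(i+2) = k w_(i+1) + p_i with k > 0 would make
     two edges cross. *)
  set k := p i - p i.+1.
  have k0 : 0 <= k by rewrite subr_ge0 ltW.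
  have w1x : X (w i.+1) = x0 + i%:Z + 1 by rewrite wS fX_fpt.
  have w2x : X (w i.+2) = x0 + i%:Z + 2 by rewrite /w fX_fpt !PoszS; ring.
  have w1y : Y (w i.+1) = 0 by rewrite /w fY_fpt.
  have w2y : Y (w i.+2) = 0 by rewrite /w fY_fpt.
  have wt : 1 + k = k + 1 + 0 by ring.
  have ex : X (fpt f (p i.+1) 1) + k * X (w i.+2) =
     k * X (w i.+1) + 1 * X (fpt f (p i) 1) + 0 * X (w i.+1).
    by rewrite w1x w2x !fX_fpt /k; ring.
  have ey : Y (fpt f (p i.+1) 1) + k * Y (w i.+2) =
     k * Y (w i.+1) + 1 * Y (fpt f (p i) 1) + 0 * Y (w i.+1).
    by rewrite w1y w2y !fY_fpt; ring.
  have [hx hy] := frame_combination wt ex ey.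
  have i1 : fpt f (p i.+1) 1 \in T2 by rewrite !inE eqxx orbT.
  have i2 : w i.+2 \in T2 by rewrite !inE eqxx orbT.
  have i3 : w i.+1 \in T1 by rewrite !inE eqxx orbT.
  have i4 : fpt f (p i) 1 \in T1 by rewrite !inE eqxx orbT.
  have := cell_compat indD TD2 TD1 i1 i2 i3 i4 i3 k0 k0 ler01 (lexx 0) wt hx hy.
  rewrite !inE => /orP[/orP[]|]/eqP E.
  - by move/(congr1 Y): E; rewrite /w !fY_fpt.
  - by move/(congr1 Y): E; rewrite /w !fY_fpt.
  - by move/(congr1 X): E; rewrite !fX_fpt => E; rewrite E ltxx in gt.
pose s1 := [seq i <- iota 0 n | p i == p i.+1].
(* Indices of the null points: the left corner 0, the points i + 1 between equal apexes i and i + 1,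
   and the right corner n + 1. There are n + 1 unit segments, with apexes numbered from 0 to n. *)
pose s := nseq (p 0%N == al - 1) 0%N ++ map S s1 ++ nseq (p n == be + 1) n.+1.
have sn i : i \in s1 -> (i < n)%N by rewrite mem_filter mem_iota add0n => /andP[_].
have us : uniq s.
  rewrite /s !cat_uniq.
  have -> : uniq (nseq (p 0%N == al - 1) 0%N) by case: (_ == _).
  have -> : uniq (nseq (p n == be + 1) n.+1) by case: (_ == _).
  rewrite (map_inj_uniq succn_inj) filter_uniq ?iota_uniq // andbT /=.
  apply/andP; split.
    apply/hasPn => i; rewrite mem_cat => /orP[/mapP[j _ ->]|]; rewrite !mem_nseq.
      by rewrite andbF.
    by move=> /andP[_ /eqP->]; rewrite andbF.
  apply/hasPn => i; rewrite mem_nseq => /andP[_ /eqP->]; apply/negP => /mapP[j /sn lj [E]].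
  by rewrite E ltnn in lj.
have winj : injective w.
  by move=> i j /(congr1 X); rewrite /w !fX_fpt => /addrI [].
have nulls i : i \in s -> null_point D (w i) /\ (i <= n.+1)%N.
  rewrite !mem_cat => /or3P[].
  - rewrite mem_nseq => /andP[]; case: eqP => // p0 _ /eqP->; split=> //.
    rewrite /w addr0; apply: (ear_row indD uniD Ypos (mulr1 1) (p := p 0%N)).
      have := pD 0%N isT; rewrite wS {1}/w addr0 fset3_swap; exact.
    move=> a aA; rewrite mul1r subr_ge0 p0; apply: leftb => //.
    by rewrite -p0; apply: pA.
  - move=> /mapP[j js ->]; have jn := sn _ js; split; last by rewrite ltnS ltnW.
    move: js; rewrite mem_filter => /andP[/eqP pj _].
    rewrite wS; apply: (mid_row indD uniD Ypos (p := p j)).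
      by rewrite addrK -wS; have := pD j (ltnW jn).
    by have := pD j.+1 jn; rewrite -pj fset3_swap !wS PoszS addrA.
  - rewrite mem_nseq => /andP[]; case: eqP => // p0 _ /eqP->; split=> //.
    rewrite /w; apply: (ear_row indD uniD Ypos (sg := -1) (p := p n)) => //.
      have := pD n (leqnn n); rewrite wS {1}/w.
      have -> : x0 + n.+1%:Z - 1 = x0 + n%:Z by rewrite PoszS addrA addrK.
      by have -> : x0 + n%:Z + 1 = x0 + n.+1%:Z by rewrite PoszS addrA.
    move=> a aA; rewrite mulN1r oppr_ge0 subr_le0 p0; apply: rightb => //.
    by rewrite -p0; apply: pA.
exists [fset x in map w s]%fset; split.
- by apply/fsubsetP => x; rewrite in_fset => /mapP[i /nulls[_ le_i] ->]; apply: row0.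
- move=> x; rewrite in_fset => /mapP[i /nulls[nx _] ->]; split=> //.
  by rewrite /w fY_fpt.
rewrite card_fseq undup_id ?map_inj_uniq // size_map /s !size_cat size_map !size_nseq.
(* The apexes range over [al, be], except that p 0 may be al - 1 and p n may be be + 1; each such
   excess is paid for by a corner in [s]. *)
have := count_repeats pmono; rewrite -size_filter -/s1.
have : al - (p 0%N == al - 1)%:Z <= p 0%N.
  have := row1 _ (pA 0%N isT); rewrite fX_fpt fY_fpt => /(_ erefl).
  case: eqP => [->|]; move: (p 0%N); clear; lia.
have : p n <= be + (p n == be + 1)%:Z.
  have := row1 _ (pA n (leqnn n)); rewrite fX_fpt fY_fpt => /(_ erefl).
  case: eqP => [->|]; move: (p n); clear; lia.
rewrite !PoszD; move: (Posz (p 0%N == al - 1)) (Posz (p n == be + 1)) (p 0%N) (p n) (size s1).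
rewrite PoszS; clear; lia.
Qed.

End BottomRowCount.

(** * Convexity *)

Section Convex.
Variable R : realType.
Implicit Types (u v : plane R) (C : set (plane R)).

Lemma convex_setP C : convex_set C <->
  forall u v (t : R), 0 <= t -> t <= 1 -> C u -> C v -> C (t *: u + (1 - t) *: v).
Proof.
split=> [cC u v t t0 t1 Cu Cv|cC u v t]; last first.
  by rewrite !inE => Cu Cv; apply: cC.
have := cC u v (Itv01 t0 t1); rewrite !inE; exact.
Qed.

Lemma conv_hull_convex C : convex_set (conv_hull C).
Proof.
apply/convex_setP => u v t t0 t1 Cu Cv B [cB CB].
by move/convex_setP: (cB); apply => //; [apply: Cu|apply: Cv].
Qed.

Lemma sub_conv_hull C : C `<=` conv_hull C.
Proof. exact: sub_gen_smallest. Qed.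

Lemma px_comb (s t : R) u v : px (s *: u + t *: v) = s * px u + t * px v.
Proof. by rewrite /px !mxE. Qed.

Lemma py_comb (s t : R) u v : py (s *: u + t *: v) = s * py u + t * py v.
Proof. by rewrite /py !mxE. Qed.

Lemma conv_hull_halfplane C (p q c : R) :
  (forall u, C u -> c <= p * px u + q * py u) ->
  forall u, conv_hull C u -> c <= p * px u + q * py u.
Proof.
move=> hC u; apply: (smallest_sub (X := [set u | c <= p * px u + q * py u])) => //.
apply/convex_setP => {}u v t t0 t1 /= hu hv; rewrite px_comb py_comb.
have -> : p * (t * px u + (1 - t) * px v) + q * (t * py u + (1 - t) * py v) =
   t * (p * px u + q * py u) + (1 - t) * (p * px v + q * py v) by ring.
have -> : c = t * c + (1 - t) * c by ring.
by apply: lerD; apply: ler_wpM2l => //; rewrite subr_ge0.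
Qed.

Lemma interiorP C u : interior C u <-> exists2 e : R, 0 < e &
  forall v, `|px v - px u| < e -> `|py v - py u| < e -> C v.
Proof.
split.
  move=> /nbhs_ballP[e /= e0 eC]; exists e => // v hx hy; apply: eC.
  split=> // i j; rewrite (ord1 j).
  by case: (unliftP ord0 i) => [k|] ->; rewrite ?(ord1 k) /ball /= distrC.
move=> [e e0 eC]; apply/nbhs_ballP; exists e => //= v [_ b]; apply: eC.
  by have := b ord0 ord0; rewrite /ball /= distrC.
by have := b (lift ord0 ord0) ord0; rewrite /ball /= distrC.
Qed.

(** The homothety with centre v and ratio t carries the box of radius e about u to a box of radius t
    e about the new point; [u'] is the preimage of w. *)
Lemma interior_segment C u v (t : R) : convex_set C -> interior C u -> C v ->
  0 < t -> t <= 1 -> interior C (t *: u + (1 - t) *: v).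
Proof.
move=> /convex_setP cC /interiorP[e e0 eC] Cv t0 t1; apply/interiorP.
exists (t * e) => [|w]; first exact: mulr_gt0.
rewrite px_comb py_comb => hx hy.
pose u' := t^-1 *: w + (1 - t^-1) *: v.
have tN0 : t != 0 by rewrite gt_eqF.
have -> : w = t *: u' + (1 - t) *: v.
  apply: cV2_eq; rewrite /u' ?px_comb ?py_comb.
    by move: (px w) (px v) => a b; field.
  by move: (py w) (py v) => a b; field.
apply: cC => //; first exact: ltW.
apply: eC; rewrite /u' ?px_comb ?py_comb.
  have -> : t^-1 * px w + (1 - t^-1) * px v - px u =
     t^-1 * (px w - (t * px u + (1 - t) * px v)).
    by move: (px w) (px v) (px u) => a b c; field.
  by rewrite normrM gtr0_norm ?invr_gt0 // ltr_pdivrMl.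
have -> : t^-1 * py w + (1 - t^-1) * py v - py u =
   t^-1 * (py w - (t * py u + (1 - t) * py v)).
  by move: (py w) (py v) (py u) => a b c; field.
by rewrite normrM gtr0_norm ?invr_gt0 // ltr_pdivrMl.
Qed.

Lemma px_emb (z : lpoint) : px (emb R z) = (px z)%:~R.
Proof. by rewrite /px mxE. Qed.

Lemma py_emb (z : lpoint) : py (emb R z) = (py z)%:~R.
Proof. by rewrite /py mxE. Qed.

Lemma finite_int_box (B : nat) :
  finite_set [set z : lpoint | `|px z| <= B%:Z /\ `|py z| <= B%:Z].
Proof.
pose r := [seq i%:Z - B%:Z | i <- iota 0 (B + B).+1].
pose s := [seq pt2 x y | x <- r, y <- r].
have memr (t : int) : `|t| <= B%:Z -> t \in r.
  by move=> ht; apply/mapP; exists (absz (t + B%:Z)); [rewrite mem_iota|]; move: ht; clear; lia.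
apply: (@sub_finite_set _ _ [set` s]); last exact: finite_seq.
move=> z [hx hy] /=; apply/allpairsP; exists (px z, py z); split=> /=.
- exact: memr hx.
- exact: memr hy.
by apply: cV2_eq; rewrite /px /py mxE.
Qed.

Section Polygon.
Variables (P : set (plane R)) (polyP : lattice_polygon P).

Lemma polygon_convex : convex_set P.
Proof. by case: polyP => F _ ->; apply: conv_hull_convex. Qed.

(** [fset_set] represents a set only if it is finite, so membership in [lattice_points] and
    [interior_points] rests on this. *)
Lemma polygon_finite : finite_set [set z : lpoint | P (emb R z)].
Proof.
case: polyP => F _ PE.
pose B := (\sum_(a <- F) (`|px a| + `|py a|)%N)%N.
have FB a : a \in F -> `|px a| <= B%:Z /\ `|py a| <= B%:Z.
  move=> aF; have : (`|px a| + `|py a| <= B)%N by rewrite /B (big_fsetD1 a) //= leq_addr.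
  by move: B => B; clear; lia.
apply: (@sub_finite_set _ _ [set z : lpoint | `|px z| <= B%:Z /\ `|py z| <= B%:Z]); last exact: finite_int_box.
have H (p q : int) : (forall a, a \in F -> - B%:Z <= p * px a + q * py a) ->
   forall z, P (emb R z) -> - B%:Z <= p * px z + q * py z.
  move=> hF z; rewrite PE => /(@conv_hull_halfplane _ p%:~R q%:~R (- B%:Z)%:~R).
  rewrite px_emb py_emb -!rmorphM -rmorphD ler_int; apply => _ [a aF <-].
  by rewrite px_emb py_emb -!rmorphM -rmorphD ler_int; apply: hF.
move=> z /= Pz.
have H1 : - B%:Z <= 1 * px z + 0 * py z by apply: H => // a /FB[]; clear; lia.
have H2 : - B%:Z <= (-1) * px z + 0 * py z by apply: H => // a /FB[]; clear; lia.
have H3 : - B%:Z <= 0 * px z + 1 * py z by apply: H => // a /FB[]; clear; lia.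
have H4 : - B%:Z <= 0 * px z + (-1) * py z by apply: H => // a /FB[]; clear; lia.
by move: H1 H2 H3 H4; clear; lia.
Qed.

Lemma mem_lattice_points z : (z \in lattice_points P) <-> P (emb R z).
Proof. by rewrite /lattice_points in_fset_set ?inE //; exact: polygon_finite. Qed.

Lemma mem_interior_points z : (z \in interior_points P) <-> interior P (emb R z).
Proof.
rewrite /interior_points in_fset_set ?inE //.
apply: sub_finite_set polygon_finite => a /=; exact: interior_subset.
Qed.

Lemma interior_lattice z : z \in interior_points P -> z \in lattice_points P.
Proof. by move=> /mem_interior_points/interior_subset/mem_lattice_points. Qed.

Lemma polygon_halfplane (p q c : R) :
  (forall a, a \in lattice_points P -> c <= p * (px a)%:~R + q * (py a)%:~R) ->
  forall u, P u -> c <= p * px u + q * py u.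
Proof.
have [F _ PE] := polyP; move=> hA u; rewrite {1}PE; apply: conv_hull_halfplane => _ [a aF <-].
rewrite px_emb py_emb; apply: hA; apply/mem_lattice_points; rewrite PE.
by apply: sub_conv_hull; exists a.
Qed.

End Polygon.
End Convex.

(** * Changes of lattice frame *)

Lemma frame_change (f : frame) (a b c a' b' c' : int) :
  (a * b' - a' * b) * (a * b' - a' * b) = 1 ->
  exists f' : frame, forall z, fX f' z = a * fX f z + b * fY f z + c /\
                               fY f' z = a' * fX f z + b' * fY f z + c'.
Proof.
set d := a * b' - a' * b => d2.
(* The new basis is given by the columns of the inverse matrix, where 1 / d = d. *)
pose e1 := (d * b') *: fe1 f - (d * a') *: fe2 f.
pose e2 := (d * a) *: fe2 f - (d * b) *: fe1 f.
pose o := fo f - c *: e1 - c' *: e2.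
have E1x : px e1 = d * (b' * px (fe1 f) - a' * px (fe2 f)) by rewrite /px !mxE; ring.
have E1y : py e1 = d * (b' * py (fe1 f) - a' * py (fe2 f)) by rewrite /py !mxE; ring.
have E2x : px e2 = d * (a * px (fe2 f) - b * px (fe1 f)) by rewrite /px !mxE; ring.
have E2y : py e2 = d * (a * py (fe2 f) - b * py (fe1 f)) by rewrite /py !mxE; ring.
have Ox : px o = px (fo f) - c * px e1 - c' * px e2 by rewrite /px !mxE.
have Oy : py o = py (fo f) - c * py e1 - c' * py e2 by rewrite /py !mxE.
have det : px e1 * py e2 - py e1 * px e2 = d * fdet f.
  transitivity (d * d * (d * fdet f)); last by rewrite d2 mul1r.
  by rewrite E1x E1y E2x E2y /fdet /d; ring.
have det2 : (px e1 * py e2 - py e1 * px e2) * (px e1 * py e2 - py e1 * px e2) = 1.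
  by rewrite det mulrACA d2 fdet2.
exists (Frame o det2) => z.
suff E : fpt (Frame o det2) (a * fX f z + b * fY f z + c) (a' * fX f z + b' * fY f z + c') = z.
  by rewrite -{1 4}E fX_fpt fY_fpt.
move: (px_frame f z) (py_frame f z); move: (fX f z) (fY f z) => x y zx zy.
apply: cV2_eq; rewrite ?px_fpt ?py_fpt /= ?zx ?zy ?Ox ?Oy.
  transitivity (px (fo f) + d * (a * b' - a' * b) * (x * px (fe1 f) + y * px (fe2 f))); last by rewrite -/d d2; ring.
  by rewrite E1x E2x; ring.
transitivity (py (fo f) + d * (a * b' - a' * b) * (x * py (fe1 f) + y * py (fe2 f))); last by rewrite -/d d2; ring.
by rewrite E1y E2y; ring.
Qed.

Lemma std_frame : exists f : frame, forall z, fX f z = px z /\ fY f z = py z.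
Proof.
have P0 x y : px (pt2 x y) = x /\ py (pt2 x y) = y by rewrite /px /py !mxE.
have det : (px (pt2 1 0) * py (pt2 0 1) - py (pt2 1 0) * px (pt2 0 1)) *
  (px (pt2 1 0) * py (pt2 0 1) - py (pt2 1 0) * px (pt2 0 1)) = 1.
  by rewrite !(P0 _ _).1 !(P0 _ _).2.
exists (Frame 0 det) => z.
have E : fpt (Frame 0 det) (px z) (py z) = z.
  apply: cV2_eq; rewrite ?px_fpt ?py_fpt /= ?(P0 _ _).1 ?(P0 _ _).2.
    by rewrite {1}/px !mxE; ring.
  by rewrite {1}/py !mxE; ring.
by rewrite -{1 3}E fX_fpt fY_fpt.
Qed.

(** * The polygon and its interior in frame coordinates *)

Section Body.
Variables (R : realType) (P : set (plane R)) (polyP : lattice_polygon P).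

Definition frpt f (x y : R) : plane R :=
  emb R (fo f) + x *: emb R (fe1 f) + y *: emb R (fe2 f).
Definition body f (x y : R) : Prop := P (frpt f x y).
Definition ibody f (x y : R) : Prop := interior P (frpt f x y).

Local Notation A := (lattice_points P).
Local Notation I := (interior_points P).

Variable f : frame.

Lemma px_frpt x y : px (frpt f x y) =
  (px (fo f))%:~R + x * (px (fe1 f))%:~R + y * (px (fe2 f))%:~R.
Proof. by rewrite /px /frpt !mxE. Qed.

Lemma py_frpt x y : py (frpt f x y) =
  (py (fo f))%:~R + x * (py (fe1 f))%:~R + y * (py (fe2 f))%:~R.
Proof. by rewrite /py /frpt !mxE. Qed.

Lemma emb_fpt x y : emb R (fpt f x y) = frpt f x%:~R y%:~R.
Proof.
by apply: cV2_eq; rewrite ?px_emb ?py_emb ?px_fpt ?py_fpt ?px_frpt ?py_frpt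
  !rmorphD !rmorphM.
Qed.

Lemma body_lattice x y : body f x%:~R y%:~R <-> fpt f x y \in A.
Proof. by rewrite /body -emb_fpt; split=> /(mem_lattice_points polyP). Qed.

Lemma ibody_lattice x y : ibody f x%:~R y%:~R <-> fpt f x y \in I.
Proof. by rewrite /ibody -emb_fpt; split=> /(mem_interior_points polyP). Qed.

Lemma body_mem z : z \in A -> body f (fX f z)%:~R (fY f z)%:~R.
Proof. by move=> zA; apply/body_lattice; rewrite fptK. Qed.

Lemma ibody_mem z : z \in I -> ibody f (fX f z)%:~R (fY f z)%:~R.
Proof. by move=> zA; apply/ibody_lattice; rewrite fptK. Qed.

Lemma frpt_comb (t x y x' y' : R) : t *: frpt f x y + (1 - t) *: frpt f x' y' =
  frpt f (t * x + (1 - t) * x') (t * y + (1 - t) * y').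
Proof.
by apply: cV2_eq; rewrite ?px_comb ?py_comb ?px_frpt ?py_frpt; ring.
Qed.

Lemma body_comb (t x y x' y' : R) : 0 <= t -> t <= 1 -> body f x y -> body f x' y' ->
  body f (t * x + (1 - t) * x') (t * y + (1 - t) * y').
Proof.
move=> t0 t1 h1 h2; rewrite /body -frpt_comb.
by have /convex_setP := polygon_convex polyP; apply.
Qed.

Lemma ibody_comb (t x y x' y' : R) : 0 < t -> t <= 1 -> ibody f x y -> body f x' y' ->
  ibody f (t * x + (1 - t) * x') (t * y + (1 - t) * y').
Proof.
move=> t0 t1 h1 h2; rewrite /ibody -frpt_comb.
exact: interior_segment (polygon_convex polyP) h1 h2 t0 t1.
Qed.

Lemma ibody_body x y : ibody f x y -> body f x y.
Proof. exact: interior_subset. Qed.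

Lemma frpt_small (e : R) : 0 < e -> exists2 e', 0 < e' & forall x y dx dy : R,
  `|dx| <= e' -> `|dy| <= e' ->
  `|px (frpt f (x + dx) (y + dy)) - px (frpt f x y)| < e /\
  `|py (frpt f (x + dx) (y + dy)) - py (frpt f x y)| < e.
Proof.
move=> e0.
pose M : R := `|(px (fe1 f))%:~R| + `|(px (fe2 f))%:~R| + `|(py (fe1 f))%:~R| + `|(py (fe2 f))%:~R| + 1.
have M0 : 0 < M by rewrite /M ltr_wpDl // !addr_ge0.
exists (e / M / 2); first by rewrite !divr_gt0.
move=> x y dx dy hx hy; rewrite !px_frpt !py_frpt.
have K (u v : R) : `|u| + `|v| < M -> `|dx * u + dy * v| < e.
  move=> uv; apply: le_lt_trans (ler_normD _ _) _; rewrite !normrM.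
  have : `|dx| * `|u| + `|dy| * `|v| <= e / M / 2 * (`|u| + `|v|).
    by rewrite mulrDr; apply: lerD; apply: ler_wpM2r.
  move/le_lt_trans; apply.
  have : e / M / 2 * (`|u| + `|v|) <= e / M / 2 * M by apply: ler_wpM2l; rewrite ?ltW // !divr_gt0.
  move/le_lt_trans; apply.
  have -> : e / M / 2 * M = e / 2 by field; rewrite gt_eqF.
  by move: e0; lra.
split.
  have -> : (px (fo f))%:~R + (x + dx) * (px (fe1 f))%:~R + (y + dy) * (px (fe2 f))%:~R -
    ((px (fo f))%:~R + x * (px (fe1 f))%:~R + y * (px (fe2 f))%:~R) = dx * (px (fe1 f))%:~R + dy * (px (fe2 f))%:~R by ring.
  apply: K; rewrite /M.
  have := normr_ge0 ((py (fe1 f))%:~R : R); have := normr_ge0 ((py (fe2 f))%:~R : R); lra.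
have -> : (py (fo f))%:~R + (x + dx) * (py (fe1 f))%:~R + (y + dy) * (py (fe2 f))%:~R -
    ((py (fo f))%:~R + x * (py (fe1 f))%:~R + y * (py (fe2 f))%:~R) = dx * (py (fe1 f))%:~R + dy * (py (fe2 f))%:~R by ring.
apply: K; rewrite /M.
have := normr_ge0 ((px (fe1 f))%:~R : R); have := normr_ge0 ((px (fe2 f))%:~R : R); lra.
Qed.

Lemma ibody_open x y : ibody f x y -> exists2 e : R, 0 < e &
  forall dx dy : R, `|dx| <= e -> `|dy| <= e -> body f (x + dx) (y + dy).
Proof.
move=> /interiorP[e e0 eP]; have [e' e'0 he] := frpt_small e0.
exists e' => // dx dy hx hy; have [h1 h2] := he x y dx dy hx hy.
exact: eP.
Qed.

Lemma body_halfplane (p q c : int) :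
  (forall a, a \in A -> c <= p * fX f a + q * fY f a) ->
  forall x y, body f x y -> c%:~R <= p%:~R * x + q%:~R * y.
Proof.
move=> hA x y bxy.
(* The functional (p, q) in standard coordinates: its values on [fe1] and [fe2] are p and q. *)
pose u : int := fdet f * (p * py (fe2 f) - q * py (fe1 f)).
pose v : int := fdet f * (q * px (fe1 f) - p * px (fe2 f)).
have U1 : u * px (fe1 f) + v * py (fe1 f) = p.
  by rewrite -[RHS]mul1r -(fdet2 f) {2}/fdet /u /v; ring.
have U2 : u * px (fe2 f) + v * py (fe2 f) = q.
  by rewrite -[RHS]mul1r -(fdet2 f) {2}/fdet /u /v; ring.
pose k : int := u * px (fo f) + v * py (fo f).
have K : (c + k)%:~R <= u%:~R * px (frpt f x y) + v%:~R * py (frpt f x y).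
  apply: (polygon_halfplane polyP) bxy => a aA.
  rewrite -!rmorphM -rmorphD ler_int.
  rewrite (px_frame f a) (py_frame f a).
  have -> : u * (px (fo f) + fX f a * px (fe1 f) + fY f a * px (fe2 f)) +
    v * (py (fo f) + fX f a * py (fe1 f) + fY f a * py (fe2 f)) =
    k + (u * px (fe1 f) + v * py (fe1 f)) * fX f a + (u * px (fe2 f) + v * py (fe2 f)) * fY f a.
    by rewrite /k; ring.
  rewrite U1 U2; have := hA a aA.
  by move: k (fX f a) (fY f a) => k' x' y'; clear; lia.
move: K; rewrite px_frpt py_frpt.
have -> : u%:~R * ((px (fo f))%:~R + x * (px (fe1 f))%:~R + y * (px (fe2 f))%:~R) +
  v%:~R * ((py (fo f))%:~R + x * (py (fe1 f))%:~R + y * (py (fe2 f))%:~R) =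
  k%:~R + (u * px (fe1 f) + v * py (fe1 f))%:~R * x + (u * px (fe2 f) + v * py (fe2 f))%:~R * y.
  by rewrite /k !rmorphD !rmorphM /=; ring.
by rewrite U1 U2 rmorphD /=; lra.
Qed.

(** Were z minimal among the lattice points, the half-plane would contain P, but a small box about z
    lies in P and moving in it against the signs of p and q lowers the value. This is the source of
    lattice points beyond the interior rows. *)
Lemma interior_not_extremal z (p q : int) : z \in I -> (p != 0) || (q != 0) ->
  exists2 a, a \in A & p * fX f a + q * fY f a < p * fX f z + q * fY f z.
Proof.
move=> zI pq; apply: contrapT => none.
have hA a : a \in A -> p * fX f z + q * fY f z <= p * fX f a + q * fY f a.
  by move=> aA; rewrite leNgt; apply/negP => lt; apply: none; exists a.
have [e e0 eb] := ibody_open (ibody_mem zI).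
have sg_le (m : int) : `|- (e * Num.sg (m%:~R : R))| <= e.
  by rewrite normrN normrM gtr0_norm // normr_sg; case: (_ != 0); rewrite ?mulr1 ?mulr0 // ltW.
have := body_halfplane hA (eb _ _ (sg_le p) (sg_le q)).
rewrite rmorphD !rmorphM /= !mulrDr.
have Kp (m : int) : m%:~R * - (e * Num.sg (m%:~R : R)) = - (e * `|m%:~R|).
  by rewrite normrEsg; ring.
rewrite !Kp.
have h1 : 0 <= e * `|p%:~R| :> R by rewrite mulr_ge0 // ltW.
have h2 : 0 <= e * `|q%:~R| :> R by rewrite mulr_ge0 // ltW.
case/orP: pq => n0.
  have : 0 < e * `|p%:~R| :> R by rewrite mulr_gt0 // normr_gt0 intr_eq0.
  by lra.
have : 0 < e * `|q%:~R| :> R by rewrite mulr_gt0 // normr_gt0 intr_eq0.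
by lra.
Qed.

End Body.

(** * Rows of a lattice polygon *)

Definition frow (S : {fset lpoint}) (f : frame) (y : int) : {fset lpoint} :=
  [fset a in S | fY f a == y]%fset.

Lemma in_frow S f y a : (a \in frow S f y) = (a \in S) && (fY f a == y).
Proof. by rewrite !inE. Qed.

Lemma card_rows (S : {fset lpoint}) f n :
  (forall a, a \in S -> 0 <= fY f a < n%:Z) ->
  #|` S| = (\sum_(i < n) #|` frow S f i%:Z|)%N.
Proof.
elim: n S => [|n IH] S hS.
  rewrite big_ord0; apply/eqP; rewrite cardfs_eq0; apply/eqP/fsetP => a.
  by rewrite in_fset0; apply/negP => /hS /andP[a0]; rewrite ltNge a0.
rewrite big_ord_recr /=.
pose S' := (S `\` frow S f n%:Z)%fset.
have sub : (frow S f n%:Z `<=` S)%fset by apply/fsubsetP => a; rewrite in_frow => /andP[].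
have hS' a : a \in S' -> 0 <= fY f a < n%:Z.
  rewrite in_fsetD in_frow => /andP[na aS]; have := hS a aS.
  by move: na; rewrite aS /=; move: (fY f a); clear; lia.
have := IH S' hS'; have -> : (\sum_(i < n) #|` frow S' f i%:Z| = \sum_(i < n) #|` frow S f i%:Z|)%N.
  apply: eq_bigr => i _; congr #|` _|; apply/fsetP => a.
  rewrite !in_frow in_fsetD in_frow.
  have [aS|] := boolP (a \in S); rewrite ?andbF //=.
  have [/eqP ->|] := boolP (fY f a == i%:Z); rewrite ?andbF //=.
  by rewrite andbT eqz_nat ltn_eqF.
by move=> <-; rewrite (cardfsDS sub) subnK // fsubset_leq_card.
Qed.

Lemma int_seq_range (s : seq int) x : uniq s -> x \in s ->
  exists a b, [/\ a \in s, b \in s, (size s)%:Z <= b - a + 1 &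
    forall y, y \in s -> a <= y <= b].
Proof.
elim: s x => [//|u s IH] x; rewrite /= => /andP[us uqs] _.
case: s IH us uqs => [|v s] IH us uqs.
  by exists u, u; split; rewrite ?inE ?eqxx // ?subrr // => y; rewrite inE => /eqP->; rewrite lexx.
have [|a [b [ia ib sz rg]]] := IH v uqs; first by rewrite inE eqxx.
have ua : u != a by apply/eqP => E; rewrite E ia in us.
have ub : u != b by apply/eqP => E; rewrite E ib in us.
have ab := rg a ia.
have nu y : y \in v :: s -> u != y by move=> iy; apply/eqP => E; rewrite E iy in us.
have [lt1|ge1] := ltrP u a.
  exists u, b; split; [by rewrite in_cons eqxx|by rewrite in_cons ib orbT| |].
    by move: sz lt1; rewrite /=; move: (size s); clear; lia.
  move=> y; rewrite in_cons => /orP[/eqP->|/rg]; move: ab lt1; clear; lia.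
have [lt2|ge2] := ltrP b u.
  exists a, u; split; [by rewrite in_cons ia orbT|by rewrite in_cons eqxx| |].
    by move: sz lt2; rewrite /=; move: (size s); clear; lia.
  move=> y; rewrite in_cons => /orP[/eqP->|/rg]; move: ab lt2; clear; lia.
exists a, b; split; [by rewrite in_cons ia orbT|by rewrite in_cons ib orbT| |]; last first.
  by move=> y; rewrite in_cons => /orP[/eqP->|/rg //]; rewrite ge1.
have sub : (size (u :: v :: s) <= size [seq (a + i%:Z)%R | i <- iota 0 (absz (b - a)%R).+1])%N.
  apply: uniq_leq_size; first by rewrite cons_uniq us uqs.
  move=> y; rewrite in_cons => /orP[/eqP->|/rg h].
    apply/mapP; exists (absz (u - a)); first by rewrite mem_iota; move: ge1 ge2; clear; lia.
    by move: ge1; clear; lia.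
  apply/mapP; exists (absz (y - a)); first by rewrite mem_iota; move: h; clear; lia.
  by move: h; clear; lia.
by move: sub ab; rewrite size_map size_iota /=; move: (size s); clear; lia.
Qed.

Lemma frow_range (S : {fset lpoint}) f y z : z \in frow S f y ->
  exists a b, [/\ fpt f a y \in S, fpt f b y \in S,
     #|` frow S f y|%:Z <= b - a + 1 &
     forall c, c \in S -> fY f c = y -> a <= fX f c <= b].
Proof.
move=> zS.
have hs c : c \in frow S f y -> fpt f (fX f c) y = c.
  by rewrite in_frow => /andP[_ /eqP <-]; rewrite fptK.
have [|| a [b [/mapP[a' ia ea] /mapP[b' ib eb] sz rg]]] :=
  @int_seq_range [seq fX f c | c <- frow S f y] (fX f z).
- rewrite map_inj_in_uniq ?fset_uniq // => u v /hs hu /hs hv E.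
  by rewrite -hu -hv E.
- by apply: map_f.
exists a, b; split.
- by move: (hs _ ia) (ia); rewrite -ea in_frow => -> /andP[].
- by move: (hs _ ib) (ib); rewrite -eb in_frow => -> /andP[].
- by rewrite size_map in sz.
- by move=> c cS cy; apply: rg; apply: map_f; rewrite in_frow cS cy eqxx.
Qed.

Lemma frow_card_ge (S : {fset lpoint}) f (a b y : int) :
  (forall x, a <= x <= b -> fpt f x y \in S) -> b - a + 1 <= #|` frow S f y|%:Z.
Proof.
move=> hS.
have [lt|ge] := ltrP b a; first by apply: le_trans (_ : 0 <= _) => //; move: lt; clear; lia.
pose s := [seq fpt f (a + i%:Z) y | i <- iota 0 (absz (b - a)).+1].
have us : uniq s.
  rewrite map_inj_uniq ?iota_uniq // => i j /(congr1 (fX f)).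
  by rewrite !fX_fpt => /addrI [].
have : (size s <= size (frow S f y))%N.
  apply: uniq_leq_size => // z /mapP[i]; rewrite mem_iota => hi ->.
  by rewrite in_frow fY_fpt eqxx andbT; apply: hS; move: hi ge; clear; lia.
by rewrite size_map size_iota; move: (size _) ge; clear; lia.
Qed.

Lemma fset_truncate (T : choiceType) (K : {fset T}) n : (n <= #|` K|)%N ->
  exists2 K' : {fset T}, (K' `<=` K)%fset & #|` K'| = n.
Proof.
move=> nK; exists [fset x in take n K]%fset.
  by apply/fsubsetP => x; rewrite in_fset => /mem_take.
rewrite card_fseq undup_id ?take_uniq ?fset_uniq //.
by rewrite size_takel.
Qed.

Lemma fset_two (T : choiceType) (K : {fset T}) : (2 <= #|` K|)%N ->
  exists a b, [/\ a \in K, b \in K & a != b].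
Proof.
move=> c2.
have [a aK] : exists a, a \in K by apply/fset0Pn; rewrite -cardfs_gt0; apply: leq_trans c2.
have [b] : exists b, b \in (K `\ a)%fset.
  by apply/fset0Pn; rewrite -cardfs_gt0; move: c2; rewrite (cardfsD1 a) aK.
by rewrite !inE => /andP[ba bK]; exists a, b; rewrite eq_sym.
Qed.

Section Rows.
Variables (R : realType) (P : set (plane R)) (polyP : lattice_polygon P).
Local Notation A := (lattice_points P).
Local Notation I := (interior_points P).
Variable f : frame.
Local Notation X := (fX f).
Local Notation Y := (fY f).

Lemma ibody_row (a b x y : R) : ibody P f a y -> body P f b y ->
  (a <= x /\ x < b) \/ (b < x /\ x <= a) -> ibody P f x y.
Proof.
move=> ia bb h.
have nab : a - b != 0 by apply/eqP => E; move: h; lra.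
pose t := (x - b) / (a - b).
have tE : t * (a - b) = x - b by rewrite /t divfK.
have t0 : 0 < t.
  rewrite ltNge; apply/negP => t0; case: h => h.
    have : 0 <= t * (a - b) by rewrite mulr_le0 //; lra.
    by lra.
  have : t * (a - b) <= 0 by rewrite mulr_le0_ge0 //; lra.
  by lra.
have t1 : t <= 1.
  rewrite leNgt; apply/negP => t1.
  have E : (t - 1) * (a - b) = x - a by rewrite mulrBl tE; ring.
  case: h => h.
    have : (t - 1) * (a - b) < 0 by rewrite nmulr_llt0; lra.
    by lra.
  have : 0 < (t - 1) * (a - b) by rewrite mulr_gt0 //; lra.
  by lra.
have -> : x = t * a + (1 - t) * b.
  transitivity (t * (a - b) + b); last by ring.
  by rewrite tE subrK.
have {1}-> : y = t * y + (1 - t) * y by ring.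
exact: ibody_comb.
Qed.

(** Joining z to the point above or below row y gives some interior point of that row; the rest of
    the open segment is interior by [ibody_row]. *)
Lemma ibody_between (l r x y u yu v yv : R) z : z \in I ->
  body P f l y -> body P f r y -> l < x -> x < r ->
  body P f u yu -> y < yu -> body P f v yv -> yv < y -> ibody P f x y.
Proof.
move=> /(ibody_mem polyP f) zI bl br lx xr bu uy bv vy.
have [c ic] : exists c, ibody P f c y.
  move: zI; move: (X z)%:~R (Y z)%:~R => zx zy zI.
  have [E|E|E] := ltrgtP zy y; last by exists zx; rewrite -E.
    pose t := (yu - y) / (yu - zy).
    have tE : t * (yu - zy) = yu - y by rewrite /t divfK //; apply/eqP; lra.
    exists (t * zx + (1 - t) * u).
    have -> : y = t * zy + (1 - t) * yu.
      have -> : t * zy + (1 - t) * yu = yu - t * (yu - zy) by ring.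
      by rewrite tE; ring.
    apply: ibody_comb => //; first by rewrite /t divr_gt0; lra.
    by rewrite /t ler_pdivrMr; lra.
  pose t := (y - yv) / (zy - yv).
  have tE : t * (zy - yv) = y - yv by rewrite /t divfK //; apply/eqP; lra.
  exists (t * zx + (1 - t) * v).
  have -> : y = t * zy + (1 - t) * yv.
    have -> : t * zy + (1 - t) * yv = yv + t * (zy - yv) by ring.
    by rewrite tE; ring.
  apply: ibody_comb => //; first by rewrite /t divr_gt0; lra.
  by rewrite /t ler_pdivrMr; lra.
have [cx|xc] := lerP c x; first by apply: ibody_row ic br _; left.
by apply: ibody_row ic bl _; right; split=> //; exact: ltW.
Qed.

Lemma body_row_lattice (a b x y : int) : fpt f a y \in A -> fpt f b y \in A ->
  a <= x <= b -> fpt f x y \in A.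
Proof.
move=> /(body_lattice polyP f) ba /(body_lattice polyP f) bb /andP[ax xb].
apply/(body_lattice polyP f).
have [E|E] := eqVneq a b; first by have -> : x = a by move: ax xb E; clear; lia.
have ab : (0 : R) < b%:~R - a%:~R by rewrite subr_gt0 ltr_int; move: ax xb E; clear; lia.
move: ax xb; rewrite -!(ler_int R) => ax xb.
pose t : R := (b%:~R - x%:~R) / (b%:~R - a%:~R).
have tE : t * (b%:~R - a%:~R) = b%:~R - x%:~R by rewrite /t divfK // gt_eqF.
have -> : x%:~R = t * a%:~R + (1 - t) * b%:~R :> R.
  have -> : t * a%:~R + (1 - t) * b%:~R = b%:~R - t * (b%:~R - a%:~R) by ring.
  by rewrite tE; ring.
have {1}-> : (y%:~R : R) = t * y%:~R + (1 - t) * y%:~R by ring.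
apply: body_comb => //; first by rewrite /t divr_ge0 ?subr_ge0 // -subr_ge0 ltW.
by rewrite /t ler_pdivrMr // mul1r lerB.
Qed.

Lemma ibody_row_lattice (a b x y : int) : fpt f a y \in I -> fpt f b y \in A ->
  (a <= x < b) || (b < x <= a) -> fpt f x y \in I.
Proof.
move=> /(ibody_lattice polyP f) ia /(body_lattice polyP f) bb h.
apply/(ibody_lattice polyP f); apply: ibody_row ia bb _.
by case/orP: h => /andP[h1 h2]; [left|right]; rewrite ltr_int ler_int.
Qed.

End Rows.

Lemma sqr1_int (sg : int) : sg * sg = 1 -> sg = 1 \/ sg = -1.
Proof.
move=> sg2; have /orP[/eqP|/eqP] : (sg == 1) || (sg == -1) by nia.
  by left.
by right.
Qed.

(** * Null points on a horizontal edge of the polygon *)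

Section RowNull.
Variables (R : realType) (P : set (plane R)) (polyP : lattice_polygon P).
Local Notation A := (lattice_points P).
Local Notation I := (interior_points P).

Section Side.
Variable f : frame.
Local Notation X := (fX f).
Local Notation Y := (fY f).
Variables (sg e : int).
Hypotheses (sg1 : sg * sg = 1) (eI : fpt f e 1 \in I) (eN : fpt f (e + sg) 1 \notin I).

Lemma side_row1 a : a \in A -> Y a = 1 -> sg * (X a - (e + sg)) <= 0.
Proof.
move=> aA a1; rewrite leNgt; apply/negP => gt; move/negP: eN; apply.
have aA' : fpt f (X a) 1 \in A by rewrite -a1 fptK.
apply: (ibody_row_lattice polyP eI aA').
by move: gt; case: (sqr1_int sg1) => ->; clear; lia.
Qed.

(** A point beyond the line from the corner (x0, 0) through (e + sg, 1), shrunk towards the corner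
    onto row 1, would lie beyond e + sg there and make that lattice point interior. The signs sg = 1
    and sg = -1 treat the two corners. *)
Lemma side_cone x0 : fpt f x0 0 \in A ->
  (forall a, a \in A -> Y a = 0 -> sg * (X a - x0) <= 0) ->
  (forall a, a \in A -> 0 <= Y a) ->
  forall a, a \in A -> sg * (X a - x0) <= sg * (Y a * (e + sg - x0)).
Proof.
move=> xA row0 Y0 a aA; rewrite leNgt; apply/negP => gt; move/negP: eN; apply.
have := Y0 a aA; rewrite le_eqVlt => /orP[/eqP ya|ya].
  by have := row0 a aA (esym ya); move: gt; rewrite -ya mul0r mulr0 ltNge => /negP.
have ba := body_mem polyP f aA.
move: gt ya ba; move: (X a) (Y a) => x y gt ya ba.
have yaR : (0 : R) < y%:~R by rewrite ltr0z.
have ya1 : (1 : R) <= y%:~R by rewrite -[1]/(1%:~R) ler_int -gtz0_ge1.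
have bx := (body_lattice polyP f x0 0).2 xA.
pose t : R := y%:~R^-1.
have tY : t * y%:~R = 1 by rewrite mulVf // gt_eqF.
have t0 : 0 <= t by rewrite invr_ge0 ltW.
have t1 : t <= 1 by rewrite invf_le1.
have := body_comb polyP t0 t1 ba bx.
have -> : t * y%:~R + (1 - t) * 0%:~R = 1 by rewrite tY mulr0 addr0.
have ie := (ibody_lattice polyP f e 1).2 eI.
move=> bx'; apply/(ibody_lattice polyP f); apply: ibody_row ie bx' _ => //.
move: gt; rewrite -(ltr_int R).
have -> : t * x%:~R + (1 - t) * x0%:~R = x0%:~R + t * (x%:~R - x0%:~R) by ring.
have K : x%:~R - x0%:~R = y%:~R * (t * (x%:~R - x0%:~R)) by rewrite mulrA [_ * t]mulrC tY mul1r.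
have E1 : (sg * (x - x0))%:~R = sg%:~R * (y%:~R * (t * (x%:~R - x0%:~R))) :> R.
  by rewrite rmorphM rmorphB /= -K.
rewrite E1; set q := t * _; rewrite !rmorphM rmorphB rmorphD /=.
case: (sqr1_int sg1) => ->; rewrite ?mul1r ?rmorphN1 ?mulN1r ?ltrN2 ltr_pM2l // => h.
  by left; move: h; rewrite -[1%:~R]/1; lra.
by right; move: h; lra.
Qed.

End Side.

Variables (h : lpoint -> R) (D : {fset {fset lpoint}}).
Hypothesis indD : induces A h D.
Hypothesis uniD : forall T, T \in D -> unimodular_triangle T.

Lemma bottom_null f z : (forall a, a \in A -> 0 <= fY f a) ->
  z \in I -> fY f z = 1 ->
  exists (x0 : int) (L : nat) (K : {fset lpoint}), [/\ (K `<=` A)%fset,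
    forall w, w \in K -> null_point D w /\ fY f w = 0,
    (#|` frow A f 0| <= L.+1)%N, (L <= #|` K| + #|` frow I f 1|)%N &
    forall i, (i <= L)%N -> fpt f (x0 + i%:Z) 0 \in A].
Proof.
move=> Y0 zI z1.
have zA := interior_lattice polyP zI.
have [a0 a0A a00] : exists2 a, a \in A & fY f a = 0.
  have [//|a aA lt] := interior_not_extremal polyP f (p := 0) (q := 1) zI.
  exists a => //; apply/le_anti; rewrite Y0 // andbT.
  by move: lt; rewrite z1; move: (fX f a) (fX f z) (fY f a); clear; lia.
have [|x0 [x1 [x0A x1A sz rg]]] := @frow_range A f 0 a0; first by rewrite in_frow a0A a00 eqxx.
have [|al [be [alI beI sz1 rg1]]] := @frow_range I f 1 z; first by rewrite in_frow zI z1 eqxx.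
have x01 : x0 <= x1 by have := rg _ x0A; rewrite fX_fpt fY_fpt => /(_ erefl)/andP[].
have albe : al <= be by have := rg1 _ alI; rewrite fX_fpt fY_fpt => /(_ erefl)/andP[].
have [L LE] : exists L : nat, L%:Z = x1 - x0.
  by exists (absz (x1 - x0)); move: x01; clear; lia.
have row0 i : (i <= L)%N -> fpt f (x0 + i%:Z) 0 \in A.
  by move=> iL; apply: (body_row_lattice polyP x0A x1A); move: iL LE; clear; lia.
have alN : fpt f (al + -1) 1 \notin I.
  by apply/negP => hI; have := rg1 _ hI; rewrite fX_fpt fY_fpt => /(_ erefl); clear; lia.
have beN : fpt f (be + 1) 1 \notin I.
  by apply/negP => hI; have := rg1 _ hI; rewrite fX_fpt fY_fpt => /(_ erefl); clear; lia.
have m11 : (-1) * (-1) = 1 :> int by [].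
have up : exists2 a, a \in A & 0 < fY f a by exists z => //; rewrite z1.
have row1 a : a \in A -> fY f a = 1 -> al - 1 <= fX f a <= be + 1.
  move=> aA a1; have := side_row1 m11 alI alN aA a1; have := side_row1 (mulr1 1) beI beN aA a1.
  by move: (fX f a); clear; lia.
have leftb : fpt f (al - 1) 1 \in A -> forall a, a \in A ->
    fY f a * (al - 1 - x0) <= fX f a - x0.
  move=> _ a aA; have := side_cone m11 alI alN x0A _ Y0 aA; rewrite !mulN1r lerN2; apply.
  move=> b bA b0; have := rg b bA b0; rewrite mulN1r; move: (fX f b); clear; lia.
have x1E : x0 + L%:Z = x1 by rewrite LE addrC subrK.
have rightb : fpt f (be + 1) 1 \in A -> forall a, a \in A ->
    fX f a - (x0 + L%:Z) <= fY f a * (be + 1 - (x0 + L%:Z)).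
  rewrite x1E => _ a aA; have := side_cone (mulr1 1) beI beN x1A _ Y0 aA; rewrite !mul1r; apply.
  move=> b bA b0; have := rg b bA b0; rewrite mul1r; move: (fX f b); clear; lia.
have [|K [KA Kn KL]] := bottom_row_null indD uniD Y0 up row0 row1 leftb rightb.
  by move: albe; clear; lia.
exists x0, L, K; split=> //.
  by move: sz; rewrite -LE; move: #|` frow A f 0|; clear; lia.
have : be - al + 1 <= #|` frow I f 1|%:Z.
  apply: frow_card_ge => x /andP[]; rewrite le_eqVlt => /orP[/eqP<- //|ax] xb.
  have [->//|nxb] := eqVneq x be.
  apply: (ibody_row_lattice polyP alI (interior_lattice polyP beI)).
  by apply/orP; left; rewrite ltW //= lt_neqAle nxb.
by move: KL; move: #|` K| #|` frow I f 1|; clear; lia.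
Qed.

End RowNull.

(** An open interval of length (hi - lo) / n contains at least that length minus one integers;
    everything is multiplied by n to stay integral. *)
Lemma frow_strict_count (S : {fset lpoint}) f (n : nat) (lo hi y : int) : (0 < n)%N ->
  (forall z, lo < n%:Z * z -> n%:Z * z < hi -> fpt f z y \in S) ->
  hi - lo <= n%:Z * (#|` frow S f y|%:Z + 1).
Proof.
move=> n0 hS.
have div (m : int) : exists q r, [/\ m = q * n%:Z + r, 0 <= r & r < n%:Z].
  exists (m %/ n)%Z, (m %% n)%Z; split; first exact: divz_eq.
    by rewrite modz_ge0 // eqz_nat -lt0n.
  by rewrite ltz_pmod.
(* Dividing hi - 1 instead of hi makes q' the largest z with n z < hi. *)
have [q [r [loE r0 rn]]] := div lo; have [q' [r' [hiE r'0 r'n]]] := div (hi - 1).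
have : q' - (q + 1) + 1 <= #|` frow S f y|%:Z.
  apply: frow_card_ge => x /andP[x1 x2]; apply: hS.
    have : n%:Z * (q + 1) <= n%:Z * x by rewrite ler_pM2l.
    by move: loE rn; clear; nia.
  have : n%:Z * x <= n%:Z * q' by rewrite ler_pM2l.
  by move: hiE r'0; clear; nia.
move=> h.
have : n%:Z * (q' - (q + 1) + 1 + 1) <= n%:Z * (#|` frow S f y|%:Z + 1).
  by rewrite ler_pM2l // lerD2r.
by move: loE hiE r0 r'n; clear; nia.
Qed.

Lemma sum_interpolation (n : int) (a b : int) (k : nat) :
  2 * (\sum_(j < k.+1) ((n - j%:Z) * a + j%:Z * b)) =
  k.+1%:Z * ((2 * n - k%:Z) * a + k%:Z * b).
Proof.
elim: k => [|k IH]; first by rewrite big_ord_recr big_ord0 /=; ring.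
by rewrite big_ord_recr /= mulrDr IH !PoszS; ring.
Qed.

Section Normal.
Variables (R : realType) (P : set (plane R)) (polyP : lattice_polygon P).
Local Notation A := (lattice_points P).
Local Notation I := (interior_points P).

(** Fewer than L of the L + 1 points of the bottom row lie in K, so two remain; with z they form the
    noncollinear triple that [cone_dim_le] asks for. *)
Lemma row_base f (K : {fset lpoint}) (x0 : int) (L : nat) z :
  (forall i, (i <= L)%N -> fpt f (x0 + i%:Z) 0 \in A) ->
  (#|` (frow A f 0 `&` K)%fset| < L)%N ->
  z \in A -> fY f z = 1 -> z \notin K ->
  exists b1 b2 b3, [/\ b1 \in (A `\` K)%fset, b2 \in (A `\` K)%fset, b3 \in (A `\` K)%fset
    & orientation b1 b2 b3 != 0].
Proof.
move=> row0 cK zA z1 zK.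
have : (L%:Z + x0) - x0 + 1 <= #|` frow A f 0|%:Z.
  apply: frow_card_ge => x hx.
  have -> : x = x0 + (absz (x - x0))%:Z by move: hx; clear; lia.
  by apply: row0; move: hx; clear; lia.
move=> cr.
have [|u [v [uA vA uv]]] := @fset_two _ (frow A f 0 `\` K)%fset.
  by rewrite cardfsD; move: cr cK; move: #|` _| #|` _|; clear; lia.
move: uA vA; rewrite !in_fsetD !in_frow => /and3P[uK uA /eqP u0] /and3P[vK vA /eqP v0].
exists u, v, z; split; rewrite ?in_fsetD ?uK ?vK ?zK //.
rewrite -normr_eq0 (norm_orientation_frame f) normr_eq0 u0 v0 z1 subrr mul0r !subr0 mulr1.
by rewrite subr_eq0; apply: contra uv => /eqP E; apply/eqP/(@frame_eq f); rewrite // u0 v0.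
Qed.

Lemma interior_base z : z \in I -> exists b1 b2 b3,
  [/\ b1 \in A, b2 \in A, b3 \in A & orientation b1 b2 b3 != 0].
Proof.
move=> zI; have [f _] := std_frame.
have [//|a aA lt] := interior_not_extremal polyP f (p := 0) (q := 1) zI.
(* This functional is constant on the line through z and a, so a lattice point of smaller value is
   off that line. *)
pose p := fY f z - fY f a; pose q := fX f a - fX f z.
have pq : (p != 0) || (q != 0).
  by apply/orP; left; rewrite /p; move: lt; rewrite !mul0r !add0r !mul1r subr_eq0; move: (fY f z) (fY f a); clear; lia.
have [b bA lt2] := interior_not_extremal polyP f zI pq.
exists z, a, b; split=> //; first exact: interior_lattice.
rewrite -normr_eq0 (norm_orientation_frame f) normr_eq0.
apply/eqP => E; move: lt2; rewrite /p /q ltNge => /negP; apply.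
rewrite -subr_ge0.
have -> : (fY f z - fY f a) * fX f b + (fX f a - fX f z) * fY f b
   - ((fY f z - fY f a) * fX f z + (fX f a - fX f z) * fY f z) =
  (fX f a - fX f z) * (fY f b - fY f z) - (fY f a - fY f z) * (fX f b - fX f z) by ring.
by rewrite E.
Qed.

(** The middle one of three points of P in such a row is interior by [ibody_between]. *)
Lemma boundary_row_le2 f y u v z : z \in I -> u \in A -> v \in A ->
  fY f u < y -> y < fY f v ->
  (#|` frow A f y| <= #|` frow I f y| + 2)%N.
Proof.
move=> zI uA vA uy yv.
have sub : (frow I f y `<=` frow A f y)%fset.
  by apply/fsubsetP => a; rewrite !in_frow => /andP[/(interior_lattice polyP)-> ->].
have := cardfsDS sub; have := fsubset_leq_card sub.
suff : (#|` frow A f y `\` frow I f y| <= 2)%N%fset.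
  by move: #|` _| #|` _| #|` _|; clear; lia.
rewrite leqNgt; apply/negP => c3.
have [f0|[a fa]] := fset_0Vmem (frow A f y `\` frow I f y)%fset.
  by rewrite f0 cardfs0 in c3.
have [|b [c [fb fc bc]]] := @fset_two _ ((frow A f y `\` frow I f y) `\ a)%fset.
  by move: c3; rewrite (cardfsD1 a) fa.
have pts w : w \in (frow A f y `\` frow I f y)%fset ->
    [/\ body P f (fX f w)%:~R y%:~R, fY f w = y & ~ ibody P f (fX f w)%:~R y%:~R].
  rewrite in_fsetD !in_frow => /andP[wI /andP[wA /eqP wy]]; split=> //.
    by rewrite -wy; apply: body_mem.
  move=> /(ibody_lattice polyP f); rewrite -{1}wy fptK => hI.
  by rewrite hI wy eqxx in wI.
move: fb fc; rewrite !in_fsetD1 => /andP[ba fb] /andP[ca fc].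
have [Ba ya na] := pts _ fa; have [Bb yb nb] := pts _ fb; have [Bc yc nc] := pts _ fc.
have nX w w' : w != w' -> fY f w = y -> fY f w' = y -> fX f w != fX f w'.
  by move=> nw e1 e2; apply: contra nw => /eqP E; apply/eqP/(@frame_eq f); rewrite // e1 e2.
have bt w1 w2 w3 : body P f (fX f w1)%:~R y%:~R -> body P f (fX f w3)%:~R y%:~R ->
   fX f w1 < fX f w2 -> fX f w2 < fX f w3 -> ibody P f (fX f w2)%:~R y%:~R.
  move=> b1 b3 l1 l2; apply: (ibody_between polyP zI b1 b3 _ _ (body_mem polyP f vA) _ (body_mem polyP f uA));
  by rewrite ltr_int.
have := nX _ _ ba yb ya; have := nX _ _ ca yc ya; have := nX _ _ bc yb yc.
have B1 := bt a b c Ba Bc; have B2 := bt c b a Bc Ba.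
have B3 := bt a c b Ba Bb; have B4 := bt b c a Bb Ba.
have B5 := bt b a c Bb Bc; have B6 := bt c a b Bc Bb.
move=> n1 n2 n3.
have [h1|h1|h1] := ltrgtP (fX f a) (fX f b); last by rewrite h1 eqxx in n3.
  have [h2|h2|h2] := ltrgtP (fX f b) (fX f c); last by rewrite h2 eqxx in n1.
    exact: nb (B1 h1 h2).
  have [h3|h3|h3] := ltrgtP (fX f a) (fX f c); last by rewrite h3 eqxx in n2.
    exact: nc (B3 h3 h2).
  exact: na (B6 h3 h1).
have [h2|h2|h2] := ltrgtP (fX f b) (fX f c); last by rewrite h2 eqxx in n1.
  have [h3|h3|h3] := ltrgtP (fX f a) (fX f c); last by rewrite h3 eqxx in n2.
    exact: na (B5 h1 h3).
  exact: nc (B4 h2 h3).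
exact: nb (B2 h2 h1).
Qed.

End Normal.

(** * Polygons reaching one row beyond their interior strip *)

Section NormalBound.
Variables (R : realType) (P : set (plane R)) (polyP : lattice_polygon P).
Local Notation A := (lattice_points P).
Local Notation I := (interior_points P).
Variables (f : frame) (n : nat).
Local Notation X := (fX f).
Local Notation Y := (fY f).
Hypothesis rowsA : forall a, a \in A -> 0 <= Y a <= n%:Z + 2.
Hypothesis rowsI : forall a, a \in I -> 1 <= Y a <= n%:Z + 1.
Variables (z1 z2 : lpoint).
Hypotheses (z1I : z1 \in I) (z1Y : Y z1 = 1).
Hypotheses (z2I : z2 \in I) (z2Y : Y z2 = n%:Z + 1).

Let c (i : nat) := #|` frow A f i%:Z|.
Let m (i : nat) := #|` frow I f i%:Z|.

Lemma bottom_point : exists2 a, a \in A & Y a = 0.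
Proof.
have [//|a aA lt] := interior_not_extremal polyP f (p := 0) (q := 1) z1I.
exists a => //; have := rowsA aA.
by move: lt; rewrite z1Y; move: (X a) (X z1) (Y a); clear; lia.
Qed.

Lemma top_point : exists2 a, a \in A & Y a = n%:Z + 2.
Proof.
have [//|a aA lt] := interior_not_extremal polyP f (p := 0) (q := -1) z2I.
exists a => //; have := rowsA aA.
by move: lt; rewrite z2Y; move: (X a) (X z2) (Y a); clear; lia.
Qed.

Lemma row_le2 i : (i <= n)%N -> (c i.+1 <= m i.+1 + 2)%N.
Proof.
move=> le_i; have [a aA a0] := bottom_point; have [b bA bn] := top_point.
by apply: (boundary_row_le2 polyP z1I aA bA); rewrite ?a0 ?bn; move: le_i; clear; lia.
Qed.

Lemma card_interior : #|` I| = (\sum_(i < n.+1) m i.+1)%N.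
Proof.
rewrite (@card_rows I f n.+2).
  rewrite big_ord_recl /=.
  have -> : frow I f 0%:Z = fset0.
    apply/fsetP => a; rewrite in_frow in_fset0; apply/negP => /andP[/rowsI]; move: (Y a); clear; lia.
  by rewrite cardfs0 add0n.
by move=> a /rowsI; move: (Y a); clear; lia.
Qed.

Lemma card_lattice : #|` A| = (c 0 + \sum_(i < n.+1) c i.+1 + c n.+2)%N.
Proof.
rewrite (@card_rows A f n.+3).
  by rewrite big_ord_recr big_ord_recl.
by move=> a /rowsA; move: (Y a); clear; lia.
Qed.

(* Interpolating between rows 1 and n + 1 bounds the interior points of the
   intermediate rows from below. *)
Lemma trapezoid : (0 < n)%N ->
  (n.+1 * (c 1 + c n.+1) <= 2 * #|` I| + 4 * n.+1)%N.
Proof.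
move=> n0.
have z1A := interior_lattice polyP z1I; have z2A := interior_lattice polyP z2I.
have [a aA a0] := bottom_point; have [b bA bn] := top_point.
have [|x1 [x1' [x1A x1A' sz1 _]]] := @frow_range A f 1%N z1; first by rewrite in_frow z1A z1Y eqxx.
have [|x2 [x2' [x2A x2A' sz2 _]]] := @frow_range A f n.+1 z2; first by rewrite in_frow z2A z2Y PoszS eqxx.
have nR : (0 : R) < n%:R by rewrite ltr0n.
have comb (u v : int) j : (j <= n)%N -> fpt f u 1%N \in A -> fpt f v n.+1 \in A ->
    body P f (((n%:Z - j%:Z) * u + j%:Z * v)%:~R / n%:R) (j.+1%:Z)%:~R.
  move=> jn /(body_lattice polyP f) bu /(body_lattice polyP f) bv.
  have jnR : (j%:R : R) <= n%:R by rewrite ler_nat.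
  pose t : R := (n%:R - j%:R) / n%:R.
  have tE : t * n%:R = n%:R - j%:R by rewrite /t divfK // gt_eqF.
  have t0 : 0 <= t by rewrite /t divr_ge0 ?subr_ge0 // ltW.
  have t1 : t <= 1 by rewrite /t ler_pdivrMr // mul1r lerBlDr lerDl.
  have := body_comb polyP t0 t1 bu bv.
  have -> : t * u%:~R + (1 - t) * v%:~R = ((n%:Z - j%:Z) * u + j%:Z * v)%:~R / n%:R.
    apply: (@mulIf _ n%:R); first by rewrite gt_eqF.
    rewrite divfK ?gt_eqF // rmorphD !rmorphM rmorphB /=.
    transitivity ((t * n%:R) * u%:~R + (n%:R - t * n%:R) * v%:~R); first by ring.
    by rewrite tE -!pmulrn; ring.
  suff -> : t * (1%:Z)%:~R + (1 - t) * (n.+1%:Z)%:~R = (j.+1%:Z)%:~R by [].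
  rewrite -!pmulrn !mulrS mulr0n.
  transitivity (1 + n%:R - t * n%:R : R); first by ring.
  by rewrite tE; ring.
(* The chords joining the left ends, and the right ends, of rows 1 and n + 1 stay in P; a lattice
   point strictly between them in row j + 1 is interior. *)
have row j : (j <= n)%N ->
  (n%:Z - j%:Z) * (x1' - x1) + j%:Z * (x2' - x2) <= n%:Z * ((m j.+1)%:Z + 1).
  move=> jn.
  have -> : (n%:Z - j%:Z) * (x1' - x1) + j%:Z * (x2' - x2) =
    ((n%:Z - j%:Z) * x1' + j%:Z * x2') - ((n%:Z - j%:Z) * x1 + j%:Z * x2) by ring.
  apply: frow_strict_count => // z lo hi; apply/(ibody_lattice polyP f).
  apply: (ibody_between polyP z1I (comb x1 x2 j jn x1A x2A) (comb x1' x2' j jn x1A' x2A') _ _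
    (body_mem polyP f bA) _ (body_mem polyP f aA)).
  - by rewrite ltr_pdivrMr // [z%:~R * _]mulrC pmulrn -rmorphM ltr_int.
  - by rewrite ltr_pdivlMr // [z%:~R * _]mulrC pmulrn -rmorphM ltr_int.
  - by rewrite ltr_int bn; move: jn; clear; lia.
  - by rewrite ltr_int a0.
have : \sum_(j < n.+1) ((n%:Z - j%:Z) * (x1' - x1) + j%:Z * (x2' - x2)) <=
       \sum_(j < n.+1) n%:Z * ((m j.+1)%:Z + 1).
  by apply: ler_sum => j _; apply: row; rewrite -ltnS.
have -> : \sum_(j < n.+1) n%:Z * ((m j.+1)%:Z + 1) = n%:Z * (#|` I|%:Z + n.+1%:Z).
  rewrite -mulr_sumr big_split /= sumr_const card_ord card_interior.
  by rewrite (big_morph Posz PoszD (erefl 0%:Z)) natz.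
rewrite -(ler_pM2l (ltr0n int 2)) sum_interpolation.
have -> : n.+1%:Z * ((2 * n%:Z - n%:Z) * (x1' - x1) + n%:Z * (x2' - x2)) =
   n%:Z * (n.+1%:Z * ((x1' - x1) + (x2' - x2))) by ring.
rewrite [X in _ <= X]mulrCA ler_pM2l ?ltz_nat // => h.
have : n.+1%:Z * ((c 1)%:Z - 1 + ((c n.+1)%:Z - 1)) <= n.+1%:Z * ((x1' - x1) + (x2' - x2)).
  by rewrite ler_pM2l // lerD // lerBlDr.
move/le_trans/(_ h); move: (c 1) (c n.+1) #|` I|; move: n.+1; clear; nia.
Qed.

Variables (h : lpoint -> R) (D : {fset {fset lpoint}}).
Hypothesis indD : induces A h D.
Hypothesis uniD : forall T, T \in D -> unimodular_triangle T.

Lemma normal_bound : (n.+1 * cone_dim (@moduli_cone R A D) <=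
  n.+1 * (#|` I| + (2 * n).+1) + 2 * #|` I|)%N.
Proof.
have z1A := interior_lattice polyP z1I; have z2A := interior_lattice polyP z2I.
have [|f' f'E] := @frame_change f 1 0 0 0 (-1) (n%:Z + 2); first by [].
have Y'E a : fY f' a = n%:Z + 2 - Y a by rewrite (f'E a).2; move: (X a) (Y a); clear; lia.
have Y0 a : a \in A -> 0 <= Y a by move=> /rowsA/andP[].
have Y0' a : a \in A -> 0 <= fY f' a by rewrite Y'E subr_ge0 => /rowsA/andP[].
have z2Y' : fY f' z2 = 1 by rewrite Y'E z2Y; clear; lia.
have [x0 [L0 [K0 [K0A K0n c0 cK0 row0]]]] := bottom_null polyP indD uniD Y0 z1I z1Y.
have [x0' [L1 [K1 [K1A K1n c1 cK1 row1]]]] := bottom_null polyP indD uniD Y0' z2I z2Y'.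
have rowE (S : {fset lpoint}) (y : int) : frow S f' y = frow S f (n%:Z + 2 - y).
  apply/fsetP => a; rewrite !in_frow Y'E; congr (_ && _).
  by apply/eqP/eqP; move: (Y a); clear; lia.
have e1 : n%:Z + 2 - 0 = n.+2%:Z by clear; lia.
have e2 : n%:Z + 2 - 1 = n.+1%:Z by clear; lia.
rewrite !rowE e1 -/(c n.+2) in c1; rewrite rowE e2 -/(m n.+1) in cK1.
rewrite -/(c 0) in c0; rewrite -/(m 1) in cK0.
(* Exactly L0 - m 1 null points are kept, in truncated subtraction. As m 1 > 0, two points of the
   bottom row stay outside K whenever L0 > 0; the top row is treated alike. *)
have [|K0' K0s k0E] := @fset_truncate _ K0 (L0 - m 1)%N; first by move: cK0; move: #|` K0| (m 1); clear; lia.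
have [|K1' K1s k1E] := @fset_truncate _ K1 (L1 - m n.+1)%N; first by move: cK1; move: #|` K1| (m n.+1); clear; lia.
pose K := (K0' `|` K1')%fset.
have K0Y w : w \in K0' -> null_point D w /\ Y w = 0 by move=> /(fsubsetP K0s)/K0n.
have K1Y w : w \in K1' -> null_point D w /\ Y w = n%:Z + 2.
  by move=> /(fsubsetP K1s)/K1n[nw]; rewrite Y'E => /eqP; rewrite subr_eq0 => /eqP <-.
have KA : (K `<=` A)%fset.
  by rewrite fsubUset (fsubset_trans K0s K0A) (fsubset_trans K1s K1A).
have Kn w : w \in K -> null_point D w by rewrite in_fsetU => /orP[/K0Y[]|/K1Y[]].
have cK : #|` K| = ((L0 - m 1) + (L1 - m n.+1))%N.
  rewrite /K cardfsU k0E k1E (_ : (K0' `&` K1')%fset = fset0) ?cardfs0 ?subn0 //.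
  apply/fsetP => w; rewrite in_fsetI in_fset0; apply/negP => /andP[/K0Y[_ w0] /K1Y[_]].
  by rewrite w0; clear; lia.
have m1 : (0 < m 1)%N by rewrite cardfs_gt0; apply/fset0Pn; exists z1; rewrite in_frow z1I z1Y eqxx.
have m2 : (0 < m n.+1)%N by rewrite cardfs_gt0; apply/fset0Pn; exists z2; rewrite in_frow z2I z2Y PoszS eqxx.
have zK w : w \in I -> w \notin K.
  move=> /rowsI wr; rewrite in_fsetU; apply/negP => /orP[/K0Y[_]|/K1Y[_]]; move: wr; move: (Y w); clear; lia.
have [b1 [b2 [b3 [b1K b2K b3K ob]]]] : exists b1 b2 b3, [/\ b1 \in (A `\` K)%fset,
    b2 \in (A `\` K)%fset, b3 \in (A `\` K)%fset & orientation b1 b2 b3 != 0].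
  have [L00|L0p] := posnP L0; last first.
    apply: (row_base row0 _ z1A z1Y (zK _ z1I)).
    have : (#|` (frow A f 0 `&` K)%fset| <= #|` K0'|)%N.
      apply: fsubset_leq_card; apply/fsubsetP => w; rewrite in_fsetI in_frow in_fsetU.
      move=> /andP[/andP[_ /eqP w0] /orP[//|/K1Y[_]]]; rewrite w0; clear; lia.
    rewrite k0E; move: #|` (_ `&` _)%fset| (m 1) m1 L0p; clear; lia.
  have [L10|L1p] := posnP L1; last first.
    apply: (row_base row1 _ z2A z2Y' (zK _ z2I)).
    have : (#|` (frow A f' 0 `&` K)%fset| <= #|` K1'|)%N.
      apply: fsubset_leq_card; apply/fsubsetP => w; rewrite in_fsetI in_frow in_fsetU Y'E.
      move=> /andP[/andP[_ /eqP w0] /orP[/K0Y[_ w1]|//]]; move: w0; rewrite w1; clear; lia.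
    rewrite k1E; move: #|` (_ `&` _)%fset| (m n.+1) m2 L1p; clear; lia.
  have K00 : K = fset0.
    by apply/eqP; rewrite -cardfs_eq0 cK L00 L10 !sub0n.
  have [b1 [b2 [b3 [q1 q2 q3 q4]]]] := interior_base polyP z1I.
  by exists b1, b2, b3; rewrite K00 fsetD0.
have := cone_dim_le R uniD KA Kn b1K b2K b3K ob; rewrite cK card_lattice.
move: (cone_dim _) => N.
have := card_interior; have := trapezoid; have := row_le2.
move: c0 c1; clearbody c m; clear => c0 c1 le2 tr cI hN.
case: n le2 tr cI hN c1 => [|k] le2 tr cI hN c1.
  (* With a single interior row, row 1 is next to both the bottom and the top row. *)
  move: cI hN; rewrite !big_ord1; have := le2 0%N isT.
  by move: (c 0%N) (c 1%N) (c 2%N) (m 1%N) c0 c1 => c0' c1' c2' m1'; clear; lia.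
have mid : (\sum_(i < k) c i.+2 <= \sum_(i < k) m i.+2 + 2 * k)%N.
  have -> : (2 * k = \sum_(i < k) 2)%N by rewrite sum_nat_const card_ord mulnC.
  rewrite -big_split /=; apply: leq_sum => i _; apply: le2.
  by apply: leqW; apply: ltn_ord.
have split_sum (F : nat -> nat) : (\sum_(i < k.+2) F i.+1 = F 1 + \sum_(i < k) F i.+2 + F k.+2)%N.
  by rewrite big_ord_recr big_ord_recl.
move: cI hN; rewrite !split_sum.
move: (\sum_(i < k) c i.+2)%N (\sum_(i < k) m i.+2)%N mid (tr isT) => Sc Sm mid {}tr cI hN.
have N1 : (N + 1 <= #|` I| + (c 1 + c k.+2) + 2 * k)%N.
  move: hN c0 c1 cI mid; move: (c 0%N) (c 1%N) (c k.+2) (c k.+3) (m 1%N) (m k.+2) #|` I|; clear; lia.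
have N2 : (k.+2 * (N + 1) <= k.+2 * (#|` I| + (c 1 + c k.+2) + 2 * k))%N by rewrite leq_mul2l N1 orbT.
move: N2 tr; rewrite !mulnDr; move: (k.+2 * N)%N (c 1%N) (c k.+2) #|` I|; clear; nia.
Qed.

End NormalBound.

(** * Multiples of the unimodular triangle *)

Lemma frow_card_le (S : {fset lpoint}) f (a b y : int) : a <= b + 1 ->
  (forall z, z \in S -> fY f z = y -> a <= fX f z <= b) ->
  #|` frow S f y|%:Z <= b - a + 1.
Proof.
move=> ab hS; have [->|[z zS]] := fset_0Vmem (frow S f y).
  by rewrite cardfs0; move: ab; clear; lia.
have [a' [b' [aS bS sz _]]] := frow_range zS.
have := hS _ aS; have := hS _ bS; rewrite !fX_fpt !fY_fpt => /(_ erefl) h1 /(_ erefl) h2.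
by move: sz h1 h2; move: #|` _|; clear; lia.
Qed.

Section Triangle.
Variables (R : realType) (P : set (plane R)) (polyP : lattice_polygon P).
Local Notation A := (lattice_points P).
Local Notation I := (interior_points P).
Variables (f : frame) (s : nat).
Local Notation X := (fX f).
Local Notation Y := (fY f).
Hypothesis triA : forall a, a \in A ->
  [/\ X a <= 1, -1 <= X a + Y a & Y a <= s%:Z + 1].
Hypotheses (cor1 : fpt f 1 (-2) \in A) (cor2 : fpt f 1 (s%:Z + 1) \in A).
Hypotheses (cor3 : fpt f (-2 - s%:Z) (s%:Z + 1) \in A) (OI : fpt f 0 0 \in I).

(** In [f'] the side X + Y = -1 is row 0, with Y as the coordinate along it. *)
Lemma triangle_left y : -2 <= y <= s%:Z + 1 -> fpt f (-1 - y) y \in A.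
Proof.
move=> hy; have [|f' f'E] := @frame_change f 0 1 0 1 1 1; first by [].
have E x z : fpt f x z = fpt f' z (x + z + 1).
  apply: (@frame_eq f'); rewrite ?fX_fpt ?fY_fpt ?(f'E _).1 ?(f'E _).2 !fX_fpt !fY_fpt; clear; lia.
rewrite E (_ : -1 - y + y + 1 = 0); last by clear; lia.
apply: (@body_row_lattice _ _ polyP f' (-2) (s%:Z + 1)) => //.
  by have := cor1; rewrite E.
by have := cor3; rewrite E (_ : -2 - s%:Z + (s%:Z + 1) + 1 = 0) //; clear; lia.
Qed.

Lemma triangle_right y : -2 <= y <= s%:Z + 1 -> fpt f 1 y \in A.
Proof.
move=> hy; have [|f' f'E] := @frame_change f 0 1 0 1 0 0; first by [].
have E x z : fpt f x z = fpt f' z x.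
  apply: (@frame_eq f'); rewrite ?fX_fpt ?fY_fpt ?(f'E _).1 ?(f'E _).2 !fX_fpt !fY_fpt; clear; lia.
by rewrite E; apply: (@body_row_lattice _ _ polyP f' (-2) (s%:Z + 1)); rewrite -?E.
Qed.

Lemma triangle_mem x y : x <= 1 -> -1 <= x + y -> y <= s%:Z + 1 -> fpt f x y \in A.
Proof.
move=> h1 h2 h3; have hy : -2 <= y <= s%:Z + 1 by move: h1 h2 h3; clear; lia.
apply: (body_row_lattice polyP (triangle_left hy) (triangle_right hy)).
by move: h1 h2; clear; lia.
Qed.

Lemma triangle_interior x y : x <= 0 -> 0 <= x + y -> y <= s%:Z -> fpt f x y \in I.
Proof.
move=> h1 h2 h3; have hy : -2 <= y <= s%:Z + 1 by move: h1 h2 h3; clear; lia.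
apply/(ibody_lattice polyP f).
have bl := (body_lattice polyP f _ _).2 (triangle_left hy).
have br := (body_lattice polyP f _ _).2 (triangle_right hy).
apply: (ibody_between polyP OI bl br _ _ ((body_lattice polyP f _ _).2 cor2) _
  ((body_lattice polyP f _ _).2 cor1)); rewrite ltr_int; move: h1 h2 h3; clear; lia.
Qed.

Lemma interior_triangle z : z \in I -> [/\ X z <= 0, 0 <= X z + Y z & Y z <= s%:Z].
Proof.
move=> zI.
have [//|a /triA[a1 a2 a3] la] := interior_not_extremal polyP f (p := -1) (q := 0) zI.
have [//|b /triA[b1 b2 b3] lb] := interior_not_extremal polyP f (p := 1) (q := 1) zI.
have [//|c /triA[c1 c2 c3] lc] := interior_not_extremal polyP f (p := 0) (q := -1) zI.
by split; [move: a1 la|move: b2 lb|move: c3 lc];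
  move: (X a) (Y a) (X b) (Y b) (X c) (Y c) (X z) (Y z); clear; lia.
Qed.

Lemma triangle_card_interior : (s.+1 * s.+2 <= 2 * #|` I|)%N.
Proof.
rewrite (@card_rows I f s.+1); last first.
  by move=> a /interior_triangle[]; move: (X a) (Y a); clear; lia.
have -> : (s.+1 * s.+2 = 2 * \sum_(i < s.+1) i.+1)%N.
  elim: s => [|k IH]; first by rewrite big_ord1.
  by rewrite big_ord_recr /= mulnDr -IH; clear; lia.
rewrite leq_mul2l /=; apply: leq_sum => i _.
have : 0 - (- i%:Z) + 1 <= #|` frow I f i%:Z|%:Z.
  apply: frow_card_ge => x hx; have := ltn_ord i; rewrite ltnS => li.
  by apply: triangle_interior; move: hx li; move: (nat_of_ord i); clear; lia.
by move: #|` frow I f i%:Z|; move: (nat_of_ord i); clear; lia.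
Qed.

(** By rows from the lowest corner the boundary has at most 1 + 2 + 2 (s + 1) + (s + 4) = 3 (s + 3)
    lattice points; the first two rows and the last one contain no interior points. *)
Lemma triangle_card : (#|` A| <= #|` I| + 3 * s.+3)%N.
Proof.
have [|f' f'E] := @frame_change f 1 0 0 0 1 2; first by [].
have rowE (S : {fset lpoint}) (y : int) : frow S f' y = frow S f (y - 2).
  apply/fsetP => a; rewrite !in_frow (f'E a).2; congr (_ && _).
  by apply/eqP/eqP; move: (X a) (Y a); clear; lia.
rewrite (@card_rows A f' s.+4); last first.
  by move=> a /triA[]; rewrite (f'E a).2; move: (X a) (Y a); clear; lia.
rewrite (@card_rows I f s.+1); last first.
  by move=> a /interior_triangle[]; move: (X a) (Y a); clear; lia.
have split_sum (F : nat -> nat) :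
    (\sum_(i < s.+4) F i = F 0 + F 1 + \sum_(i < s.+1) F i.+2 + F s.+3)%N.
  by rewrite big_ord_recr !big_ord_recl /= !addnA.
rewrite (split_sum (fun i => #|` frow A f' i%:Z|)).
have r0 : (#|` frow A f' 0%:Z| <= 1)%N.
  have : #|` frow A f' 0%:Z|%:Z <= 1 - 1 + 1.
    by apply: frow_card_le => // z /triA[]; rewrite (f'E z).1 (f'E z).2; move: (X z) (Y z); clear; lia.
  by move: #|` _|; clear; lia.
have r1 : (#|` frow A f' 1%:Z| <= 2)%N.
  have : #|` frow A f' 1%:Z|%:Z <= 1 - 0 + 1.
    by apply: frow_card_le => // z /triA[]; rewrite (f'E z).1 (f'E z).2; move: (X z) (Y z); clear; lia.
  by move: #|` _|; clear; lia.
have rt : (#|` frow A f' s.+3%:Z| <= s.+4)%N.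
  have : #|` frow A f' s.+3%:Z|%:Z <= 1 - (-2 - s%:Z) + 1.
    apply: frow_card_le => [|z /triA[]]; first by clear; lia.
    by rewrite (f'E z).1 (f'E z).2; move: (X z) (Y z); clear; lia.
  by move: #|` _|; clear; lia.
have mid : (\sum_(i < s.+1) #|` frow A f' i.+2%:Z| <=
            \sum_(i < s.+1) #|` frow I f i%:Z| + 2 * s.+1)%N.
  have -> : (2 * s.+1 = \sum_(i < s.+1) 2)%N by rewrite sum_nat_const card_ord mulnC.
  rewrite -big_split /=; apply: leq_sum => i _.
  rewrite rowE (_ : i.+2%:Z - 2 = i%:Z); last by clear; lia.
  by apply: (boundary_row_le2 polyP OI cor1 cor2); rewrite fY_fpt; have := ltn_ord i; clear; lia.
move: r0 r1 rt mid; move: #|` frow A f' 0%:Z| #|` frow A f' 1%:Z| #|` frow A f' s.+3%:Z|.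
by move: (\sum_(i < s.+1) _)%N (\sum_(i < s.+1) _)%N; clear; lia.
Qed.

Variables (h : lpoint -> R) (D : {fset {fset lpoint}}).
Hypothesis indD : induces A h D.
Hypothesis uniD : forall T, T \in D -> unimodular_triangle T.

(** The sides Y = s + 1 and X = 1 each have s + 4 lattice points next to s + 1 interior ones, hence
    two null points; they share only a corner, so three are distinct. The dimension is then at most
    g + 3 (s + 1), and (s + 1) (s + 2) <= 2 g covers the difference. *)
Lemma triangle_bound : (s.+1 * cone_dim (@moduli_cone R A D) <=
  s.+1 * (#|` I| + (2 * s).+1) + 2 * #|` I|)%N.
Proof.
have [|f1 f1E] := @frame_change f 1 0 0 0 (-1) (s%:Z + 1); first by [].
have [|f2 f2E] := @frame_change f 0 1 0 (-1) 0 1; first by [].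
have Y1E a : fY f1 a = s%:Z + 1 - Y a by rewrite (f1E a).2; move: (X a) (Y a); clear; lia.
have Y2E a : fY f2 a = 1 - X a by rewrite (f2E a).2; move: (X a) (Y a); clear; lia.
have X1E a : fX f1 a = X a by rewrite (f1E a).1; move: (X a) (Y a); clear; lia.
have X2E a : fX f2 a = Y a by rewrite (f2E a).1; move: (X a) (Y a); clear; lia.
have P1 x y : fpt f1 x y = fpt f x (s%:Z + 1 - y).
  by apply: (@frame_eq f1); rewrite ?fX_fpt ?fY_fpt ?X1E ?Y1E ?fX_fpt ?fY_fpt //; clear; lia.
have P2 x y : fpt f2 x y = fpt f (1 - y) x.
  by apply: (@frame_eq f2); rewrite ?fX_fpt ?fY_fpt ?X2E ?Y2E ?fX_fpt ?fY_fpt //; clear; lia.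
have Y10 a : a \in A -> 0 <= fY f1 a by rewrite Y1E subr_ge0 => /triA[].
have Y20 a : a \in A -> 0 <= fY f2 a by rewrite Y2E subr_ge0 => /triA[].
have z1I : fpt f 0 s%:Z \in I by apply: triangle_interior => //; rewrite add0r.
have z1Y : fY f1 (fpt f 0 s%:Z) = 1 by rewrite Y1E fY_fpt; clear; lia.
have z2Y : fY f2 (fpt f 0 0) = 1 by rewrite Y2E fX_fpt subr0.
have [x1 [L1 [K1 [K1A K1n c1 cK1 _]]]] := bottom_null polyP indD uniD Y10 z1I z1Y.
have [x2 [L2 [K2 [K2A K2n c2 cK2 _]]]] := bottom_null polyP indD uniD Y20 OI z2Y.
have k1 : (2 <= #|` K1|)%N.
  have h1 : 1 - (-2 - s%:Z) + 1 <= #|` frow A f1 0|%:Z.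
    by apply: frow_card_ge => x hx; rewrite P1; apply: triangle_mem; move: hx; clear; lia.
  have h2 : #|` frow I f1 1|%:Z <= 0 - (- s%:Z) + 1.
    apply: frow_card_le => [|z /interior_triangle[]]; first by clear; lia.
    by rewrite X1E Y1E; move: (X z) (Y z); clear; lia.
  by move: h1 h2 c1 cK1; move: #|` _| #|` _| #|` _|; clear; lia.
have k2 : (2 <= #|` K2|)%N.
  have h1 : (s%:Z + 1) - (-2) + 1 <= #|` frow A f2 0|%:Z.
    by apply: frow_card_ge => x hx; rewrite P2; apply: triangle_mem; move: hx; clear; lia.
  have h2 : #|` frow I f2 1|%:Z <= s%:Z - 0 + 1.
    apply: frow_card_le => [|z /interior_triangle[]]; first by clear; lia.
    by rewrite X2E Y2E; move: (X z) (Y z); clear; lia.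
  by move: h1 h2 c2 cK2; move: #|` _| #|` _| #|` _|; clear; lia.
pose K := (K1 `|` K2)%fset.
have K1Y w : w \in K1 -> Y w = s%:Z + 1.
  by move=> /K1n[_]; rewrite Y1E => /eqP; rewrite subr_eq0 => /eqP <-.
have K2X w : w \in K2 -> X w = 1.
  by move=> /K2n[_]; rewrite Y2E => /eqP; rewrite subr_eq0 => /eqP <-.
have cK : (3 <= #|` K|)%N.
  have : (#|` K1 `&` K2| <= #|` [fset fpt f 1 (s%:Z + 1)%R]|)%N%fset.
    apply: fsubset_leq_card; apply/fsubsetP => w; rewrite in_fsetI in_fset1.
    move=> /andP[/K1Y wy /K2X wx]; apply/eqP/(@frame_eq f); by rewrite ?fX_fpt ?fY_fpt.
  rewrite cardfs1 /K cardfsU; move: k1 k2; move: #|` K1| #|` K2| #|` _|; clear; lia.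
have KA : (K `<=` A)%fset by rewrite fsubUset K1A K2A.
have Kn w : w \in K -> null_point D w by rewrite in_fsetU => /orP[/K1n[]|/K2n[]].
have off x y : x <= 0 -> y <= 0 -> -1 <= x + y -> fpt f x y \in (A `\` K)%fset.
  move=> hx hy hxy; rewrite in_fsetD; apply/andP; split; last first.
    by apply: triangle_mem; move: hx hy hxy; clear; lia.
  rewrite in_fsetU; apply/negP => /orP[/K1Y|/K2X]; rewrite ?fX_fpt ?fY_fpt; move: hx hy; clear; lia.
have o0 : orientation (fpt f 0 0) (fpt f 0 (-1)) (fpt f (-1) 0) != 0.
  by rewrite -normr_eq0 (norm_orientation_frame f) normr_eq0 !fX_fpt !fY_fpt.
have := cone_dim_le R uniD KA Kn (off 0 0 _ _ _) (off 0 (-1) _ _ _) (off (-1) 0 _ _ _) o0.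
move=> /(_ isT isT isT isT isT isT isT isT isT).
have := triangle_card_interior; have := triangle_card; move: cK.
move: (cone_dim _) #|` K| #|` A| #|` I| => N k a g; clear => k3 ag gs hN.
have N1 : (N <= g + 3 * s.+1)%N by move: hN k3 ag; clear; lia.
have : (s.+1 * N <= s.+1 * (g + 3 * s.+1))%N by rewrite leq_mul2l N1 orbT.
move: gs; clear; nia.
Qed.

End Triangle.

(** * Polygons reaching far beyond their interior strip *)

Section Abnormal.
Variables (R : realType) (P : set (plane R)) (polyP : lattice_polygon P).
Local Notation A := (lattice_points P).
Local Notation I := (interior_points P).
Variables (f : frame) (s k t v : int).
Local Notation X := (fX f).
Local Notation Y := (fY f).
Hypothesis rowsI : forall z, z \in I -> 0 <= Y z <= s.
Hypothesis rowsA : forall a, a \in A -> - k <= Y a <= s + t.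
Hypotheses (OI : fpt f 0 0 \in I) (vA : fpt f v (- k) \in A).
Hypotheses (k2 : 2 <= k) (t1 : 1 <= t) (v0 : 0 <= v < k).
Hypothesis minimal : forall (f' : frame) (lo hi : int),
  (forall z, z \in I -> 0 <= fY f' z <= s) ->
  (forall a, a \in A -> lo <= fY f' a <= hi) -> s + t + k <= hi - lo.

Let O_ibody : ibody P f 0 0.
Proof. by have := (ibody_lattice polyP f 0 0).2 OI. Qed.

Let kR : (2 : R) <= k%:~R.
Proof. by rewrite -[2]/(2%:~R) ler_int. Qed.

Let not_row_minus1 (x : int) : ~ ibody P f x%:~R (-1).
Proof.
move=> hx; have : fpt f x (-1) \in I by apply/(ibody_lattice polyP f).
by move/rowsI; rewrite fY_fpt.
Qed.

(** The segment from the interior point (0, 0) to a point at depth j >= 2 crosses row -1 before its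
    end. *)
Lemma deep_row_minus1 (x j : int) : 2 <= j -> fpt f x (- j) \in A ->
  ibody P f (x%:~R / j%:~R) (-1).
Proof.
move=> j2 /(body_lattice polyP f) b.
have jR : (2 : R) <= j%:~R by rewrite -[2]/(2%:~R) ler_int.
pose u : R := 1 - j%:~R^-1.
have jN0 : j%:~R != 0 :> R by apply/eqP; lra.
have u0 : 0 < u by rewrite /u subr_gt0 invf_lt1; lra.
have u1 : u <= 1 by rewrite /u gerBl invr_ge0; lra.
have := ibody_comb polyP u0 u1 O_ibody b.
have -> : u * 0 + (1 - u) * x%:~R = x%:~R / j%:~R by rewrite /u; field.
by have -> : u * 0 + (1 - u) * (- j)%:~R = -1 by rewrite /u rmorphN /=; field.
Qed.

Let v_pos : 0 < v.
Proof.
case/andP: v0 => v0' _; rewrite lt_neqAle v0' andbT; apply/eqP => E.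
have := deep_row_minus1 k2 vA; rewrite -E mul0r -[0]/(0%:~R); exact: not_row_minus1.
Qed.

(** The interior point v / k lies in (0, 1), so a point of P outside [0, 1] would make (0, -1) or
    (1, -1) interior. *)
Lemma row_minus1 x : body P f x (-1) -> 0 <= x <= 1.
Proof.
move=> b; have iv := deep_row_minus1 k2 vA.
have k0R : 0 < k%:~R :> R by apply: lt_le_trans kR.
have vk : v%:~R / k%:~R < 1 :> R.
  by rewrite ltr_pdivrMr // mul1r ltr_int; case/andP: v0.
have vk0 : 0 < v%:~R / k%:~R :> R by rewrite divr_gt0 // ltr0z.
apply/andP; split; rewrite leNgt; apply/negP => h.
  have : ibody P f 0 (-1) by apply: (ibody_row polyP iv b); right; split=> //; exact: ltW.
  by rewrite -[0]/(0%:~R); exact: not_row_minus1.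
have : ibody P f 1 (-1) by apply: (ibody_row polyP iv b); left; split=> //; exact: ltW.
by rewrite -[1]/(1%:~R); exact: not_row_minus1.
Qed.

Lemma irow_minus1 x : ibody P f x (-1) -> 0 < x < 1.
Proof.
move=> ib; have /andP[x0 x1] := row_minus1 (ibody_body ib).
apply/andP; split; rewrite lt_neqAle ?x0 ?x1 andbT; apply/eqP => E.
  by move: ib; rewrite -E -[0]/(0%:~R); exact: not_row_minus1.
by move: ib; rewrite E -[1]/(1%:~R); exact: not_row_minus1.
Qed.

(* The segment from v to (x, y) meets the row -1 in this point. *)
Let cross (x y : int) : R :=
  ((k - 1) * x + (y + 1) * v)%:~R / (y + k)%:~R.

Let crossE (x y : int) : -1 <= y -> exists w : R,
  [/\ 0 < w, w <= 1, w * x%:~R + (1 - w) * v%:~R = cross x y &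
      w * y%:~R + (1 - w) * (- k)%:~R = -1].
Proof.
have k2R := kR; move=> y1; have yR : (-1 : R) <= y%:~R by rewrite -[-1]/((-1)%:~R) ler_int.
have yk : y%:~R + k%:~R != 0 :> R by apply/eqP; lra.
exists ((k%:~R - 1) / (y%:~R + k%:~R)); split.
- by rewrite divr_gt0; lra.
- by rewrite ler_pdivrMr; lra.
- by rewrite /cross !rmorphD !rmorphM /= rmorphB rmorphD /=; field.
- by rewrite rmorphN /=; field.
Qed.

Let cross_bounds (x y : int) : -1 <= y ->
  ((0 <= cross x y <= 1) = (0 <= (k - 1) * x + (y + 1) * v <= y + k)) /\
  ((0 < cross x y < 1) = (0 < (k - 1) * x + (y + 1) * v < y + k)).
Proof.
move=> y1; have yk : (0 : R) < (y + k)%:~R by rewrite ltr0z; move: y1 k2; clear; lia.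
rewrite /cross ler_pdivrMr // ler_pdivlMr // ltr_pdivrMr // ltr_pdivlMr // !mul0r !mul1r.
by rewrite ler0z ltr0z ler_int ltr_int.
Qed.

(** The segment to the deep point crosses row -1 in [0, 1], that is 0 <= (k - 1) X + (Y + 1) v <= Y
    + k; the bounds 1 <= v <= k - 1 turn this into half-planes independent of v. *)
Lemma high_cone a : a \in A -> -1 <= Y a -> X a <= 1 /\ -1 <= X a + Y a.
Proof.
move=> aA y1; have [w [w0 w1 ex ey]] := crossE (X a) y1.
have := body_comb polyP (ltW w0) w1 (body_mem polyP f aA) ((body_lattice polyP f _ _).2 vA).
rewrite ex ey => /row_minus1; rewrite (cross_bounds (X a) y1).1.
by move: y1 v_pos v0 k2; move: (X a) (Y a); clear; nia.
Qed.

(** Here the window is open, so integrality moves both lines inwards by one. *)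
Lemma interior_cone z : z \in I -> X z <= 0 /\ 0 <= X z + Y z.
Proof.
move=> zI; have y1 : -1 <= Y z by have := rowsI zI; move: (Y z); clear; lia.
have [w [w0 w1 ex ey]] := crossE (X z) y1.
have := ibody_comb polyP w0 w1 (ibody_mem polyP f zI) ((body_lattice polyP f _ _).2 vA).
rewrite ex ey => /irow_minus1; rewrite (cross_bounds (X z) y1).2.
by move: y1 v_pos v0 k2; move: (X z) (Y z); clear; nia.
Qed.

Lemma deep_cone a : a \in A -> Y a <= -2 -> 0 < X a < - Y a.
Proof.
move=> aA y2.
have j2 : 2 <= - Y a by rewrite lerNr.
have aA' : fpt f (X a) (- - Y a) \in A by rewrite opprK fptK.
have /irow_minus1 := deep_row_minus1 j2 aA'.
have jR : (0 : R) < (- Y a)%:~R by rewrite ltr0z; move: j2; clear; lia.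
by rewrite ltr_pdivrMr // ltr_pdivlMr // mul0r mul1r ltr0z ltr_int.
Qed.

(** In the directions -X and X + Y the interior points occupy values in [0, s] and P lies in
    [1 - k, 1 + s + t], of length s + t + k. By [minimal] both ends are attained, and the cones
    leave one candidate for each; for the lower ends this needs k >= 3. *)
Lemma extremal_points :
  [/\ fpt f (-1 - s - t) (s + t) \in A, fpt f 1 (s + t) \in A,
      3 <= k -> fpt f (k - 1) (- k) \in A & 3 <= k -> fpt f 1 (- k) \in A].
Proof.
have [|f1 f1E] := @frame_change f 0 1 0 (-1) 0 0; first by [].
have [|f2 f2E] := @frame_change f 1 0 0 1 1 0; first by [].
have Y1 a : fY f1 a = - X a by rewrite (f1E a).2; move: (X a) (Y a); clear; lia.
have Y2 a : fY f2 a = X a + Y a by rewrite (f2E a).2; move: (X a) (Y a); clear; lia.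
have I1 z : z \in I -> 0 <= fY f1 z <= s.
  move=> zI; have := rowsI zI; have := interior_cone zI; rewrite Y1; move: (X z) (Y z); clear; lia.
have I2 z : z \in I -> 0 <= fY f2 z <= s.
  move=> zI; have := rowsI zI; have := interior_cone zI; rewrite Y2; move: (X z) (Y z); clear; lia.
have bd a : a \in A ->
    (-1 <= Y a /\ X a <= 1 /\ -1 <= X a + Y a \/ Y a <= -2 /\ 0 < X a < - Y a) /\ - k <= Y a <= s + t.
  move=> aA; split; last exact: rowsA.
  have [y1|y1] := lerP (-1) (Y a); first by left; have := high_cone aA y1.
  have y2 : Y a <= -2 by move: y1; move: (Y a); clear; lia.
  by right; have := deep_cone aA y2.
have tight (f' : frame) (lo hi : int) : (forall z, z \in I -> 0 <= fY f' z <= s) ->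
    (forall a, a \in A -> lo <= fY f' a <= hi) -> hi - lo = s + t + k ->
    (exists2 a, a \in A & fY f' a = lo) /\ (exists2 a, a \in A & fY f' a = hi).
  move=> hI hA w; split; apply: contrapT => no.
    have := minimal (f' := f') (lo := lo + 1) (hi := hi) hI.
    suff hA' a : a \in A -> lo + 1 <= fY f' a <= hi.
      by move=> /(_ hA'); move: w; clear; lia.
    move=> aA; have ne : fY f' a <> lo by move=> E; apply: no; exists a.
    by move: ne (hA a aA); move: (fY f' a); clear; lia.
  have := minimal (f' := f') (lo := lo) (hi := hi - 1) hI.
  suff hA' a : a \in A -> lo <= fY f' a <= hi - 1.
    by move=> /(_ hA'); move: w; clear; lia.
  move=> aA; have ne : fY f' a <> hi by move=> E; apply: no; exists a.
  by move: ne (hA a aA); move: (fY f' a); clear; lia.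
have s0 : 0 <= s by have := rowsI OI; rewrite fY_fpt => /andP[].
have [[a1 a1A e1] [a2 a2A e2]] : (exists2 a, a \in A & fY f1 a = 1 - k) /\
    (exists2 a, a \in A & fY f1 a = 1 + s + t).
  apply: tight => // [a /bd|]; last by clear; lia.
  by rewrite Y1; move: k2 t1 s0; move: (X a) (Y a); clear; lia.
have [[a3 a3A e3] [a4 a4A e4]] : (exists2 a, a \in A & fY f2 a = 1 - k) /\
    (exists2 a, a \in A & fY f2 a = 1 + s + t).
  apply: tight => // [a /bd|]; last by clear; lia.
  by rewrite Y2; move: k2 t1 s0; move: (X a) (Y a); clear; lia.
rewrite Y1 in e1; rewrite Y1 in e2; rewrite Y2 in e3; rewrite Y2 in e4.
split=> [||k3|k3].
- have [ex ey] : X a2 = -1 - s - t /\ Y a2 = s + t.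
    by have := bd _ a2A; move: e2 s0 t1; move: (X a2) (Y a2); clear; lia.
  by rewrite -ex -ey fptK.
- have [ex ey] : X a4 = 1 /\ Y a4 = s + t.
    by have := bd _ a4A; move: e4 s0 t1; move: (X a4) (Y a4); clear; lia.
  by rewrite -ex -ey fptK.
- have [ex ey] : X a1 = k - 1 /\ Y a1 = - k.
    by have := bd _ a1A; move: e1 k3; move: (X a1) (Y a1); clear; lia.
  by rewrite -ex -ey fptK.
- have [ex ey] : X a3 = 1 /\ Y a3 = - k.
    by have := bd _ a3A; move: e3 k3; move: (X a3) (Y a3); clear; lia.
  by rewrite -ex -ey fptK.
Qed.

(** For k >= 3 the midpoint (k / 2, -k) of two corners lies in P, and the segment to it from the
    interior point (0, 0) passes through (1, -2), an interior lattice point below the strip. *)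
Lemma depth2 : k = 2.
Proof.
have [_ _ h1 h2] := extremal_points.
apply/eqP; apply: contrapT => /negP ne.
have k3 : 3 <= k by move: ne k2; clear; lia.
have k3R : (3 : R) <= k%:~R by rewrite -[3]/(3%:~R) ler_int.
have b1 := (body_lattice polyP f _ _).2 (h1 k3).
have b2 := (body_lattice polyP f _ _).2 (h2 k3).
have half0 : (0 : R) <= 2^-1 by lra.
have half1 : (2^-1 : R) <= 1 by lra.
have b3 := body_comb polyP half0 half1 b1 b2.
have kN0 : k%:~R != 0 :> R by apply/eqP; lra.
have u0 : 0 < 1 - 2 / k%:~R :> R by rewrite subr_gt0 ltr_pdivrMr; lra.
have kge0 : 0 <= k%:~R :> R by apply: le_trans k3R.
have u1 : 1 - 2 / k%:~R <= 1 :> R by rewrite gerBl divr_ge0.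
have := ibody_comb polyP u0 u1 O_ibody b3; rewrite rmorphB rmorphN /=.
have -> : (1 - 2 / k%:~R) * 0 + (1 - (1 - 2 / k%:~R)) * (2^-1 * (k%:~R - 1%:~R) + (1 - 2^-1) * 1%:~R) = 1%:~R :> R.
  by field.
have -> : (1 - 2 / k%:~R) * 0 + (1 - (1 - 2 / k%:~R)) * (2^-1 * - k%:~R + (1 - 2^-1) * - k%:~R) = (-2)%:~R :> R.
  by field.
by move/(ibody_lattice polyP f)/rowsI; rewrite fY_fpt.
Qed.

(** For t >= 2 the point (0, s + t) lies in P, so (0, s + 1) would be an interior lattice point
    above the strip. *)
Lemma height1 : t = 1.
Proof.
have [h1 h2 _ _] := extremal_points.
have s0 : 0 <= s by have := rowsI OI; rewrite fY_fpt => /andP[].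
apply/eqP; apply: contrapT => /negP ne.
have t2 : 2 <= t by move: ne t1; clear; lia.
have : fpt f 0 (s + t) \in A.
  by apply: (body_row_lattice polyP h1 h2); move: s0 t2; clear; lia.
move=> /(body_lattice polyP f) b.
have s0R : (0 : R) <= s%:~R by rewrite ler0z.
have t2R : (2 : R) <= t%:~R by rewrite -[2]/(2%:~R) ler_int.
have stN0 : s%:~R + t%:~R != 0 :> R by apply/eqP; lra.
pose u : R := 1 - (s%:~R + 1) / (s%:~R + t%:~R).
have u0 : 0 < u by rewrite /u subr_gt0 ltr_pdivrMr; lra.
have u1 : u <= 1 by rewrite /u gerBl divr_ge0 // addr_ge0 // (le_trans _ t2R).
have := ibody_comb polyP u0 u1 O_ibody b; rewrite rmorphD /=.
have -> : u * 0 + (1 - u) * 0%:~R = 0%:~R by ring.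
have -> : u * 0 + (1 - u) * (s%:~R + t%:~R) = (s + 1)%:~R by rewrite rmorphD /= /u; field.
by move/(ibody_lattice polyP f)/rowsI; rewrite fY_fpt; clear; lia.
Qed.

Lemma abnormal_triangle :
  [/\ forall a, a \in A -> [/\ X a <= 1, -1 <= X a + Y a & Y a <= s + 1],
      fpt f 1 (-2) \in A, fpt f 1 (s + 1) \in A & fpt f (-2 - s) (s + 1) \in A].
Proof.
have [h1 h2 _ _] := extremal_points.
split.
- move=> a aA; have := rowsA aA; rewrite depth2 height1.
  have [y1|y1] := lerP (-1) (Y a).
    by have [] := high_cone aA y1; move=> x1 x2 /andP[_ x3]; split.
  have y2 : Y a <= -2 by move: y1; move: (Y a); clear; lia.
  have := deep_cone aA y2; move: y2; move: (X a) (Y a); clear => x y y2 hx hy.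
  by split; move: hx hy y2; clear; lia.
- have -> // : fpt f 1 (-2) = fpt f v (- k).
  by congr fpt; move: v_pos v0; rewrite depth2; clear; lia.
- by have -> : fpt f 1 (s + 1) = fpt f 1 (s + t) by rewrite height1.
- have -> // : fpt f (-2 - s) (s + 1) = fpt f (-1 - s - t) (s + t).
  by congr fpt; rewrite height1; clear; lia.
Qed.

End Abnormal.

(** * Choice of a strip of minimal interior width *)

Section Strip.
Variables (R : realType) (P : set (plane R)) (polyP : lattice_polygon P).
Local Notation A := (lattice_points P).
Local Notation I := (interior_points P).
Variable s : nat.
Hypothesis I0 : I != fset0.
Hypothesis minS : forall (f : frame) (s' : nat),
  (forall z, z \in I -> 0 <= fY f z <= s'%:Z) -> (s <= s')%N.

Definition in_strip f := forall z, z \in I -> 0 <= fY f z <= s%:Z.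

(** If row 0 had no interior point, shifting down by one would fit the interior into a smaller
    strip. *)
Lemma strip_bottom f : in_strip f -> exists2 z, z \in I & fY f z = 0.
Proof.
move=> fI; apply: contrapT => no.
have pos z : z \in I -> 1 <= fY f z <= s%:Z.
  move=> zI; have := fI z zI; have : fY f z <> 0 by move=> E; apply: no; exists z.
  by move: (fY f z); clear; lia.
have /fset0Pn[z0 z0I] := I0.
have [|f' f'E] := @frame_change f 1 0 0 0 1 (-1); first by [].
have := @minS f' s.-1; have s0 : (0 < s)%N by have := pos _ z0I; move: (fY f z0); clear; lia.
have H z : z \in I -> 0 <= fY f' z <= s.-1%:Z.
  by move=> /pos; rewrite (f'E z).2; move: s0; move: (fX f z) (fY f z); clear; lia.
by move=> /(_ H); move: s0; clear; lia.
Qed.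

Lemma strip_flip f : in_strip f -> exists2 f', in_strip f' &
  forall z, fY f' z = s%:Z - fY f z.
Proof.
move=> fI; have [|f' f'E] := @frame_change f 1 0 0 0 (-1) s%:Z; first by [].
have E z : fY f' z = s%:Z - fY f z by rewrite (f'E z).2; move: (fX f z) (fY f z); clear; lia.
by exists f' => // z /fI; rewrite E; move: (fY f z); clear; lia.
Qed.

Lemma strip_top f : in_strip f -> exists2 z, z \in I & fY f z = s%:Z.
Proof.
move=> /strip_flip[f' /strip_bottom[z zI z0] E]; exists z => //.
by move: z0; rewrite E; move: (fY f z); clear; lia.
Qed.

Variables (h : lpoint -> R) (D : {fset {fset lpoint}}).
Hypothesis indD : induces A h D.
Hypothesis uniD : forall T, T \in D -> unimodular_triangle T.

Local Notation strip_inequality := (s.+1 * cone_dim (@moduli_cone R A D) <=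
  s.+1 * (#|` I| + (2 * s).+1) + 2 * #|` I|)%N.

Lemma deep_bound f (lo : int) (w : nat) a : in_strip f ->
  (forall b, b \in A -> lo <= fY f b <= lo + w%:Z) ->
  (forall f' lo' (w' : nat), in_strip f' ->
     (forall b, b \in A -> lo' <= fY f' b <= lo' + w'%:Z) -> (w <= w')%N) ->
  a \in A -> fY f a <= -2 -> strip_inequality.
Proof.
move=> fI fA minw aA a2.
have [z0 z0I z00] := strip_bottom fI; have [z1 z1I z1s] := strip_top fI.
have [v vA vm] := @seq_argmin _ int (fY f) A a aA.
have [u uA um] := @seq_argmin _ int (fun b => - fY f b) A a aA.
have [//|b bA lt] := interior_not_extremal polyP f (p := 0) (q := -1) z1I.
pose k : int := - fY f v; pose t : int := fY f u - s%:Z.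
have k2 : 2 <= k by have := vm _ aA; rewrite /k; move: a2; move: (fY f a) (fY f v); clear; lia.
have t1 : 1 <= t.
  have := um _ bA; rewrite /t; move: lt; rewrite z1s.
  by move: (fX f b) (fX f z1) (fY f b) (fY f u); clear; lia.
(* The quotient is the shear X + q Y that brings the lowest point to 0 <= r < k and keeps all
   rows. *)
have [q [r [qr r0 rk]]] : exists q r, [/\ fX f v - fX f z0 = q * k + r, 0 <= r & r < k].
  exists ((fX f v - fX f z0) %/ k)%Z, ((fX f v - fX f z0) %% k)%Z; split.
  - exact: divz_eq.
  - by rewrite modz_ge0 //; move: k2; clear; lia.
  - by rewrite ltz_pmod //; move: k2; clear; lia.
have [|g gE] := @frame_change f 1 q (- fX f z0) 0 1 0; first by ring.
have gY z : fY g z = fY f z by rewrite (gE z).2; move: (fX f z) (fY f z); clear; lia.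
have gI z : z \in I -> 0 <= fY g z <= s%:Z by rewrite gY; apply: fI.
have gA z : z \in A -> - k <= fY g z <= s%:Z + t.
  move=> zA; have := vm _ zA; have := um _ zA; rewrite gY /k /t.
  by move: (fY f z) (fY f v) (fY f u); clear; lia.
have gO : fpt g 0 0 \in I.
  have <- : z0 = fpt g 0 0; last by [].
  by apply: (@frame_eq g); rewrite ?fX_fpt ?fY_fpt ?(gE z0).1 ?gY z00 // mulr0 mul1r addr0 subrr.
have gv : fpt g r (- k) \in A.
  have <- : v = fpt g r (- k); last by [].
  apply: (@frame_eq g); rewrite ?fX_fpt ?fY_fpt ?(gE v).1 ?gY /k ?opprK //.
  by move: qr; rewrite /k; move: (fX f v) (fX f z0) (fY f v); clear; nia.
have gr : 0 <= r < k by rewrite r0.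
have gmin (f' : frame) (lo' hi : int) : (forall z, z \in I -> 0 <= fY f' z <= s%:Z) ->
    (forall b, b \in A -> lo' <= fY f' b <= hi) -> s%:Z + t + k <= hi - lo'.
  move=> f'I f'A; have := minw f' lo' (absz (hi - lo')) f'I.
  have lh : lo' <= hi by have /andP[] := f'A _ aA; exact: le_trans.
  have H b' : b' \in A -> lo' <= fY f' b' <= lo' + (absz (hi - lo'))%:Z.
    by move=> /f'A; move: lh; move: (fY f' b'); clear; lia.
  move=> /(_ H); have := fA _ uA; have := fA _ vA; move: lh; rewrite /t /k.
  by move: (fY f u) (fY f v); clear; lia.
have [triA c1 c2 c3] := abnormal_triangle polyP gI gA gO gv k2 t1 gr gmin.
exact: (triangle_bound polyP triA c1 c2 c3 gO indD uniD).
Qed.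

Lemma strip_bound f0 : in_strip f0 -> strip_inequality.
Proof.
move=> f0I; have /fset0Pn[z0 z0I] := I0; have z0A := interior_lattice polyP z0I.
pose W (w : nat) := `[< exists f lo, in_strip f /\
   forall b, b \in A -> lo <= fY f b <= lo + w%:Z >].
have exW : exists w, W w.
  have [v vA vm] := @seq_argmin _ int (fY f0) A z0 z0A.
  have [u uA um] := @seq_argmin _ int (fun b => - fY f0 b) A z0 z0A.
  exists (absz (fY f0 u - fY f0 v)); apply/asboolP; exists f0, (fY f0 v); split=> // b bA.
  by have := vm _ bA; have := um _ bA; move: (fY f0 b) (fY f0 u) (fY f0 v); clear; lia.
have [w /asboolP[f [lo [fI fA]]] wmin] := ex_minnP exW.
have minw f' lo' (w' : nat) : in_strip f' ->
    (forall b, b \in A -> lo' <= fY f' b <= lo' + w'%:Z) -> (w <= w')%N.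
  by move=> f'I f'A; apply: wmin; apply/asboolP; exists f', lo'.
have [[a aA a2]|low] := pselect (exists2 a, a \in A & fY f a <= -2).
  exact: deep_bound fI fA minw aA a2.
(* A point two rows above the strip is the previous case upside down: the rows lo, ..., lo + w
   become s - lo - w, ..., s - lo. *)
have [[a aA a2]|high] := pselect (exists2 a, a \in A & s%:Z + 2 <= fY f a).
  have [f' f'I f'E] := strip_flip fI.
  apply: (@deep_bound f' (s%:Z - lo - w%:Z) w a) => //.
    by move=> b /fA; rewrite f'E; move: (fY f b); clear; lia.
  by rewrite f'E; move: a2; move: (fY f a); clear; lia.
have [|g gE] := @frame_change f 1 0 0 0 1 1; first by [].
have gY z : fY g z = fY f z + 1 by rewrite (gE z).2; move: (fX f z) (fY f z); clear; lia.
have [z1 z1I z1Y] := strip_bottom fI; have [z2 z2I z2Y] := strip_top fI.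
apply: (@normal_bound _ _ polyP g s _ _ z1 z2 z1I _ z2I _ h D indD uniD).
- move=> a aA; rewrite gY.
  have l : ~ (fY f a <= -2) by move=> ?; apply: low; exists a.
  have hh : ~ (s%:Z + 2 <= fY f a) by move=> ?; apply: high; exists a.
  by move: l hh; move: (fY f a); clear; lia.
- by move=> a /fI; rewrite gY; move: (fY f a); clear; lia.
- by rewrite gY z1Y.
- by rewrite gY z2Y.
Qed.

End Strip.

(** * Lattice width *)

Section Maps.
Variable R : realType.

Lemma unimodular_map_px (M : 'M[int]_2) b (u : plane R) : px (unimodular_map M b u) =
  (M ord0 ord0)%:~R * px u + (M ord0 (lift ord0 ord0))%:~R * py u + (px b)%:~R.
Proof. by rewrite /px /py !mxE !big_ord_recl big_ord0 !mxE addr0. Qed.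

Lemma unimodular_map_py (M : 'M[int]_2) b (u : plane R) : py (unimodular_map M b u) =
  (M (lift ord0 ord0) ord0)%:~R * px u + (M (lift ord0 ord0) (lift ord0 ord0))%:~R * py u
  + (py b)%:~R.
Proof. by rewrite /px /py !mxE !big_ord_recl big_ord0 !mxE addr0. Qed.

Lemma unitmx_sqr (M : 'M[int]_2) : M \in unitmx ->
  (M ord0 ord0 * M (lift ord0 ord0) (lift ord0 ord0) - M (lift ord0 ord0) ord0 * M ord0 (lift ord0 ord0)) *
  (M ord0 ord0 * M (lift ord0 ord0) (lift ord0 ord0) - M (lift ord0 ord0) ord0 * M ord0 (lift ord0 ord0)) = 1.
Proof.
rewrite unitmxE -det_mx2 => /mulrV; move: (\det M) (\det M)^-1 => x y xy.
have /eqP : (absz x * absz y = 1)%N by rewrite -abszM xy.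
by rewrite muln_eq1 => /andP[/eqP x1 _]; move: x1; clear; nia.
Qed.

Lemma unimodular_map_frame (M : 'M[int]_2) b : M \in unitmx ->
  exists f : frame, forall z : lpoint,
   (fX f z)%:~R = px (unimodular_map M b (emb R z)) /\
   (fY f z)%:~R = py (unimodular_map M b (emb R z)).
Proof.
move=> /unitmx_sqr d2; have [f0 f0E] := std_frame.
have [f fE] := @frame_change f0 _ _ (px b) _ _ (py b) d2.
exists f => z; rewrite unimodular_map_px unimodular_map_py !px_emb !py_emb.
move: (fE z); rewrite (f0E z).1 (f0E z).2; move: (fX f z) (fY f z) => x y [-> ->].
by rewrite !rmorphD !rmorphM.
Qed.

Lemma frame_unimodular_map f : exists (M : 'M[int]_2) b, M \in unitmx /\
  exists p q c : int, (forall z : lpoint, fY f z = p * px z + q * py z + c) /\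
  forall u : plane R, py (unimodular_map M b u) = p%:~R * px u + q%:~R * py u + c%:~R.
Proof.
have [a [b [c [a' [b' [c' [d2 fE]]]]]]] := frame_coords f.
pose M : 'M[int]_2 := \matrix_(i, j) (if i == ord0 then (if j == ord0 then a else b)
   else (if j == ord0 then a' else b')).
exists M, (pt2 c c'); split.
  rewrite unitmxE det_mx2 !mxE /=; apply/unitrP; exists (a * b' - a' * b).
  by split; rewrite d2.
exists a', b', c'; split; first by move=> z; rewrite (fE z).2.
have hb : py (pt2 c c') = c' by rewrite /py mxE.
by move=> u; rewrite unimodular_map_py hb !mxE.
Qed.

End Maps.

Section Width.
Variables (R : realType) (P : set (plane R)) (polyP : lattice_polygon P).
Local Notation A := (lattice_points P).
Local Notation I := (interior_points P).

(** Only the second coordinate of a unimodular map matters, and it is the row coordinate of a frame;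
    on the hull the two inequalities follow from those at interior lattice points. *)
Lemma fits_in_strip_frame (t : nat) : fits_in_strip (interior_polygon P) t <->
  exists f : frame, forall z, z \in I -> 0 <= fY f z <= t%:Z.
Proof.
split.
  move=> [M [b [uM hM]]]; have [f fE] := unimodular_map_frame R b uM.
  exists f => z zI; have := hM (emb R z); rewrite pyE -(fE z).2.
  rewrite -[0]/(0%:~R) pmulrn !ler_int; apply.
  by apply: sub_conv_hull; exists z.
move=> [f fI]; have [M [b [uM [p [q [c [fE mE]]]]]]] := frame_unimodular_map R f.
exists M, b; split=> // u hu; rewrite pyE mE; apply/andP; split.
  have : (- c)%:~R <= p%:~R * px u + q%:~R * py u.
    apply: conv_hull_halfplane hu => _ [z zI <-].
    rewrite px_emb py_emb -!rmorphM -rmorphD ler_int.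
    by have := fI z zI; rewrite fE; move: (p * px z + q * py z); clear; lia.
  by rewrite rmorphN /=; lra.
have : (c - t%:Z)%:~R <= (- p)%:~R * px u + (- q)%:~R * py u.
  apply: conv_hull_halfplane hu => _ [z zI <-].
  rewrite px_emb py_emb -!rmorphM -rmorphD ler_int.
  have := fI z zI; rewrite fE !mulNr; move: (p * px z) (q * py z); clear; lia.
by rewrite rmorphB !rmorphN /= -pmulrn; lra.
Qed.

(** Ensures that a least width exists, so that [xget] in [lattice_width] does not fall back on its
    default 0. *)
Lemma interior_strip_exists : exists (t : nat) (f : frame),
  forall z, z \in I -> 0 <= fY f z <= t%:Z.
Proof.
have [f0 _] := std_frame.
have [I0|/fset0Pn[z0 z0I]] := eqVneq I fset0.
  by exists 0%N, f0 => z; rewrite I0 in_fset0.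
have [v vI vm] := @seq_argmin _ int (fY f0) I z0 z0I.
have [u uI um] := @seq_argmin _ int (fun b => - fY f0 b) I z0 z0I.
have [|f fE] := @frame_change f0 1 0 0 0 1 (- fY f0 v); first by [].
exists (absz (fY f0 u - fY f0 v)), f => z zI; rewrite (fE z).2.
have := vm _ zI; have := um _ zI.
by move: (fX f0 z) (fY f0 z) (fY f0 u) (fY f0 v); clear; lia.
Qed.

Lemma lattice_width_frames : 0 <= lattice_width (interior_polygon P) ->
  exists s : nat, [/\ lattice_width (interior_polygon P) = s%:Z, I != fset0,
    (exists f : frame, forall z, z \in I -> 0 <= fY f z <= s%:Z) &
    forall (f : frame) (s' : nat),
      (forall z, z \in I -> 0 <= fY f z <= s'%:Z) -> (s <= s')%N].
Proof.
rewrite /lattice_width; case: asboolP => [//|ne _].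
set S := [set s | _ /\ _].
have exF : exists t, `[< fits_in_strip (interior_polygon P) t >].
  have [t hf] := interior_strip_exists.
  by exists t; apply/asboolP/fits_in_strip_frame.
have [m /asboolP mf mmin] := ex_minnP exF.
have [Sf Sm] : S (xget 0%N S).
  apply: (@xgetPex _ 0%N S); exists m; split=> // t tf; apply: mmin; exact/asboolP.
exists (xget 0%N S); split=> //.
(* The hull of no points is empty, and that case of [lattice_width] has been excluded. *)
- apply/eqP => I0; apply: ne; rewrite /interior_polygon I0.
  have -> : emb R @` [set` fset0] = set0.
    by apply/seteqP; split=> // u [z /=]; rewrite in_fset0.
  by apply: smallest_id => u v l; rewrite inE.
- exact/fits_in_strip_frame.
- by move=> f s' hf; apply: Sm; apply/fits_in_strip_frame; exists f.
Qed.

End Width.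

(** * The exceptional triangle *)

Section Exceptional.
Variables (R : realType) (P : set (plane R)) (polyP : lattice_polygon P).
Hypothesis eqP_exc : equivalent_polygons P (@exceptional_triangle R).
Local Notation A := (lattice_points P).
Local Notation I := (interior_points P).

Let pxpt2 (x y : int) : px (pt2 x y) = x. Proof. by rewrite /px mxE. Qed.
Let pypt2 (x y : int) : py (pt2 x y) = y. Proof. by rewrite /py mxE. Qed.

Let vertex (x y : int) : pt2 x y \in [fset pt2 (-2) (-2); pt2 2 0; pt2 0 2]%fset ->
  @exceptional_triangle R (emb R (pt2 x y)).
Proof. by move=> h; apply: sub_conv_hull; exists (pt2 x y). Qed.

Lemma exceptional_halfplane (p q c : int) :
  c <= p * (-2) + q * (-2) -> c <= p * 2 -> c <= q * 2 ->
  forall u, @exceptional_triangle R u -> c%:~R <= p%:~R * px u + q%:~R * py u.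
Proof.
move=> h1 h2 h3; apply: conv_hull_halfplane => _ [z /= zin <-].
rewrite px_emb py_emb -!rmorphM -rmorphD ler_int.
by move: zin; rewrite !inE => /orP[/orP[]|]/eqP->; rewrite pxpt2 pypt2 ?mulr0 ?addr0 ?add0r.
Qed.

(** Near the origin the barycentric coordinates [al], [be], 1 - [al] - [be] of the corners (-2, -2),
    (2, 0), (0, 2) are nonnegative; [t] turns them into two nested binary combinations. *)
Lemma exceptional_center (x y : R) : `|x| <= 1 / 4 -> `|y| <= 1 / 4 ->
  forall u, px u = x -> py u = y -> @exceptional_triangle R u.
Proof.
rewrite !ler_norml => hx hy u ux uy.
have cE : convex_set (@exceptional_triangle R) by apply: conv_hull_convex.
have {}cE := (convex_setP _).1 cE.
pose al := (1 - (x + y) / 2) / 3.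
pose be := al + x / 2.
pose t := be / (1 - al).
have al1 : 0 < 1 - al by rewrite /al; lra.
have be0 : 0 <= be by rewrite /be /al; lra.
have ga0 : 0 <= 1 - al - be by rewrite /be /al; lra.
have t0 : 0 <= t by rewrite /t divr_ge0 // ltW.
have t1 : t <= 1 by rewrite /t ler_pdivrMr //; lra.
have w1 : @exceptional_triangle R (emb R (pt2 2 0)) by apply: vertex; rewrite !inE eqxx orbT.
have w2 : @exceptional_triangle R (emb R (pt2 0 2)) by apply: vertex; rewrite !inE eqxx orbT.
have w0 : @exceptional_triangle R (emb R (pt2 (-2) (-2))) by apply: vertex; rewrite !inE eqxx.
have w3 := cE _ _ t t0 t1 w1 w2.
have al0 : 0 <= al by rewrite /al; lra.
have al1' : al <= 1 by lra.
have := cE _ _ al al0 al1' w0 w3.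
have tE : (1 - al) * t = be by rewrite /t mulrC divfK // gt_eqF.
suff -> : al *: emb R (pt2 (-2) (-2)) + (1 - al) *: (t *: emb R (pt2 2 0) + (1 - t) *: emb R (pt2 0 2)) = u by [].
apply: cV2_eq; rewrite ?px_comb ?py_comb.
  rewrite !px_emb !pxpt2 ux.
  transitivity (- (2 * al) + 2 * ((1 - al) * t)); first by rewrite rmorphN /=; ring.
  by rewrite tE /be; lra.
rewrite !py_emb !pypt2 uy.
transitivity (- (2 * al) + 2 * ((1 - al) - (1 - al) * t)); first by rewrite rmorphN /=; ring.
by rewrite tE /be /al; lra.
Qed.

Lemma exceptional_frame : exists f : frame,
  (forall z, z \in A -> [/\ fX f z - 2 * fY f z <= 2, fY f z - 2 * fX f z <= 2
     & fX f z + fY f z <= 2]) /\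
  [/\ fpt f 0 0 \in I, fpt f (-2) (-2) \in A, fpt f 2 0 \in A & fpt f 0 2 \in A].
Proof.
have [M [b [uM eE]]] := eqP_exc; have [f fE] := unimodular_map_frame R b uM.
have inj (u v : plane R) : unimodular_map M b u = unimodular_map M b v -> u = v.
  move/addIr => E.
  have uM' : (map_mx intr M : 'M[R]_2) \in unitmx.
    by rewrite unitmxE det_map_mx rmorph_unit // -unitmxE.
  by rewrite -[u](mulKmx uM') E mulKmx.
have back u : @exceptional_triangle R (unimodular_map M b u) -> P u.
  by rewrite eE => -[v Pv /inj <-].
have mapE (x y : int) : unimodular_map M b (emb R (fpt f x y)) = emb R (pt2 x y).
  have := fE (fpt f x y); rewrite fX_fpt fY_fpt => -[ex ey].
  by apply: cV2_eq; rewrite ?px_emb ?py_emb ?pxpt2 ?pypt2.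
have vert (x y : int) : pt2 x y \in [fset pt2 (-2) (-2); pt2 2 0; pt2 0 2]%fset -> fpt f x y \in A.
  by move=> h; apply/(mem_lattice_points polyP); apply: back; rewrite mapE; apply: vertex.
exists f; split.
  move=> z /(mem_lattice_points polyP) Pz.
  have Ez : @exceptional_triangle R (unimodular_map M b (emb R z)) by rewrite eE; exists (emb R z).
  have H (p q c : int) : c <= p * (-2) + q * (-2) -> c <= p * 2 -> c <= q * 2 ->
      c <= p * fX f z + q * fY f z.
    move=> h1 h2 h3; have := exceptional_halfplane h1 h2 h3 Ez.
    rewrite -(fE z).1 -(fE z).2; move: (fX f z) (fY f z) => x y.
    by rewrite -!rmorphM -rmorphD ler_int.
  have := H (-1) 2 (-2) isT isT isT; have := H 2 (-1) (-2) isT isT isT.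
  have := H (-1) (-1) (-2) isT isT isT.
  by move: (fX f z) (fY f z); clear => x y h1 h2 h3; split; move: h1 h2 h3; clear; lia.
split; try by apply: vert; rewrite !inE eqxx ?orbT.
apply/(mem_interior_points polyP)/interiorP.
pose B : R := `|(M ord0 ord0)%:~R| + `|(M ord0 (lift ord0 ord0))%:~R| +
  (`|(M (lift ord0 ord0) ord0)%:~R| + `|(M (lift ord0 ord0) (lift ord0 ord0))%:~R|) + 1.
have B0 : 0 < B by rewrite /B ltr_wpDl // !addr_ge0.
exists (1 / 4 / B); first by rewrite !divr_gt0.
set u0 := emb R _ => v hx hy; apply: back.
have m0 : unimodular_map M b u0 = emb R (pt2 0 0) by rewrite mapE.
have K (p q : R) : `|p| + `|q| <= B -> `|p * (px v - px u0) + q * (py v - py u0)| <= 1 / 4.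
  move=> pq; apply: le_trans (ler_normD _ _) _; rewrite !normrM.
  apply: le_trans (_ : (`|p| + `|q|) * (1 / 4 / B) <= _).
    by rewrite mulrDl; apply: lerD; apply: ler_wpM2l => //; exact: ltW.
  apply: le_trans (_ : B * (1 / 4 / B) <= _).
    by apply: ler_wpM2r => //; rewrite ltW // !divr_gt0.
  by rewrite mulrC divfK // gt_eqF.
apply: (@exceptional_center _ _ _ _ _ erefl erefl).
  have -> : px (unimodular_map M b v) = px (unimodular_map M b v) - px (unimodular_map M b u0).
    by rewrite m0 px_emb pxpt2 subr0.
  rewrite !unimodular_map_px.
  set p := (M ord0 ord0)%:~R; set q := (M ord0 _)%:~R.
  have -> : p * px v + q * py v + (px b)%:~R - (p * px u0 + q * py u0 + (px b)%:~R) =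
     p * (px v - px u0) + q * (py v - py u0) by ring.
  by apply: K; rewrite /B -/p -/q -addrA lerDl !addr_ge0.
have -> : py (unimodular_map M b v) = py (unimodular_map M b v) - py (unimodular_map M b u0).
  by rewrite m0 py_emb pypt2 subr0.
rewrite !unimodular_map_py.
set p := (M _ ord0)%:~R; set q := (M (lift _ _) (lift _ _))%:~R.
have -> : p * px v + q * py v + (py b)%:~R - (p * px u0 + q * py u0 + (py b)%:~R) =
   p * (px v - px u0) + q * (py v - py u0) by ring.
by apply: K; rewrite /B -/p -/q addrAC lerDr !addr_ge0.
Qed.

(** The five rows have at most 1 + 2 + 4 + 2 + 1 lattice points. The centre is interior, hence so
    are its midpoints with the three corners, which are lattice points. *)
Lemma exceptional_card : (#|` A| <= 10)%N /\ (4 <= #|` I|)%N.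
Proof.
have [f [fA [OI c1 c2 c3]]] := exceptional_frame; split.
  have [|g gE] := @frame_change f 1 0 0 0 1 2; first by [].
  rewrite (@card_rows A g 5); last first.
    by move=> a /fA[]; rewrite (gE a).2; move: (fX f a) (fY f a); clear; lia.
  rewrite !big_ord_recl big_ord0 /= /bump /=.
  have row (i : nat) (a b : int) : a <= b + 1 ->
      (forall x y : int, x - 2 * y <= 2 -> y - 2 * x <= 2 -> x + y <= 2 -> y + 2 = i%:Z -> a <= x <= b) ->
      #|` frow A g i%:Z|%:Z <= b - a + 1.
    move=> ab hr; apply: frow_card_le => // z /fA[h1 h2 h3]; rewrite (gE z).1 (gE z).2 => e.
    have -> : 1 * fX f z + 0 * fY f z + 0 = fX f z by ring.
    by apply: hr h1 h2 h3 _; rewrite -e; ring.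
  have r0 := @row 0%N (-2) (-2) isT; have r1 := @row 1%N (-1) 0 isT.
  have r2 := @row 2%N (-1) 2 isT; have r3 := @row 3%N 0 1 isT.
  have r4 := @row 4%N 0 0 isT.
  have {}r0 := r0 ltac:(clear; lia); have {}r1 := r1 ltac:(clear; lia).
  have {}r2 := r2 ltac:(clear; lia); have {}r3 := r3 ltac:(clear; lia).
  have {}r4 := r4 ltac:(clear; lia).
  move: r0 r1 r2 r3 r4.
  move: #|` frow A g 0%N%:Z| #|` frow A g 1%N%:Z| #|` frow A g 2%N%:Z|.
  by move: #|` frow A g 3%N%:Z| #|` frow A g 4%N%:Z|; clear; lia.
have half (x y : int) : fpt f (2 * x) (2 * y) \in A -> fpt f x y \in I.
  move=> /(body_lattice polyP f) bb; apply/(ibody_lattice polyP f).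
  have h0 : (0 : R) < 2^-1 by lra.
  have h1 : (2^-1 : R) <= 1 by lra.
  have := ibody_comb polyP h0 h1 ((ibody_lattice polyP f _ _).2 OI) bb.
  rewrite !rmorphM /= -[2%:~R]/(2 : R) -[0%:~R]/(0 : R).
  have -> : 2^-1 * 0 + (1 - 2^-1) * (2 * x%:~R) = x%:~R :> R by lra.
  by have -> : 2^-1 * 0 + (1 - 2^-1) * (2 * y%:~R) = y%:~R :> R by lra.
pose l := [seq fpt f xy.1 xy.2 | xy <- [:: (0, 0); (-1, -1); (1, 0); (0, 1)] : seq (int * int)].
have ul : uniq l.
  rewrite map_inj_uniq // => -[x y] [x' y'] /= E.
  by have := congr1 (fX f) E; have := congr1 (fY f) E; rewrite !fX_fpt !fY_fpt => -> ->.
have : (size l <= size I)%N.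
  apply: uniq_leq_size => // z /mapP[[x y]]; rewrite !inE => /or4P[]/eqP[-> ->] -> //=.
  - exact: half.
  - exact: half.
  - exact: half.
by rewrite size_map.
Qed.

End Exceptional.

(** * From strips to expected gonality *)

Lemma egon_bound (R : realType) (P : set (plane R)) (D : {fset {fset lpoint}}) :
  lattice_polygon P -> 1 < egon P -> regular_unimodular R (lattice_points P) D ->
  (cone_dim (@moduli_cone R (lattice_points P) D))%:R <=
  #|` interior_points P|%:R + (2 * #|` interior_points P|%:R) / ((egon P)%:~R - 1)
  + 2 * (egon P)%:~R - 3 :> R.
Proof.
move=> polyP; rewrite /egon; case: asboolP => [exc _ [uniD _]|_].
  have [cA cI] := exceptional_card polyP exc.
  (* Here d = 3 and the bound is 2 g + 3, which is at least 11 since g >= 4. *)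
  have := leq_trans (cone_dim_card R (lattice_points P) uniD) cA.
  move: (cone_dim _) #|` _| cI => N g; rewrite -!(ler_nat R) -[3%:~R]/(3 : R) => g4 N10.
  have -> : g%:R + 2 * g%:R / (3 - 1) + 2 * 3 - 3 = 2 * g%:R + 3 :> R by field.
  by move: g4 N10; lra.
move=> d1 [uniD [h indD]].
(* The condition d > 1 excludes the width -1 of an empty interior polygon. *)
have [|s [sE I0 [f fI] smin]] := @lattice_width_frames R P.
  by move: d1; move: (lattice_width _); clear; lia.
have := strip_bound polyP I0 smin indD uniD fI; rewrite sE.
move: (cone_dim _) #|` _| => N g.
rewrite -(ler_nat R) natrD !natrM natrD -!natr1 natrM rmorphD /= -pmulrn => hN.
have s1 : 0 < s%:R + 1 :> R by rewrite ltr_wpDl.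
have -> : s%:R + 2%:~R - 1 = s%:R + 1 :> R by rewrite -[2%:~R]/(2 : R); ring.
rewrite -[2%:~R]/(2 : R) -(ler_pM2l s1); apply: le_trans hN _.
rewrite le_eqVlt; apply/orP; left; apply/eqP.
by field; rewrite gt_eqF.
Qed.

Theorem theorem1p4 (R : realType) (P : set 'cV[R]_2) (g : nat) (d : int)
    (maxP : maximal_polygon P)
    (gE : g = #|` interior_points P|)
    (dE : d = egon P)
    (d_gt1 : 1 < d) :
  (dim_moduli P)%:R <= g%:R + (2 * g%:R) / (d%:~R - 1) + 2 * d%:~R - 3 :> R.
Proof.
rewrite gE dE in d_gt1 *; have [polyP _] := maxP.
rewrite /dim_moduli; elim/big_ind: _ => [|m n hm hn|D /asboolP regD].
(* The maximum over no triangulation is 0, and d >= 2 makes 2 d - 3 positive. *)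
- have d1R : 1 < (egon P)%:~R :> R by rewrite -[1]/(1%:~R) ltr_int.
  have d2R : 2 <= (egon P)%:~R :> R by rewrite -[2]/(2%:~R) ler_int.
  have : 0 <= (2 * #|` interior_points P|%:R) / ((egon P)%:~R - 1) :> R.
    by rewrite divr_ge0 ?mulr_ge0 ?ler0n // subr_ge0 ltW.
  by have := ler0n R #|` interior_points P|; lra.
- by rewrite /maxn; case: ifP.
exact: egon_bound.
Qed.
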